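(* Let $p$ be a prime number, and let $G$ be a finite group that is not a $(p,q)$-Dress group for any prime number $q$. Then: (a) if all proper quotients of $G$ are $p$-hypo-elementary, then $\mathrm{Prim}_{K_{\mathbb{F}_p}}(G)\cong \mathbb{Z}$; (b) if $q$ is a prime number such that all proper quotients of $G$ are $(p,q)$-Dress groups, and at least one of them is not $p$-hypo-elementary, then $\mathrm{Prim}_{K_{\mathbb{F}_p}}(G)\cong \mathbb{Z}/q\mathbb{Z}$; (c) if there exists a proper quotient of $G$ that is not a $(p,q)$-Dress group for any prime number $q$, or if there exist distinct prime numbers $q_1$ and $q_2$ and, for $i=1$ and $2$, a proper quotient of $G$ that is a non-$p$-hypo-elementary $(p,q_i)$-Dress group, then $\mathrm{Prim}_{K_{\mathbb{F}_p}}(G)$ is trivial. Moreover, in all cases, $\mathrm{Prim}_{K_{\mathbb{F}_p}}(G)$ is generated by (the image of) any element of $K_{\mathbb{F}_p}(G)\subseteq B(G)$ of the form $[G/G]+\sum_{H\lneq G}a_H[G/H]$ with $a_H\in \mathbb{Z}$.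
   Context: For a finite group $G$, the Burnside ring $B(G)$ is, as a group, the free abelian group on isomorphism classes $[G/H]$ of transitive $G$-sets; the class of a finite $G$-set is the sum of the classes of its orbits. $R_{\mathbb{F}_p}(G)$ is the free abelian group on isomorphism classes of finitely generated indecomposable $\mathbb{F}_p[G]$-modules (equivalently, the free abelian group on isomorphism classes $[V]$ of finitely generated $\mathbb{F}_p[G]$-modules modulo the relations $[U\oplus V]=[U]+[V]$; this is not the Grothendieck group with respect to short exact sequences). There is a homomorphism $B(G)\to R_{\mathbb{F}_p}(G)$ sending the class of a $G$-set $X$ to the class of the permutation module $\mathbb{F}_p[X]$; its kernel is denoted $K_{\mathbb{F}_p}(G)$. For a subgroup $H\le G$, induction $K_{\mathbb{F}_p}(H)\to K_{\mathbb{F}_p}(G)$ is the additive map given by induction of sets, $[H/U]\mapsto [G/U]$. For a normal subgroup $N$ of $G$, inflation (lifting) $K_{\mathbb{F}_p}(G/N)\to K_{\mathbb{F}_p}(G)$ is the additive map that regards a $G/N$-set as a $G$-set via $G\to G/N$. $\mathrm{Imprim}_{K_{\mathbb{F}_p}}(G)$ is the subgroup of $K_{\mathbb{F}_p}(G)$ generated by all elements induced from $K_{\mathbb{F}_p}(H)$ for proper subgroups $H\lneq G$ and all elements inflated from $K_{\mathbb{F}_p}(G/N)$ for normal subgroups $N\neq 1$ of $G$, and $\mathrm{Prim}_{K_{\mathbb{F}_p}}(G)=K_{\mathbb{F}_p}(G)/\mathrm{Imprim}_{K_{\mathbb{F}_p}}(G)$. A proper quotient of $G$ is a quotient $G/N$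 with $N\neq 1$ normal in $G$. For prime numbers $p,q$ (possibly equal): a finite group is $q$-quasi-elementary if it has a normal cyclic subgroup of $q$-power index; it is $p$-hypo-elementary if it has a normal $p$-subgroup with cyclic quotient; it is a $(p,q)$-Dress group if it has a normal $p$-subgroup with $q$-quasi-elementary quotient. (Trivial groups are allowed as $p$-groups, and index $1$ counts as a $q$-power index.) *)

(* Defs.v *)
From HB Require Import structures.
From mathcomp Require Import all_boot all_algebra all_fingroup all_solvable.
From mathcomp Require Import mxrepresentation character ring_quotient generic_quotient.
From mathcomp Require Import freeg.
From mathcomp Require Import boolp classical_sets.

Set Implicit Arguments.
Unset Strict Implicit.
Unset Printing Implicit Defensive.

Import GRing.Theory.
Local Open Scope ring_scope.
Local Open Scope quotient_scope.

Definition zmod_isom (U V : zmodType) : Prop :=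
  exists f : {additive U -> V}, bijective f.

Definition zspan (V : zmodType) (A : set V) : {pred V} :=
  fun x => `[< smallest (fun S : set V => zmod_closed (mem S)) A x >].

Lemma zspan_zmod_closed (V : zmodType) (A : set V) : zmod_closed (zspan A).
Proof.
split=> [|x y xA yA]; apply/asboolP=> S [[S0 SB] AS].
  exact: set_mem.
have memS z : z \in zspan A -> z \in S.
  by move=> /asboolP zA; apply/mem_set; apply: zA.
by apply: set_mem; apply: SB; apply: memS.
Qed.

HB.instance Definition _ (V : zmodType) (A : set V) :=
  GRing.isZmodClosed.Build V (zspan A) (zspan_zmod_closed A).

Section Groups.
Local Open Scope group_scope.
Variable gT : finGroupType.
Implicit Type G : {set gT}.

Definition quasi_elementary (q : nat) G : bool :=
  [exists C : {group gT}, [&& C <| G, cyclic C & q.-nat #|G : C|]].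

Definition hypo_elementary (p : nat) G : bool :=
  [exists P : {group gT}, [&& P <| G, p.-group P & cyclic (G / P)]].

End Groups.

Definition Dress_group (gT : finGroupType) (p q : nat) (G : {set gT}) : bool :=
  [exists P : {group gT},
    [&& P <| G, p.-group P & quasi_elementary q (G / P)]]%g.

(* MathComp actions are right actions, so G-sets are right G-sets: a G-set is  *)
(* a subset S of a finite type on which the group G acts through [to], and the *)
(* transitive G-set G/H is the set of right cosets of H with G acting by right *)
(* translation.                                                                *)

Definition gset_isom (gT : finGroupType) (G : {set gT})
    (D1 : {set gT}) (T1 : finType) (to1 : action D1 T1) (S1 : {set T1})
    (D2 : {set gT}) (T2 : finType) (to2 : action D2 T2) (S2 : {set T2}) : bool :=
  [exists f : {ffun T1 -> T2},
    [&& dinjectiveb f S1, f @: S1 == S2 &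
        [forall x in S1, forall a in G, f (to1 x a) == to2 (f x) a]]].

Section Burnside.
Variables (gT : finGroupType) (G : {group gT}).

(* The isomorphism class of a transitive G-set S, recorded as the set of all   *)
(* subgroups H of G with G/H isomorphic to S.                                  *)
Definition trans_class (D : {set gT}) (T : finType) (to : action D T)
    (S : {set T}) : {set {group gT}} :=
  [set H in subgroups G | gset_isom G 'Rs%act (rcosets H G) to S].

Definition trans_classes : {set {set {group gT}}} :=
  [set trans_class 'Rs%act (rcosets (H : {group gT}) G) | H in subgroups G].

Definition trans_type := {c | c \in trans_classes}.

(* A subgroup H of G with [G/H] = c; only its G-conjugacy class is determined  *)
(* by c, and nothing below depends on the choice.                              *)
Definition trans_repr (c : trans_type) : {group gT} :=
  odflt 1%G [pick H in val c].

Definition burnside := {ffun trans_type -> int}.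
HB.instance Definition _ := GRing.Zmodule.on burnside.

Definition gset_class (D : {set gT}) (T : finType) (to : action D T)
    (S : {set T}) : burnside :=
  \sum_(O in orbit to G @: S) [ffun c => (val c == trans_class to O)%:R].

Definition coset_class (H : {group gT}) : burnside :=
  gset_class 'Rs%act (rcosets H G).

Definition burnside_lift (V : zmodType) (f : trans_type -> V) (x : burnside) : V :=
  \sum_c f c *~ x c.

Lemma burnside_lift_is_zmod_morphism (V : zmodType) (f : trans_type -> V) :
  zmod_morphism (burnside_lift f).
Proof.
move=> x y; rewrite /burnside_lift -sumrB; apply: eq_bigr => c _.
by rewrite !ffunE mulrzBr.
Qed.

HB.instance Definition _ (V : zmodType) (f : trans_type -> V) :=
  GRing.isZmodMorphism.Build burnside V (burnside_lift f)
    (burnside_lift_is_zmod_morphism f).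

End Burnside.

(* The additive map sending [H/U] to [G/U]. *)
Definition ind (gT : finGroupType) (H G : {group gT}) : burnside H -> burnside G :=
  burnside_lift (fun c => coset_class G (trans_repr c)).

(* The additive map regarding a G/N-set as a G-set, where G acts through the   *)
(* canonical projection (defined on the normaliser of N).                      *)
Definition infl (gT : finGroupType) (G N : {group gT}) :
    burnside (G / N)%G -> burnside G :=
  burnside_lift (fun c =>
    gset_class G ('Rs \o coset_morphism N)%act
      (rcosets (trans_repr c) (G / N)%g)).

Section RepresentationGroup.
Variables (F : fieldType) (gT : finGroupType) (G : {group gT}).

Definition modules := {classic representation F G}.

(* Imposing [U] = [V] for isomorphic U and V turns the free group on modules   *)
(* into the free group on isomorphism classes of modules.                      *)
Definition rep_relations : set {freeg modules / int} :=
  [set z | exists U V : representation F G,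
     mx_rsim U V /\ z = << U : modules >> - << V : modules >>] `|`
  [set z | exists U V : representation F G,
     z = << dadd_grepr U V : modules >>
         - (<< U : modules >> + << V : modules >>)].

(* Not a Grothendieck group for exact sequences: only direct sums are split.   *)
Definition rep_group := Quotient.quot (zspan rep_relations).
HB.instance Definition _ := GRing.Zmodule.on rep_group.

Definition rep_class (V : representation F G) : rep_group :=
  \pi_(Quotient.quot (zspan rep_relations)) << V : modules >>.

Section PermutationModule.
Variables (D : {group gT}) (T : finType) (to : action D T) (S : {set T}).

Definition permutation_mx (g : gT) : 'M[F]_#|S| :=
  \matrix_(i, j) (to (enum_val i) g == enum_val j)%:R.

Lemma permutation_mx_repr : [acts G, on S | to] -> mx_repr G permutation_mx.
Proof.
move=> actS; split=> [|x y Gx Gy].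
  by apply/matrixP=> i j; rewrite !mxE act1 (inj_eq enum_val_inj).
have Dx : x \in D by have:= fintype.subsetP actS x Gx; rewrite !inE => /andP[].
have Dy : y \in D by have:= fintype.subsetP actS y Gy; rewrite !inE => /andP[].
apply/matrixP=> i j; rewrite !mxE.
have Sx : to (enum_val i) x \in S by rewrite (acts_act actS) ?enum_valP.
rewrite (bigD1 (enum_rank_in Sx (to (enum_val i) x))) //= !mxE.
rewrite enum_rankK_in // eqxx mul1r actMin // big1 ?addr0 // => k neq_k.
rewrite !mxE; case: eqP => [eq_k|_]; last by rewrite mul0r.
by case/negP: neq_k; apply/eqP/enum_val_inj; rewrite enum_rankK_in -?eq_k.
Qed.

Definition permutation_module (actS : [acts G, on S | to]) : representation F G :=
  Representation (MxRepresentation (permutation_mx_repr actS)).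

End PermutationModule.

Definition burnside_to_rep : burnside G -> rep_group :=
  burnside_lift (fun c =>
    rep_class (permutation_module (actsRs_rcosets (trans_repr c) G))).
HB.instance Definition _ := GRing.Additive.on burnside_to_rep.

End RepresentationGroup.

Section Relations.
Variables (p : nat) (gT : finGroupType) (G : {group gT}).

Definition is_relation : {pred burnside G} :=
  fun x => burnside_to_rep 'F_p x == 0.

Lemma is_relation_zmod_closed : zmod_closed is_relation.
Proof.
split=> [|x y]; rewrite !unfold_in ?raddf0 // => /eqP x0 /eqP y0.
by rewrite raddfB /= x0 y0 subr0.
Qed.

HB.instance Definition _ :=
  GRing.isZmodClosed.Build (burnside G) is_relation is_relation_zmod_closed.

Record relation_group :=
  RelationGroup { relation_val :> burnside G; _ : relation_val \in is_relation }.

HB.instance Definition _ := [isSub for relation_val].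
HB.instance Definition _ := [Choice of relation_group by <:].
HB.instance Definition _ := [SubChoice_isSubZmodule of relation_group by <:].

End Relations.

Section Primitive.
Local Open Scope group_scope.
Variables (p : nat) (gT : finGroupType) (G : {group gT}).

Definition induced_relations : set (relation_group p G) :=
  [set y | exists (H : {group gT}) (x : relation_group p H),
     H \proper G /\ relation_val y = ind G x].

Definition inflated_relations : set (relation_group p G) :=
  [set y | exists (N : {group gT}) (x : relation_group p (G / N)%G),
     [/\ N <| G, N :!=: 1 & relation_val y = infl x]].

Definition imprim : {pred relation_group p G} :=
  zspan (induced_relations `|` inflated_relations).
HB.instance Definition _ := GRing.ZmodClosed.on imprim.

Definition prim := Quotient.quot imprim.
HB.instance Definition _ := GRing.Zmodule.on prim.

Definition prim_class (x : relation_group p G) : prim := \pi_(Quotient.quot imprim) x.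

End Primitive.

(* Main.v *)
(* Write f_H : B(G) -> Z for the mark X |-> |X^H|. The heart of the proof is that x lies in K(G) iff
   f_H(x) = 0 for every p-hypo-elementary H <= G.

   Necessity: the rank of the pairing M^H x (M^* )^H -> F_p is additive in M, and on F_p[X] it counts the
   H-orbits of length prime to p; if P is the normal Sylow p-subgroup of H, this number is an average of
   the marks at the groups P<h>.

   Sufficiency: modules with the same dim Hom_G(-, L) for all L are isomorphic, so x lies in K(G) iff
   D_x(L) := sum_H x_H dim L^H vanishes for all L; in particular B(G)/K(G) is torsion-free. By induction,
   for G not p-hypo-elementary it suffices to find one element of K(G) with a nonzero mark at G. If
   O_p(G) <> 1, inflate one from G/O_p(G). If O_p(G) = 1, let z have vanishing marks at all proper
   subgroups. Then D_z is additive on short exact sequences: the defect of left exactness is controlled by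
   nontrivial p-subgroups P and by the marks of z at subgroups of N_G(P) < G. Hence M |-> D_z(Hom(M, L))
   only depends on the composition factors of M. The marks of z at cyclic groups vanish, so F_p[z] has the
   same composition factors as 0, and this gives D_z(L) = 0.

   If f_G(theta) = 1 with theta in K(G), an element z of K(G) with f_G(z) = 0 equals
   z theta + (1 - theta) z, and both products are combinations of relations induced from proper subgroups.
   So Prim(G) = Z / f_G(Imprim(G)), where f_G(Imprim(G)) is the sum of the f_{G/N}(K(G/N)) for N <> 1.
   Finally f_G(K(G)) is 0, qZ or Z when G is p-hypo-elementary, a (p,q)-Dress group that is not
   p-hypo-elementary, or not a (p,q)-Dress group for any q; this rests on f_G = f_U mod q for U = O^q(G)
   and on the fact that G is a (p,q)-Dress group iff U is p-hypo-elementary. *)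

From HB Require Import structures.
From mathcomp Require Import all_boot all_order all_algebra all_fingroup all_solvable.
From mathcomp Require Import all_field mxrepresentation mxabelem classfun character.
From mathcomp Require boolp classical_sets ring_quotient generic_quotient freeg.
Require Import Defs.

Set Implicit Arguments.
Unset Strict Implicit.
Unset Printing Implicit Defensive.
Import GRing.Theory Num.Theory.
Local Open Scope ring_scope.
Local Open Scope group_scope.

(** * Transfers between fixed spaces *)

(** The obstacle is sufficiency. Marks see only fixed points of sets, whereas membership in K(G)
    amounts to an isomorphism of modules in characteristic p, which neither characters nor
    composition factors decide. The dimensions dim L^H do decide it, but they are not exact in L.
    The way out is that the cokernel of V^H -> W^H, for V onto W, is a quotient of Mackey functors
    that vanishes at H = 1. It can be cut into layers, each generated and detected at the conjugates
    of a single p-subgroup P; on such a layer the dimension at H is a function of the intersections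
    of N_G(P) with the conjugates of H, and these are what the marks control. Once exactness is
    restored, only composition factors matter, and these can be compared through integral
    characteristic polynomials, which pass from characteristic 0 to p. Since B(G)/K(G) is
    torsion-free, integral multiples of idempotents do the work of the idempotents themselves. *)

Lemma mem_repr_rcosetP (gT : finGroupType) (K : {group gT}) x :
  exists2 k, k \in K & repr (K :* x) = k * x.
Proof. by case/rcosetP: (mem_repr_rcoset K x) => k Kk ->; exists k. Qed.

Lemma rcosetJ (gT : finGroupType) (K : {group gT}) (x g : gT) :
  (K :* x) :^ g = (K :^ g) :* (x ^ g).
Proof. by rewrite conjsMg conjg_set1. Qed.

Section Transfer.
Variables (F : fieldType) (gT : finGroupType) (G : {group gT}) (n : nat).
Variable r : mx_representation F G n.
Implicit Types (H K T P Q : {group gT}).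

(** The relative trace V^K -> V^H. It depends on the chosen representatives except on vectors fixed
    by K, hence the recurring assumption that u lies in [rfix_mx r K]. *)
Definition tr_mx (K H : {set gT}) : 'M[F]_n :=
  (\sum_(C in rcosets K H) r (repr C))%R.

Lemma rfix_coset m (u : 'M_(m, n)) K x y :
    K \subset G -> (u <= rfix_mx r K)%MS -> x \in G -> y \in K :* x ->
  u *m r y = u *m r x.
Proof.
move=> sKG /rfix_mxP fixu Gx /rcosetP[k Kk ->].
have Gk := subsetP sKG k Kk.
by rewrite repr_mxM // mulmxA fixu.
Qed.

Lemma rfix_repr m (u : 'M_(m, n)) K x :
    K \subset G -> (u <= rfix_mx r K)%MS -> x \in G ->
  u *m r (repr (K :* x)) = u *m r x.
Proof.
move=> sKG fixu Gx; apply: rfix_coset fixu Gx _ => //.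
exact: mem_repr_rcoset.
Qed.

Lemma mulmx_tr m (u : 'M_(m, n)) K H :
  u *m tr_mx K H = (\sum_(C in rcosets K H) u *m r (repr C))%R.
Proof. exact: mulmx_sumr. Qed.

(** Mackey's double coset formula, kept as an inclusion. Right translation by T splits the cosets K
    x into orbits, and the orbit of K x contributes u x followed by the trace from K^x :&: T to T. A
    T-stable predicate [Q] allows some double cosets to be left out. *)
Lemma tr_mackey_sub m (u : 'M_(m, n)) m' (W : 'M_(m', n)) K H T (Q : pred {set gT}) :
    K \subset H -> T \subset H -> H \subset G -> (u <= rfix_mx r K)%MS ->
    (forall x t, x \in H -> t \in T -> Q (K :* (x * t)) = Q (K :* x)) ->
    (forall x, x \in H -> Q (K :* x) ->
      (u *m r x *m tr_mx (K :^ x :&: T) T <= W)%MS) ->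
  ((\sum_(C in rcosets K H | Q C) u *m r (repr C))%R <= W)%MS.
Proof.
move=> sKH sTH sHG fixu QT subW.
have sKG := subset_trans sKH sHG; have sTG := subset_trans sTH sHG.
pose S := [set C in rcosets K H | Q C].
have actS : [acts T, on S | 'Rs].
  apply/subsetP=> t Tt; rewrite !inE; apply/subsetP=> C; rewrite !inE.
  case/andP=> /rcosetsP[x Hx ->] Qx /=; rewrite rcosetE -rcosetM QT // Qx andbT.
  by rewrite mem_rcosets mulSGid // groupM // (subsetP sTH).
rewrite (eq_bigl (mem S)) => [|C]; last by rewrite !inE.
rewrite (set_partition_big _ (orbit_partition actS)) /=.
apply: summx_sub => _ /imsetP[C SC ->].
move: SC; rewrite inE => /andP[/rcosetsP[x Hx ->] Qx].
have Gx := subsetP sHG x Hx.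
(* [h] parametrizes the orbit of K x by the cosets of its stabilizer K^x :&: T in T, the index set
   of the trace. *)
pose h (D : {set gT}) := K :* (x * repr D).
have defO : orbit 'Rs T (K :* x) = h @: rcosets (K :^ x :&: T) T.
  apply/setP=> C'; apply/orbitP/imsetP=> [[t Tt <-] | [D]].
    exists ((K :^ x :&: T) :* t); first by apply/rcosetsP; exists t.
    rewrite /h /= rcosetE -rcosetM; have [k] := mem_repr_rcosetP [group of K :^ x :&: T] t.
    rewrite inE mem_conjg => /andP[Kk _] ->; apply/rcoset_eqP.
    rewrite mem_rcoset; have -> : x * t * (x * (k * t))^-1 = (k ^ x^-1)^-1.
      by rewrite conjgE !invMg !invgK !mulgA mulgK.
    by rewrite groupV.
  case/rcosetsP=> t Tt -> ->; have [k] := mem_repr_rcosetP [group of K :^ x :&: T] t.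
  rewrite inE /h => /andP[_ Tk] /= ->.
  by exists (k * t); rewrite ?groupM //= rcosetE -rcosetM.
have hinj : {in rcosets (K :^ x :&: T) T &, injective h}.
  move=> _ _ /rcosetsP[s Ts ->] /rcosetsP[t Tt ->]; rewrite /h.
  have [k1 K1 /= ->] := mem_repr_rcosetP [group of K :^ x :&: T] t.
  have [k2 K2 /= ->] := mem_repr_rcosetP [group of K :^ x :&: T] s.
  have e1 : (K :^ x :&: T) :* t = (K :^ x :&: T) :* (k1 * t).
    by apply/rcoset_eqP; rewrite mem_rcoset invMg mulgA mulgV mul1g (groupV [group of K :^ x :&: T]).
  have e2 : (K :^ x :&: T) :* s = (K :^ x :&: T) :* (k2 * s).
    by apply/rcoset_eqP; rewrite mem_rcoset invMg mulgA mulgV mul1g (groupV [group of K :^ x :&: T]).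
  rewrite e1 e2; have T1 : k1 * t \in T by rewrite groupM //; case/setIP: K1.
  have T2 : k2 * s \in T by rewrite groupM //; case/setIP: K2.
  move: {e1 e2 K1 K2} T1 T2; move: (k1 * t) (k2 * s) => a b Ta Tb eqab.
  apply/rcoset_eqP; rewrite mem_rcoset; apply/setIP; split.
    rewrite mem_conjg conjgE invgK.
    have : x * b \in K :* (x * a) by rewrite -eqab rcoset_refl.
    by rewrite mem_rcoset invMg !mulgA.
  by rewrite groupM ?groupV.
rewrite defO big_imset //=.
suff -> : (\sum_(D in rcosets (K :^ x :&: T) T) u *m r (repr (h D)))%R
          = u *m r x *m tr_mx (K :^ x :&: T) T by apply: subW.
rewrite mulmx_tr; apply: eq_bigr => _ /rcosetsP[t Tt ->]; rewrite /h.
have [k /setIP[_ Tk] /= ->] := mem_repr_rcosetP [group of K :^ x :&: T] t.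
have Gkt: k * t \in G by rewrite (subsetP sTG) ?groupM.
have Gxkt: x * (k * t) \in G by rewrite groupM.
rewrite (rfix_repr sKG fixu Gxkt). by rewrite repr_mxM // mulmxA.
Qed.

Lemma tr_trans m (u : 'M_(m, n)) P K H :
    P \subset K -> K \subset H -> H \subset G -> (u <= rfix_mx r P)%MS ->
  u *m tr_mx P K *m tr_mx K H = u *m tr_mx P H.
Proof.
move=> sPK sKH sHG fixu; have sKG := subset_trans sKH sHG.
have sPG := subset_trans sPK sKG; rewrite !mulmx_tr.
rewrite [RHS](partition_big (fun C : {set gT} => K :* repr C) [in rcosets K H]) /=.
  apply: eq_bigr => _ /rcosetsP[y Hy ->].
  have [k Kk /= ->] := mem_repr_rcosetP K y.
  pose x := k * y; have Hx : x \in H by rewrite groupM // (subsetP sKH).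
  have Gx := subsetP sHG x Hx.
  have -> : K :* y = K :* x.
    by apply/rcoset_eqP; rewrite mem_rcoset invMg mulgA mulgV mul1g groupV.
  pose h (D : {set gT}) := D :* x.
  have hinj : {in rcosets P K &, injective h}.
    by move=> C D _ _ /(congr1 (fun A => A :* x^-1)); rewrite /h !rcosetK.
  rewrite -/x [RHS](_ : _ = (\sum_(C in h @: rcosets P K) u *m r (repr C))%R).
    rewrite [RHS](big_imset _ hinj) mulmx_suml /=; apply: eq_bigr => _ /rcosetsP[z Kz ->].
    have Gz := subsetP sKG z Kz.
    have Gzx : z * x \in G by rewrite groupM.
    by rewrite /h -rcosetM !(rfix_repr sPG fixu) // repr_mxM // mulmxA.
  apply: eq_bigl => C; apply/andP/imsetP=> [[/rcosetsP[z Hz ->]] | [_ /rcosetsP[z Kz ->] ->]].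
    have [p Pp /= ->] := mem_repr_rcosetP P z.
    move=> /eqP eqK; exists (P :* (z * x^-1)); last by rewrite /h -rcosetM mulgKV.
    apply/rcosetsP; exists (z * x^-1) => //.
    have : p * z \in K :* x by rewrite -eqK rcoset_refl.
    by rewrite mem_rcoset -mulgA groupMl // (subsetP sPK).
  rewrite /h -rcosetM; split.
    by apply/rcosetsP; exists (z * x) => //; rewrite groupM // (subsetP sKH).
  have [p Pp /= ->] := mem_repr_rcosetP P (z * x).
  apply/eqP/rcoset_eqP; rewrite mem_rcoset /x invMg !mulgA !mulgK groupM //.
  exact: (subsetP sPK).
move=> _ /rcosetsP[z Hz ->].
have [p Pp /= ->] := mem_repr_rcosetP P z; apply/rcosetsP; exists (p * z) => //.
by rewrite groupM // (subsetP sKH) // (subsetP sPK).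
Qed.

Lemma tr_conj m (u : 'M_(m, n)) K H g :
    K \subset H -> H \subset G -> g \in G -> (u <= rfix_mx r K)%MS ->
  u *m tr_mx K H *m r g = u *m r g *m tr_mx (K :^ g) (H :^ g).
Proof.
move=> sKH sHG Gg fixu; have sKG := subset_trans sKH sHG.
have fixug : (u *m r g <= rfix_mx r (K :^ g))%MS.
  by rewrite rfix_mx_conjsg // submxMr.
rewrite !mulmx_tr mulmx_suml.
have -> : rcosets (K :^ g) (H :^ g) = (conjugate^~ g) @: rcosets K H.
  apply/setP=> C; apply/rcosetsP/imsetP=> [[_ /imsetP[x Hx ->] ->] | [_ /rcosetsP[x Hx ->] ->]].
    by exists (K :* x); rewrite ?rcosetJ //; apply/rcosetsP; exists x.
  by exists (x ^ g); rewrite ?memJ_conjg // rcosetJ.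
rewrite [RHS]big_imset /=; last by move=> C D _ _; apply: conjsg_inj.
apply: eq_bigr => _ /rcosetsP[x Hx ->]; have Gx := subsetP sHG x Hx.
have sKgG : (K :^ g)%G \subset G by rewrite -(conjGid Gg) conjSg.
rewrite rcosetJ (rfix_repr sKgG fixug) ?groupJ // (rfix_repr sKG fixu) //.
by rewrite -!mulmxA -!repr_mxM ?groupJ // -conjgC.
Qed.

Lemma tr_index m (u : 'M_(m, n)) K H :
    K \subset H -> H \subset G -> (u <= rfix_mx r H)%MS ->
  u *m tr_mx K H = (#|H : K|%:R *: u)%R.
Proof.
move=> sKH sHG fixu; have sKG := subset_trans sKH sHG.
rewrite mulmx_tr (eq_bigr (fun=> u)) => [|_ /rcosetsP[x Hx ->]].
  by rewrite sumr_const scaler_nat.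
rewrite rfix_repr ?(submx_trans fixu) ?rfix_mxS // ?(subsetP sHG) //.
by move/rfix_mxP: fixu => ->.
Qed.

End Transfer.

(** * Mackey families of fixed vectors *)

Lemma mxrank_adds_coker (F : fieldType) m1 m2 n (U : 'M[F]_(m1, n)) (W : 'M_(m2, n)) :
  \rank (U + W)%MS = (\rank (U *m cokermx W) + \rank W)%N.
Proof.
rewrite -(mxrank_mul_ker (U + W)%MS (cokermx W)); congr (_ + _)%N.
  by rewrite addsmxMr mulmx_coker addsmx0.
apply/eqP; rewrite eqn_leq; apply/andP; split; apply: mxrankS.
  by apply/rV_subP=> v; rewrite sub_capmx => /andP[_ /sub_kermxP]; rewrite submxE => ->.
by rewrite sub_capmx addsmxSr; apply/sub_kermxP; apply: mulmx_coker.
Qed.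

(** Both sides are the dimension of an image of A in a quotient; by rank-nullity it suffices that
    the two maps have the same kernel on A. *)
Lemma mxrank_adds_eq (F : fieldType) m n n1 n2 m1 m2 (A : 'M[F]_(m, n))
    (M1 : 'M_(n, n1)) (W1 : 'M_(m1, n1)) (M2 : 'M_(n, n2)) (W2 : 'M_(m2, n2)) :
    (forall u : 'rV_n, (u <= A -> (u *m M1 <= W1) = (u *m M2 <= W2))%MS) ->
  (\rank (A *m M1 + W1)%MS - \rank W1 = \rank (A *m M2 + W2)%MS - \rank W2)%N.
Proof.
move=> eqker; rewrite !mxrank_adds_coker !addnK -!mulmxA.
apply: (@addIn (\rank (A :&: kermx (M1 *m cokermx W1))%MS)).
rewrite mxrank_mul_ker.
suff /eqmxP-> : (A :&: kermx (M1 *m cokermx W1) == A :&: kermx (M2 *m cokermx W2))%MS.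
  by rewrite mxrank_mul_ker.
apply/andP; split; apply/rV_subP=> u; rewrite !sub_capmx => /andP[Au];
  rewrite Au /= !sub_kermx !(mulmxA u) -!submxE eqker //.
Qed.

Section ConjugateSubgroups.
Variables (gT : finGroupType) (G P : {group gT}).
Hypothesis sPG : P \subset G.
Implicit Type Q : {group gT}.

Lemma orbitJ_sub Q : Q \in orbit 'JG%act G P -> Q \subset G.
Proof. by case/imsetP=> g Gg ->; rewrite /= -(conjGid Gg) conjSg. Qed.

Lemma orbitJ_card Q : Q \in orbit 'JG%act G P -> #|Q| = #|P|.
Proof. by case/imsetP=> g Gg ->; rewrite cardJg. Qed.

Lemma orbitJ_conj Q g : Q \in orbit 'JG%act G P -> g \in G -> (Q :^ g)%G \in orbit 'JG%act G P.
Proof.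
case/imsetP=> x Gx -> Gg; apply/imsetP; exists (x * g); rewrite ?groupM //.
by apply: val_inj; rewrite /= conjsgM.
Qed.

End ConjugateSubgroups.

Section Families.
Variables (F : fieldType) (gT : finGroupType) (G : {group gT}) (n : nat).
Variable r : mx_representation F G n.
Implicit Types (H K T P Q : {group gT}).

(* A subfunctor of the fixed point functor [H |-> V^H]. *)
Record mackey_family (A : {group gT} -> 'M[F]_n) : Prop := MackeyFamily {
  mf_fix : forall H, H \subset G -> (A H <= rfix_mx r H)%MS;
  mf_res : forall K H, K \subset H -> H \subset G -> (A H <= A K)%MS;
  mf_conj : forall H g, H \subset G -> g \in G -> (A H *m r g <= A (H :^ g)%G)%MS;
  mf_tr : forall K H, K \subset H -> H \subset G -> (A K *m tr_mx r K H <= A H)%MS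
}.

Section Layer.
Variables (A B : {group gT} -> 'M[F]_n) (P : {group gT}).
Hypotheses (famA : mackey_family A) (famB : mackey_family B).
Hypothesis sPG : P \subset G.
Hypothesis leBA : forall H, H \subset G -> (B H <= A H)%MS.
Hypothesis lowAB : forall Q, Q \subset G -> (#|Q| < #|P|)%N -> (A Q <= B Q)%MS.

Let cj (Q : {group gT}) := Q \in orbit 'JG%act G P.

(** By Mackey, a coset with P1^x != P2 contributes a trace from P1^x :&: P2, a subgroup smaller than
    P, where A already lies in B. *)
Lemma layer_tr_off m (u : 'M_(m, n)) P1 P2 H : cj P1 -> cj P2 ->
    P1 \subset H -> P2 \subset H -> H \subset G -> (u <= A P1)%MS ->
  ((\sum_(C in rcosets P1 H | P1 :^ repr C != P2) u *m r (repr C))%R <= B P2)%MS.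
Proof.
move=> cj1 cj2 sP1H sP2H sHG uA.
have sP1G := orbitJ_sub sPG cj1; have sP2G := orbitJ_sub sPG cj2.
have conj_repr x : P1 :^ repr (P1 :* x) = P1 :^ x.
  by have [k Pk ->] := mem_repr_rcosetP P1 x; rewrite conjsgM conjGid.
apply: (@tr_mackey_sub _ _ _ _ _ _ _ _ _ _ H P2 (fun C => P1 :^ repr C != P2)) => //.
- exact: submx_trans uA (mf_fix famA sP1G).
- move=> x t Hx P2t; rewrite !conj_repr conjsgM; congr (~~ _).
  by rewrite -{1}(conjGid P2t) (inj_eq (@conjsg_inj _ t)).
move=> x Hx; rewrite conj_repr => neqP.
have Gx := subsetP sHG x Hx.
pose R := (P1 :^ x :&: P2)%G.
have sRP2 : R \subset P2 by apply: subsetIr.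
have ltR : (#|R| < #|P|)%N.
  rewrite -(orbitJ_card cj2) proper_card // properEneq sRP2 andbT.
  apply: contraNneq neqP => /setIidPr sP2; rewrite eq_sym eqEcard sP2 cardJg.
  by rewrite /= (orbitJ_card cj1) -(orbitJ_card cj2).
have sRG : R \subset G := subset_trans sRP2 sP2G.
have sP1xG : (P1 :^ x)%G \subset G by rewrite -(conjGid Gx) conjSg.
apply: submx_trans (mf_tr famB sRP2 sP2G); apply: submxMr.
apply: submx_trans (lowAB sRG ltR).
apply: submx_trans (mf_res famA (subsetIl _ _) sP1xG).
by apply: submx_trans (mf_conj famA sP1G Gx); apply: submxMr.
Qed.

Lemma layer_tr_disjoint m (u : 'M_(m, n)) P1 P2 H : cj P1 -> cj P2 ->
    P1 \subset H -> P2 \subset H -> H \subset G -> (u <= A P1)%MS ->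
    P2 \notin orbit 'JG%act H P1 ->
  (u *m tr_mx r P1 H <= B P2)%MS.
Proof.
move=> cj1 cj2 sP1H sP2H sHG uA notP2.
rewrite mulmx_tr.
rewrite (eq_bigl (fun C : {set gT} => (C \in rcosets P1 H) && (P1 :^ repr C != P2))).
  exact: layer_tr_off.
move=> C; rewrite andb_idr // => /rcosetsP[x Hx ->].
apply: contraNneq notP2 => defP2; apply/imsetP.
have [k Pk eqr] := mem_repr_rcosetP P1 x.
exists (repr (P1 :* x)); last by apply: val_inj; rewrite /= defP2.
by rewrite eqr groupM // (subsetP sP1H).
Qed.

(** Modulo B Q, the restriction to Q of a trace from Q keeps only the cosets that normalize Q. *)
Lemma layer_tr_self m (u : 'M_(m, n)) Q H : cj Q -> Q \subset H -> H \subset G ->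
  (u <= A Q)%MS -> (u *m tr_mx r Q H - u *m tr_mx r Q 'N_H(Q) <= B Q)%MS.
Proof.
move=> cjQ sQH sHG uA; rewrite !mulmx_tr.
rewrite (bigID (fun C : {set gT} => Q :^ repr C == Q)) /=.
rewrite (_ : (\sum_(C | (C \in rcosets Q H) && (Q :^ repr C == Q)) u *m r (repr C))%R
     = (\sum_(C in rcosets Q 'N_H(Q)) u *m r (repr C))%R).
  by rewrite addrC addrK; apply: layer_tr_off.
apply: eq_bigl => C; apply/andP/rcosetsP=> [[/rcosetsP[x Hx ->]] | [x]].
  have [k Qk ->] := mem_repr_rcosetP Q x; rewrite conjsgM conjGid // => /eqP nQx.
  by exists x => //; rewrite inE Hx /=; apply/normP.
case/setIP=> Hx Nx ->; split; first by apply/rcosetsP; exists x.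
have [k Qk ->] := mem_repr_rcosetP Q x; rewrite conjsgM conjGid //.
by apply/eqP/normP.
Qed.

(** The dimension of the image in A Q / B Q of the trace from Q to T. It takes plain sets so that
    conjugates and intersections can be plugged in directly; [<<Q>>] is Q itself when Q is a
    group. *)
Definition layer_rank (Q T : {set gT}) : nat :=
  (\rank (A <<Q>>%G *m tr_mx r Q T + B <<Q>>%G)%MS - \rank (B <<Q>>%G))%N.

Let layer_rankE Q T : layer_rank Q T =
  (\rank (A Q *m tr_mx r Q T + B Q)%MS - \rank (B Q))%N.
Proof. by rewrite /layer_rank (_ : <<Q>>%G = Q) //; apply: val_inj; rewrite /= genGid. Qed.

Hypothesis genAB : forall H, H \subset G ->
  (A H <= B H + \sum_(Q : {group gT} | cj Q && (Q \subset H)) A Q *m tr_mx r Q H)%MS.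
Hypothesis detAB : forall H (u : 'rV_n), H \subset G -> (u <= A H)%MS ->
  (forall Q, cj Q -> Q \subset H -> (u <= B Q)%MS) -> (u <= B H)%MS.

(** Traces from distinct H-classes are independent modulo B H: restriction to Q sends those from
    outside the class of Q into B Q, and by [detAB] membership in B H is detected at the conjugates
    of P. *)
Lemma layer_orbit_rank (H : {group gT}) (s : seq {group gT}) :
    H \subset G -> uniq s -> {in s, forall Q, cj Q && (Q \subset H)} ->
    {in s &, forall Q1 Q2, Q2 \in orbit 'JG%act H Q1 -> Q1 = Q2} ->
  \rank (B H + \sum_(Q <- s) A Q *m tr_mx r Q H)%MS
    = (\rank (B H) + \sum_(Q <- s) layer_rank Q 'N_H(Q))%N.
Proof.
move=> sHG; elim: s => [_ _ _|Q s IHs /= /andP[sQ uniq_s] cjs orbs].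
  by rewrite !big_nil addn0 addsmx0.
have cjs' : {in s, forall Q, cj Q && (Q \subset H)}.
  by move=> Q1 s1; apply: cjs; rewrite inE s1 orbT.
have orbs' : {in s &, forall Q1 Q2, Q2 \in orbit 'JG%act H Q1 -> Q1 = Q2}.
  by move=> Q1 Q2 s1 s2; apply: orbs; rewrite inE ?s1 ?s2 orbT.
have /andP[cjQ sQH] := cjs _ (mem_head _ _).
have sQG := orbitJ_sub sPG cjQ.
rewrite !big_cons; set S := (\sum_(j <- s) _)%MS in IHs *.
rewrite addnCA -(IHs uniq_s cjs' orbs').
have -> : \rank (B H + (A Q *m tr_mx r Q H + S))%MS = \rank (A Q *m tr_mx r Q H + (B H + S))%MS.
  by rewrite addsmxA [in RHS]addsmxA [(A Q *m _ + B H)%MS]addsmxC.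
rewrite -(@subnK (\rank (B H + S)%MS) (\rank _)); last by rewrite mxrankS // addsmxSr.
congr (_ + _)%N; rewrite layer_rankE; apply: mxrank_adds_eq => u uA.
have uAH : (u *m tr_mx r Q H <= A H)%MS.
  by apply: submx_trans (mf_tr famA sQH sHG); apply: submxMr.
have self := layer_tr_self cjQ sQH sHG uA.
have trN_B : (u *m tr_mx r Q H <= B Q)%MS = (u *m tr_mx r Q 'N_H(Q) <= B Q)%MS.
  apply/idP/idP=> inB; last first.
    by rewrite -[u *m tr_mx r Q H](subrK (u *m tr_mx r Q 'N_H(Q))) addmx_sub.
  rewrite -[u *m tr_mx r Q 'N_H(Q)](subKr (u *m tr_mx r Q H)) addmx_sub //.
  by rewrite -scaleN1r scalemx_sub.
rewrite -trN_B; apply/idP/idP=> [inW | inB].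
  case/sub_addsmxP: inW => -[w1 w2] /= ->; apply: addmx_sub.
    apply: submx_trans (submxMl _ _) _. exact: (mf_res famB sQH sHG).
  apply: submx_trans (submxMl _ _) _; rewrite /S big_seq.
  apply: (big_ind (fun M => (M <= B Q)%MS)) => [|M1 M2 s1 s2|Q1 sQ1].
  - exact: sub0mx.
  - by rewrite addsmx_sub s1.
  have /andP[cj1 sQ1H] := cjs' _ sQ1.
  apply: layer_tr_disjoint => //; apply/negP=> orbQ.
  case/negP: sQ; rewrite -(orbs Q1 Q _ _ orbQ) ?mem_head //.
  by rewrite inE sQ1 orbT.
apply: submx_trans (addsmxSl _ _); apply: detAB => // P2 cj2 sP2H.
have [|notorb] := boolP (P2 \in orbit 'JG%act H Q); last exact: layer_tr_disjoint.
(* A trace to H is fixed by h, so its membership in B Q carries over to the conjugate of Q by h. *)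
case/imsetP=> h Hh ->; have Gh := subsetP sHG h Hh.
have -> : u *m tr_mx r Q H = u *m tr_mx r Q H *m r h.
  by have /rfix_mxP-> := submx_trans uAH (mf_fix famA sHG).
by apply: submx_trans (mf_conj famB sQG Gh); apply: submxMr.
Qed.

Lemma layer_rankJ Q T g : cj Q -> Q \subset T -> T \subset G -> g \in G ->
  layer_rank (Q :^ g) (T :^ g) = layer_rank Q T.
Proof.
move=> cjQ sQT sTG Gg; have sQG := orbitJ_sub sPG cjQ.
rewrite (layer_rankE (Q :^ g)%G) layer_rankE.
have eqJ D K (famD : mackey_family D) : K \subset G -> (D (K :^ g)%G :=: D K *m r g)%MS.
  move=> sKG; apply/eqmxP/andP; split; last exact: mf_conj.
  have sKgG : (K :^ g)%G \subset G by rewrite -(conjGid Gg) conjSg.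
  have := mf_conj famD sKgG (groupVr Gg).
  rewrite (_ : ((K :^ g) :^ g^-1)%G = K); last by apply: val_inj; rewrite /= conjsgK.
  by move/(submxMr (r g)); rewrite repr_mxKV.
have uG : row_free (r g) by rewrite row_free_unit repr_mx_unit.
have eqA := eqmxMr (tr_mx r (Q :^ g) (T :^ g)) (eqJ A Q famA sQG).
have eqB := eqJ B Q famB sQG.
rewrite (adds_eqmx eqA eqB) eqB.
rewrite -tr_conj ?(mf_fix famA) // -addsmxMr !mxrankMfree //.
Qed.

(** By [genAB] the previous sum exhausts A H. The factor |H| replaces a sum over H-classes by a sum
    over all their members, the class of Q having |H : N_H(Q)| of them. *)
Lemma layer_rank_sum (H : {group gT}) : H \subset G ->
  (#|H| * (\rank (A H) - \rank (B H)) =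
   \sum_(Q : {group gT} | cj Q && (Q \subset H)) #|'N_H(Q)| * layer_rank Q 'N_H(Q))%N.
Proof.
move=> sHG; pose S := [set Q | cj Q & Q \subset H].
have actS : [acts H, on S | 'JG].
  apply/subsetP=> h Hh; rewrite !inE; apply/subsetP=> Q; rewrite !inE => /andP[cjQ sQH].
  by rewrite /= /cj orbitJ_conj ?(subsetP sHG) //= -(conjGid Hh) conjSg.
have [trX sXS injX repX] := orbit_transversalP actS.
set X := orbit_transversal _ _ _ in trX sXS injX repX.
have rankA : \rank (A H) = (\rank (B H) + \sum_(Q in X) layer_rank Q 'N_H(Q))%N.
  rewrite -big_enum /= -layer_orbit_rank ?enum_uniq //.
  - apply/eqP; rewrite eqn_leq; apply/andP; split; apply: mxrankS; last first.
      rewrite addsmx_sub leBA // big_enum /=; apply/sumsmx_subP=> Q XQ.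
      by have := subsetP sXS Q XQ; rewrite inE => /andP[cjQ sQH]; apply: mf_tr.
    apply: submx_trans (genAB sHG) _; rewrite addsmx_sub addsmxSl big_enum /=.
    apply/sumsmx_subP=> Q /andP[cjQ sQH].
    have [|h Hh Xh] := repX Q; first by rewrite inE cjQ.
    apply: submx_trans (addsmxSr _ _); apply: (sumsmx_sup _ Xh).
    have Gh := subsetP sHG h Hh; have sQG := orbitJ_sub sPG cjQ.
    have sAQ := mf_fix famA sQG.
    have -> : A Q *m tr_mx r Q H = A Q *m tr_mx r Q H *m r h.
      have sH : (A Q *m tr_mx r Q H <= A H)%MS by apply: mf_tr.
      by have /rfix_mxP-> := submx_trans sH (mf_fix famA sHG).
    by rewrite tr_conj // (conjGid Hh) submxMr // (mf_conj famA).
  - by move=> Q; rewrite mem_enum => /(subsetP sXS); rewrite inE.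
  by move=> Q1 Q2; rewrite !mem_enum => X1 X2; rewrite injX // => /eqP.
rewrite rankA addKn big_distrr /=.
rewrite [RHS](eq_bigl [in S]) => [|Q]; last by rewrite [RHS]inE.
rewrite (set_partition_big _ (orbit_partition actS)) /=.
have -> : orbit 'JG H @: S = orbit 'JG H @: X.
  apply/setP=> O; apply/imsetP/imsetP=> -[Q SQ ->]; last first.
    by exists Q; rewrite ?(subsetP sXS).
  have [h Hh Xh] := repX Q SQ; exists ('JG%act Q h) => //.
  exact: (esym (orbit_act 'JG Q Hh)).
rewrite [RHS]big_imset /=; last first.
  by move=> Q1 Q2 X1 X2 eqO; apply/eqP; rewrite -injX // eqO orbit_refl.
apply: eq_bigr => Q XQ; have := subsetP sXS Q XQ; rewrite inE => /andP[cjQ sQH].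
rewrite (eq_bigr (fun=> #|'N_H(Q)| * layer_rank Q 'N_H(Q))%N) => [|Q1 /imsetP[h Hh ->]].
  rewrite sum_nat_const mulnA; congr (_ * _)%N.
  by rewrite -(card_orbit_stab 'JG H Q) astab1JG.
have Gh := subsetP sHG h Hh.
have -> : 'N_H('JG%act Q h) = 'N_H(Q) :^ h.
  by rewrite conjIg conjGid // -normJ.
rewrite cardJg layer_rankJ //; first by rewrite subsetI sQH normG.
by rewrite subIset // sHG.
Qed.

(** Each conjugate of P is P^g for |N_G(P)| elements g, so this factor turns the sum over conjugates
    into one over G. What remains depends on H only through the subgroups N_G(P) :&: H^g, the form
    in which vanishing marks can be applied. *)
Lemma layer_weight (H : {group gT}) : H \subset G ->
  (#|'N_G(P)| * (#|H| * (\rank (A H) - \rank (B H))) =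
   \sum_(g in G) let T := 'N_G(P) :&: H :^ g in
      if P \subset T then #|T| * layer_rank P T else 0)%N.
Proof.
move=> sHG; rewrite layer_rank_sum // (reindex_inj invg_inj) /=.
pose f (Q : {group gT}) := (#|'N_H(Q)| * layer_rank Q 'N_H(Q))%N.
rewrite [RHS](_ : _ = \sum_(g in G | (P :^ g \subset H)) f (P :^ g)%G)%N; last first.
  rewrite [RHS]big_mkcondr [LHS](eq_bigl [in G]) /= => [|g]; last by rewrite /= groupV.
  apply: eq_bigr => g Gg.
  have defN : 'N_H(P :^ g) = ('N_G(P) :&: H :^ g^-1) :^ g.
    by rewrite !conjIg conjsgKV (conjGid Gg) -normJ setIAC (setIidPr sHG).
  have -> : (P \subset 'N_G(P) :&: H :^ g^-1) = (P :^ g \subset H).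
    by rewrite !subsetI sPG normG /= -sub_conjg.
  case: ifP => // sPgH; rewrite /f defN cardJg layer_rankJ //.
  - by apply/imsetP; exists 1; rewrite ?group1 //; apply: val_inj; rewrite /= conjsg1.
  - by rewrite !subsetI sPG normG /= -sub_conjg.
  by rewrite subIset // subIset // subxx.
rewrite (partition_big (fun g => P :^ g)%G (fun Q : {group gT} => cj Q && (Q \subset H))) /=.
  rewrite big_distrr /=; apply: eq_bigr => Q /andP[/imsetP[g Gg defQ] sQH].
  rewrite (eq_bigr (fun=> f Q)) => [|x /andP[_ /eqP <-]] //.
  rewrite sum_nat_const; congr (_ * _)%N; rewrite -(card_rcoset _ g).
  apply: eq_card => x; rewrite [RHS]unfold_in /= mem_rcoset inE groupMr ?groupV //.
  have -> : ((P :^ x)%G == Q) = (x * g^-1 \in 'N(P)).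
    rewrite defQ -val_eqE /= -(inj_eq (@conjsg_inj _ g^-1)) conjsgK -conjsgM.
    by apply/eqP/normP.
  case: (x \in G) => //=; apply/idP/andP=> [nP | []//]; split=> //.
  have -> : P :^ x = Q.
    by rewrite defQ /= -{2}(normP nP) -conjsgM mulgKV.
  by [].
by move=> g /andP[Gg sPgH]; rewrite sPgH andbT; apply/imsetP; exists g.
Qed.

End Layer.
End Families.

(** * The layer between two Mackey families at the conjugates of one subgroup *)

Section Filtration.
Variables (F : fieldType) (gT : finGroupType) (G : {group gT}) (n : nat).
Variable r : mx_representation F G n.
Implicit Types H K Q : {group gT}.
Variables (A B : {group gT} -> 'M[F]_n) (P : {group gT}).
Hypotheses (famA : mackey_family r A) (famB : mackey_family r B).
Hypothesis sPG : P \subset G.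
Hypothesis leBA : forall H : {group gT}, H \subset G -> (B H <= A H)%MS.
Hypothesis lowAB : forall Q : {group gT}, Q \subset G -> (#|Q| < #|P|)%N -> (A Q <= B Q)%MS.

Local Notation cj := (fun Q : {group gT} => Q \in orbit 'JG%act G P).

(** [J] agrees with B at the conjugates of P, and [upper], the sum [J + C], agrees with A there. So
    J / B and A / [upper] vanish at P, while [upper] / J is generated and detected at the conjugates
    of P. *)
Definition locally_trivial (H : {group gT}) : 'M[F]_n :=
  (A H :&: \bigcap_(Q : {group gT} | (Q \in orbit 'JG%act G P) && (Q \subset H)) B Q)%MS.

Definition generated_part (H : {group gT}) : 'M[F]_n :=
  (\sum_(Q : {group gT} | (Q \in orbit 'JG%act G P) && (Q \subset H)) A Q *m tr_mx r Q H)%MS.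

Local Notation J := locally_trivial.
Local Notation C := generated_part.

Lemma sub_locally m (u : 'M_(m, n)) H :
  (u <= J H)%MS <-> (u <= A H)%MS /\ forall Q, cj Q -> Q \subset H -> (u <= B Q)%MS.
Proof.
rewrite sub_capmx; split=> [/andP[uA /sub_bigcapmxP uB] | [uA uB]].
  by split=> // Q cjQ sQH; apply: uB; rewrite cjQ.
by rewrite uA; apply/sub_bigcapmxP=> Q /andP[]; apply: uB.
Qed.

Lemma locally_subl H : (J H <= A H)%MS. Proof. exact: capmxSl. Qed.

Lemma locally_subr H Q : cj Q -> Q \subset H -> (J H <= B Q)%MS.
Proof. by move=> cjQ sQH; case/sub_locally: (submx_refl (J H)) => _ ->. Qed.

Lemma sub_locallyB H : H \subset G -> (B H <= J H)%MS.
Proof.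
move=> sHG; apply/sub_locally; split=> [|Q cjQ sQH]; first exact: leBA.
exact: (mf_res famB sQH sHG).
Qed.

Lemma generated_sub H : H \subset G -> (C H <= A H)%MS.
Proof.
by move=> sHG; apply/sumsmx_subP=> Q /andP[cjQ sQH]; apply: (mf_tr famA sQH sHG).
Qed.

Lemma small_inter (K : {group gT}) Q x : cj Q -> ~~ (Q \subset K :^ x) ->
  (#|K :^ x :&: Q| < #|P|)%N.
Proof.
move=> cjQ nsQ; rewrite -(orbitJ_card cjQ) proper_card // properEneq subsetIr andbT.
by apply: contraNneq nsQ => /setIidPr.
Qed.

Lemma tr_id m (u : 'M_(m, n)) Q : Q \subset G -> (u <= rfix_mx r Q)%MS ->
  u *m tr_mx r Q Q = u.
Proof. by move=> sQG fixu; rewrite tr_index // indexgg scale1r. Qed.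

Lemma low_tr m (u : 'M_(m, n)) (R K : {group gT}) : R \subset K -> K \subset G ->
  (#|R| < #|P|)%N -> (u <= A R)%MS -> (u *m tr_mx r R K <= B K)%MS.
Proof.
move=> sRK sKG ltR uA; apply: submx_trans (mf_tr famB sRK sKG); apply: submxMr.
exact: submx_trans (lowAB (subset_trans sRK sKG) ltR).
Qed.

Lemma subJG (H : {group gT}) g : H \subset G -> g \in G -> (H :^ g)%G \subset G.
Proof. by move=> sHG Gg; rewrite -(conjGid Gg) conjSg. Qed.

Lemma locally_conj H g : H \subset G -> g \in G -> (J H *m r g <= J (H :^ g)%G)%MS.
Proof.
move=> sHG Gg; apply/sub_locally; split=> [|Q cjQ sQH].
  by apply: submx_trans (mf_conj famA sHG Gg); rewrite submxMr ?locally_subl.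
have cjQ' := orbitJ_conj cjQ (groupVr Gg).
have eqQ : ((Q :^ g^-1) :^ g)%G = Q by apply: val_inj; rewrite /= conjsgKV.
rewrite -[in X in (_ <= X)%MS]eqQ.
apply: submx_trans (mf_conj famB (orbitJ_sub sPG cjQ') Gg); apply: submxMr.
by apply: locally_subr => //=; rewrite sub_conjgV.
Qed.

Lemma locally_family : mackey_family r J.
Proof.
split=> [H sHG|K H sKH sHG|H g|K H sKH sHG]; last 2 first.
- exact: locally_conj.
- have sKG := subset_trans sKH sHG.
  apply/sub_locally; split=> [|Q cjQ sQH].
    by apply: submx_trans (mf_tr famA sKH sHG); rewrite submxMr ?locally_subl.
  have fixJ : (J K <= rfix_mx r K)%MS.
    exact: submx_trans (locally_subl K) (mf_fix famA sKG).
  rewrite mulmx_tr; have sQG := orbitJ_sub sPG cjQ.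
  have := @tr_mackey_sub _ _ _ _ r _ (J K) _ (B Q) K H Q predT sKH sQH sHG fixJ.
  rewrite (eq_bigl [in rcosets K H]) => [|D]; last by rewrite andbT.
  apply=> // x Hx _; have Gx := subsetP sHG x Hx; have sKxG := subJG sKG Gx.
  have JKx : (J K *m r x <= J (K :^ x)%G)%MS by apply: locally_conj.
  have [sQK | nsQ] := boolP (Q \subset K :^ x).
    have JB : (J K *m r x <= B Q)%MS by apply: submx_trans JKx (locally_subr cjQ _).
    by rewrite (setIidPr sQK) tr_id // (submx_trans JB (mf_fix famB sQG)).
  apply: (@low_tr _ _ (K :^ x :&: Q)%G) => //; first exact: subsetIr.
    exact: small_inter.
  apply: submx_trans JKx (submx_trans (locally_subl _) _).
  exact: (mf_res famA (subsetIl _ _) sKxG).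
- exact: submx_trans (locally_subl H) (mf_fix famA sHG).
apply/sub_locally; split.
  exact: submx_trans (locally_subl H) (mf_res famA sKH sHG).
by move=> Q cjQ sQK; apply: locally_subr => //; apply: subset_trans sKH.
Qed.

(** [C] alone need not be stable under restriction: Mackey's formula also yields traces from
    subgroups Q^x :&: K smaller than P. These lie in B K, hence in J K. *)
Definition upper (H : {group gT}) : 'M[F]_n := (J H + C H)%MS.

Lemma upper_sub H : H \subset G -> (upper H <= A H)%MS.
Proof. by move=> sHG; rewrite addsmx_sub locally_subl generated_sub. Qed.

Lemma upper_full Q : cj Q -> (A Q <= upper Q)%MS.
Proof.
move=> cjQ; have sQG := orbitJ_sub sPG cjQ; apply: submx_trans (addsmxSr _ _).
apply: (sumsmx_sup Q); first by rewrite cjQ subxx.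
by rewrite tr_id // (mf_fix famA sQG).
Qed.

Lemma upper_family : mackey_family r upper.
Proof.
split=> [H sHG|K H sKH sHG|H g sHG Gg|K H sKH sHG].
- exact: submx_trans (upper_sub sHG) (mf_fix famA sHG).
- have sKG := subset_trans sKH sHG.
  rewrite addsmx_sub (submx_trans (mf_res locally_family sKH sHG) (addsmxSl _ _)) /=.
  apply/sumsmx_subP=> Q /andP[cjQ sQH]; have sQG := orbitJ_sub sPG cjQ.
  have fixQ := mf_fix famA sQG.
  rewrite mulmx_tr.
  have := @tr_mackey_sub _ _ _ _ r _ (A Q) _ (upper K) Q H K predT sQH sKH sHG fixQ.
  rewrite (eq_bigl [in rcosets Q H]) => [|D]; last by rewrite andbT.
  apply=> // x Hx _; have Gx := subsetP sHG x Hx; have sQxG := subJG sQG Gx.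
  have AQx := mf_conj famA sQG Gx; have cjQx := orbitJ_conj cjQ Gx.
  have [sQK | nsQ] := boolP (Q :^ x \subset K).
    rewrite (setIidPl sQK); apply: submx_trans (addsmxSr _ _).
    apply: (sumsmx_sup (Q :^ x)%G); first by rewrite cjQx.
    exact: submxMr.
  apply: submx_trans (addsmxSl _ _); apply: submx_trans (sub_locallyB sKG).
  apply: (@low_tr _ _ (Q :^ x :&: K)%G) => //; first exact: subsetIr.
    rewrite -(orbitJ_card cjQx) proper_card // properEneq subsetIl andbT.
    by apply: contraNneq nsQ => /setIidPl.
  exact: submx_trans AQx (mf_res famA (subsetIl _ _) sQxG).
- rewrite addsmxMr addsmx_sub; apply/andP; split.
    by apply: submx_trans (addsmxSl _ _); apply: locally_conj.
  apply: submx_trans (addsmxSr _ _); rewrite sumsmxMr; apply/sumsmx_subP=> Q /andP[cjQ sQH].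
  have sQG := orbitJ_sub sPG cjQ.
  rewrite tr_conj ?(mf_fix famA) //; apply: (sumsmx_sup (Q :^ g)%G).
    by rewrite orbitJ_conj //= conjSg.
  by rewrite submxMr // (mf_conj famA).
rewrite addsmxMr addsmx_sub; apply/andP; split.
  by apply: submx_trans (addsmxSl _ _); apply: (mf_tr locally_family sKH sHG).
apply: submx_trans (addsmxSr _ _); rewrite sumsmxMr; apply/sumsmx_subP=> Q /andP[cjQ sQK].
have sQG := orbitJ_sub sPG cjQ; have fixQ := mf_fix famA sQG.
rewrite tr_trans //; apply: (sumsmx_sup Q) => //.
by rewrite cjQ (subset_trans sQK).
Qed.

Lemma upper_weight (H : {group gT}) : H \subset G ->
  (#|'N_G(P)| * (#|H| * (\rank (upper H) - \rank (J H))) =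
   \sum_(g in G) let T := 'N_G(P) :&: H :^ g in
      if P \subset T then #|T| * layer_rank r upper J P T else 0)%N.
Proof.
move=> sHG; apply: layer_weight => //.
- exact: upper_family.
- exact: locally_family.
- by move=> K _; apply: addsmxSl.
- move=> Q sQG ltQ; apply: submx_trans (upper_sub sQG) _.
  exact: submx_trans (lowAB sQG ltQ) (sub_locallyB sQG).
- move=> K sKG; apply: addsmxS => //; apply/sumsmx_subP=> Q /andP[cjQ sQK].
  apply: (sumsmx_sup Q); first by rewrite cjQ.
  by rewrite submxMr // upper_full.
(* Detection: J Q lies in B Q for every conjugate Q of P, so the hypothesis becomes the defining
   condition of J K. *)
move=> K u sKG uE uJ; apply/sub_locally; split; first exact: submx_trans uE (upper_sub sKG).
by move=> Q cjQ sQK; apply: submx_trans (uJ Q cjQ sQK) _; apply: locally_subr.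
Qed.

End Filtration.

(** * Vanishing of weighted dimensions of quotients of Mackey families *)

Section Vanishing.
Variables (p : nat) (F : fieldType) (gT : finGroupType) (G : {group gT}) (n : nat).
Variable r : mx_representation F G n.
Variables (I : finType) (z : I -> rat) (Hs : I -> {group gT}).
Hypothesis pF : p \in [pchar F].
Hypothesis sHs : forall i, Hs i \subset G.
Hypothesis weight0 : forall (P : {group gT}) (w : {set gT} -> rat),
  P \subset G -> p.-group P -> P :!=: 1%g ->
  (\sum_i z i / #|Hs i|%:R * \sum_(g in G) w ('N_G(P) :&: Hs i :^ g) = 0)%R.

(* Induct on the total dimension of A / B. A minimal P with A_P <> B_P is a nontrivial p-group, by
   transfer from a Sylow subgroup; between B and A lie J and J + C, which differ only above conjugates
   of P, and there the dimensions are governed by the intersections of N_G(P) with the H_i. *)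
Lemma mackey_vanish (A B : {group gT} -> 'M[F]_n) :
    mackey_family r A -> mackey_family r B ->
    (forall H : {group gT}, H \subset G -> (B H <= A H)%MS) -> (A 1%G <= B 1%G)%MS ->
  (\sum_i z i * ((\rank (A (Hs i)))%:R - (\rank (B (Hs i)))%:R) = 0)%R.
Proof.
move=> famA famB leBA.
have [m] := ubnP (\sum_(H : {group gT} | H \subset G) (\rank (A H) - \rank (B H)))%N.
elim: m A B famA famB leBA => // m IHm A B famA famB leBA.
rewrite ltnS => leAm sAB1.
pose bad (H : {group gT}) := (H \subset G) && ~~ (A H <= B H)%MS.
case: (pickP bad) => [P0 P0P | eqAB]; last first.
  apply: big1 => i _.
  have := eqAB (Hs i); rewrite /bad sHs /= => /negbFE sAB.
  suff -> : \rank (A (Hs i)) = \rank (B (Hs i)) by rewrite subrr mulr0.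
  by apply/eqP; rewrite eqn_leq !mxrankS // leBA.
have [P /andP[sPG nsAB] minP] := @arg_minnP _ _ bad (fun H => #|H|) P0P.
have lowAB (Q : {group gT}) : Q \subset G -> (#|Q| < #|P|)%N -> (A Q <= B Q)%MS.
  move=> sQG ltQ; apply: contraLR ltQ => nQ; rewrite -leqNgt; apply: minP.
  by rewrite /bad sQG.
have ntP : P :!=: 1%g.
  apply: contraNneq nsAB => P1; suff -> : P = 1%G by [].
  exact: val_inj.
have pP : p.-group P.
  apply: contraR nsAB => npP; have [S sylS] := Sylow_exists p P.
  have sSP := pHall_sub sylS; have pS := pHall_pgroup sylS.
  have sSG := subset_trans sSP sPG.
  have ltS : (#|S| < #|P|)%N.
    rewrite proper_card // properEneq sSP andbT.
    by apply: contraNneq npP => <-.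
  have AP : (A P *m tr_mx r S P <= B P)%MS.
    apply: submx_trans (mf_tr famB sSP sPG); apply: submxMr.
    exact: submx_trans (mf_res famA sSP sPG) (lowAB _ sSG ltS).
  rewrite tr_index // ?(mf_fix famA) // in AP.
  have ind0 : (#|P : S|%:R != 0 :> F)%R.
    rewrite -(dvdn_pcharf pF) -p'natE ?(pcharf_prime pF) //.
    by case/and3P: sylS.
  by rewrite (eqmx_scale _ ind0) in AP.
(* At P the family J agrees with B while A does not, so replacing A by J lowers the total
   dimension. *)
have IH1 : (\sum_i z i * ((\rank (locally_trivial G A B P (Hs i)))%:R - (\rank (B (Hs i)))%:R) = 0)%R.
  apply: IHm => //; first exact: locally_family.
  - by move=> H sHG; apply: (sub_locallyB P famB leBA).
  - apply: leq_trans leAm.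
    rewrite (bigD1 P) //= [X in (_ < X)%N](bigD1 P) //= -addSn leq_add //.
      have -> : (\rank (locally_trivial G A B P P) - \rank (B P) = 0)%N.
        apply/eqP; rewrite subn_eq0 mxrankS // locally_subr //.
        by apply: (orbit_refl 'JG%act).
      by rewrite subn_gt0 ltn_neqAle (mxrank_leqif_sup (leBA P sPG)) mxrankS ?leBA // nsAB.
    by apply: leq_sum => H _; rewrite leq_sub2r // mxrankS // locally_subl.
  exact: submx_trans (locally_subl _ _ _ _ _) sAB1.
(* At P [upper] agrees with A, so replacing B by [upper] lowers the total dimension as well. *)
have IH2 : (\sum_i z i * ((\rank (A (Hs i)))%:R - (\rank (upper r A B P (Hs i)))%:R) = 0)%R.
  apply: IHm => //; first exact: upper_family.
  - by move=> H sHG; apply: (upper_sub B P famA).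
  - apply: leq_trans leAm.
    rewrite (bigD1 P) //= [X in (_ < X)%N](bigD1 P) //= -addSn leq_add //.
      have -> : (\rank (A P) - \rank (upper r A B P P) = 0)%N.
        apply/eqP; rewrite subn_eq0 mxrankS // (upper_full B famA sPG) //.
        by apply: (orbit_refl 'JG%act).
      by rewrite subn_gt0 ltn_neqAle (mxrank_leqif_sup (leBA P sPG)) mxrankS ?leBA // nsAB.
    apply: leq_sum => H /andP[sHG _]; rewrite leq_sub2l // mxrankS //.
    by apply: submx_trans (addsmxSl _ _); apply: (sub_locallyB P famB leBA).
  apply: submx_trans sAB1 (submx_trans _ (addsmxSl _ _)).
  by apply: (sub_locallyB P famB leBA); apply: sub1G.
have split_sub i :
   ((\rank (A (Hs i)))%:R - (\rank (B (Hs i)))%:R =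
     ((\rank (locally_trivial G A B P (Hs i)))%:R - (\rank (B (Hs i)))%:R) +
     (((\rank (A (Hs i)))%:R - (\rank (upper r A B P (Hs i)))%:R) +
     ((\rank (upper r A B P (Hs i)))%:R - (\rank (locally_trivial G A B P (Hs i)))%:R)) :> rat)%R.
  by rewrite subrKA [RHS]addrC subrKA.
(* Multiplication by |N_G(P)| makes [upper_weight] applicable to the middle layer; its factor |H_i|
   is why [weight0] divides by [#|Hs i|]. *)
have IH3 : (\sum_i z i * ((\rank (upper r A B P (Hs i)))%:R -
              (\rank (locally_trivial G A B P (Hs i)))%:R) = 0)%R.
  pose w (T : {set gT}) : rat :=
    ((if P \subset T then #|T| * layer_rank r (upper r A B P) (locally_trivial G A B P) P T else 0)%N%:R)%R.
  have N0 : (#|'N_G(P)|%:R != 0 :> rat)%R by rewrite pnatr_eq0 -lt0n cardG_gt0.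
  apply: (mulfI N0); rewrite mulr0 -[RHS](weight0 w sPG pP ntP) mulr_sumr.
  apply: eq_bigr => i _.
  have Hi0 : (#|Hs i|%:R != 0 :> rat)%R by rewrite pnatr_eq0 -lt0n cardG_gt0.
  rewrite -natr_sum -(upper_weight famA famB sPG leBA lowAB (sHs i)) !natrM.
  rewrite natrB ?mxrankS ?addsmxSl //.
  rewrite mulrCA -[RHS]mulrA; congr (_ * _)%R.
  by rewrite mulrCA mulKf.
rewrite (eq_bigr _ (fun i _ => congr1 (fun t => z i * t)%R (split_sub i))).
rewrite (eq_bigr _ (fun i _ => mulrDr _ _ _)) big_split /= IH1 add0r.
by rewrite (eq_bigr _ (fun i _ => mulrDr _ _ _)) big_split /= IH2 IH3 addr0.
Qed.

End Vanishing.

(** * Split exact sequences and characteristic polynomials *)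

Local Close Scope group_scope.

Section SplitExact.
Variables (F : fieldType) (n1 n2 n3 : nat).
Variables (P1 : 'M[F]_(n1, n2)) (Q1 : 'M[F]_(n2, n1)) (P2 : 'M[F]_(n2, n3)) (Q2 : 'M[F]_(n3, n2)).

Definition split_exact :=
  [/\ P1 *m Q1 = 1%:M, Q2 *m P2 = 1%:M, P1 *m P2 = 0 & Q1 *m P1 + P2 *m Q2 = 1%:M].

Hypothesis spl : split_exact.

Lemma split_exact_mul0 : Q2 *m Q1 = 0.
Proof.
case: spl => e1 e2 e3 e4; have : Q2 *m (Q1 *m P1 + P2 *m Q2) *m Q1 = Q2 *m Q1 by rewrite e4 mulmx1.
rewrite mulmxDr mulmxDl [Q2 *m (P2 *m Q2)]mulmxA e2 mul1mx -!mulmxA e1 mulmx1.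
by move/(canRL (addrK _)); rewrite subrr.
Qed.

Lemma split_exact_dim : (n1 + n3)%N = n2.
Proof.
case: spl => e1 e2 e3 e4; apply/eqP; rewrite eqn_leq.
have e5 := split_exact_mul0.
have h1 : col_mx P1 Q2 *m row_mx Q1 P2 = 1%:M.
  by rewrite mul_col_row e1 e2 e3 e5 -scalar_mx_block.
have h2 : row_mx Q1 P2 *m col_mx P1 Q2 = 1%:M by rewrite mul_row_col.
by rewrite (mulmx1_min h1) (mulmx1_min h2).
Qed.

End SplitExact.

(** In the basis formed by the rows of [P1] and [Q2], [A2] becomes block triangular with diagonal
    blocks [A1] and [A3]. *)
Lemma char_poly_split (F : fieldType) n1 n2 n3 (P1 : 'M[F]_(n1, n2)) Q1 (P2 : 'M[F]_(n2, n3)) Q2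
   (A1 : 'M_n1) A2 A3 :
  split_exact P1 Q1 P2 Q2 -> A1 *m P1 = P1 *m A2 -> A2 *m P2 = P2 *m A3 ->
  char_poly A2 = char_poly A1 * char_poly A3.
Proof.
move=> spl; have e := split_exact_dim spl; case: _ / e in P1 Q1 P2 Q2 A2 spl *.
case: spl => e1 e2 e3 e4 eqA1 eqA3.
have h2 : row_mx Q1 P2 *m col_mx P1 Q2 = 1%:M by rewrite mul_row_col.
have h1 := mulmx1C h2.
have sim : col_mx P1 Q2 *m A2 *m row_mx Q1 P2 = block_mx A1 0 (Q2 *m A2 *m Q1) A3.
  rewrite mul_col_mx mul_col_row -eqA1 -!mulmxA e1 e3 eqA3 !mulmx0 mulmx1.
  by rewrite [Q2 *m (P2 *m _)]mulmxA e2 mul1mx.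
have -> : char_poly A2 = char_poly (block_mx A1 0 (Q2 *m A2 *m Q1) A3).
  rewrite /char_poly /char_poly_mx -sim.
  have -> : 'X%:M - map_mx polyC (col_mx P1 Q2 *m A2 *m row_mx Q1 P2)
     = map_mx polyC (col_mx P1 Q2) *m ('X%:M - map_mx polyC A2) *m map_mx polyC (row_mx Q1 P2).
    have BB : map_mx polyC (col_mx P1 Q2) *m map_mx polyC (row_mx Q1 P2) = 1%:M.
      by rewrite -map_mxM h1 map_mx1.
    by rewrite mulmxBr mulmxBl !map_mxM mul_mx_scalar -scalemxAl BB scalemx1.
  rewrite !det_mulmx mulrAC -det_mulmx -map_mxM h1 map_mx1 det1 mul1r //.
rewrite /char_poly /char_poly_mx map_block_mx map_mx0 scalar_mx_block.
by rewrite opp_block_mx add_block_mx !add0r oppr0 det_lblock.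
Qed.

(** * Short exact sequences and composition factors *)

Section ExactSequences.
Variables (F : fieldType) (gT : finGroupType) (G : {group gT}).
Implicit Types U V W : representation F G.

Definition equivariant U V (f : 'M[F]_(rdegree U, rdegree V)) :=
  forall x, x \in G -> U x *m f = f *m V x.

(** [Q1] and [Q2] split the sequence linearly and witness its exactness; equivariance is asked only
    of the maps of the sequence, [P1] and [P2]. *)
Definition exseq U V W :=
  exists P1, exists Q1, exists P2, exists Q2,
    [/\ @split_exact F (rdegree U) (rdegree V) (rdegree W) P1 Q1 P2 Q2,
        equivariant P1 & equivariant P2].

Lemma gring_mx_equivariant U V (f : 'M_(rdegree U, rdegree V)) a :
  equivariant f -> gring_mx U a *m f = f *m gring_mx V a.
Proof.
move=> eqf; rewrite /gring_mx /= !(mulmx_sum_row a) !linear_sum /= mulmx_suml.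
apply: eq_bigr => i _; rewrite !linearZ /= !rowK !mxvecK -scalemxAl.
by rewrite eqf ?enum_valP.
Qed.

Lemma exseq_char_poly U V W a : exseq U V W ->
  char_poly (gring_mx V a) = char_poly (gring_mx U a) * char_poly (gring_mx W a).
Proof.
move=> [P1 [Q1 [P2 [Q2 [spl eq1 eq2]]]]].
by apply: (char_poly_split spl); apply: gring_mx_equivariant.
Qed.

Lemma exseq_dim U V W : exseq U V W -> (rdegree U + rdegree W)%N = rdegree V.
Proof. by move=> [P1 [Q1 [P2 [Q2 [spl _ _]]]]]; apply: split_exact_dim spl. Qed.

Lemma exseq_sub V (M : 'M_(rdegree V)) (modM : mxmodule V M) :
  exseq (Representation (submod_repr modM)) V (Representation (factmod_repr modM)).
Proof.
exists (val_submod 1%:M), (in_submod _ 1%:M), (in_factmod _ 1%:M), (val_factmod 1%:M).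
split=> [|x Gx|x Gx].
- split.
  + by rewrite -in_submodE val_submodK.
  + by rewrite -in_factmodE val_factmodK.
  + by rewrite -in_factmodE; apply/eqP; rewrite in_factmod_eq0 val_submodP.
  by rewrite -val_submodE -val_factmodE add_sub_fact_mod.
- by rewrite /= -val_submodE -[LHS]mulmx1 -val_submodJ // mul1mx mulmx1.
by rewrite /= -in_factmodE -in_factmodJ // mul1mx.
Qed.

Lemma exseq_onto U W (f : 'M_(rdegree U, rdegree W)) :
  equivariant f -> row_full f -> exists K, exseq K U W.
Proof.
move=> eqf fullf.
have modK : mxmodule U (kermx f).
  apply/mxmoduleP=> x Gx; apply/sub_kermxP.
  by rewrite -mulmxA eqf // mulmxA mulmx_ker mul0mx.
exists (Representation (submod_repr modK)).
have ker0 : val_submod 1%:M *m f = 0 :> 'M_(\rank (kermx f), _).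
  by apply/sub_kermxP; apply: val_submodP.
exists (val_submod 1%:M), (in_submod _ (1%:M - f *m pinvmx f)), f, (pinvmx f).
split=> //; last first.
  by move=> x Gx /=; rewrite -val_submodE -[LHS]mulmx1 -val_submodJ // mul1mx mulmx1.
split=> //; last first.
- rewrite -val_submodE in_submodK ?subrK //; apply/sub_kermxP.
  by rewrite mulmxBl mul1mx mulmxKpV ?submx_refl ?subrr.
- by apply: mulVpmx.
rewrite in_submodE (mulmxA (val_submod _)) mulmxBr mulmx1 (mulmxA (val_submod _) f) ker0 mul0mx subr0.
by rewrite -in_submodE val_submodK.
Qed.

Lemma exseq_dadd U W : exseq U (dadd_grepr U W) W.
Proof.
exists (row_mx 1%:M 0), (col_mx 1%:M 0), (col_mx 0 1%:M), (row_mx 0 1%:M).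
split=> [|x Gx|x Gx].
- split; rewrite ?mul_row_col ?mul_col_row ?mulmx1 ?mulmx0 ?mul0mx ?addr0 ?add0r //.
  by rewrite add_block_mx !addr0 !add0r -scalar_mx_block.
- by rewrite /= mul_row_block mul_mx_row !mulmx1 !mul1mx !mulmx0 !mul0mx !addr0.
by rewrite /= mul_block_col mul_col_mx !mulmx1 !mul1mx !mulmx0 !mul0mx !add0r.
Qed.

Section CompositionFactors.
Variables M N : representation F G.
Hypothesis cpMN : forall a, char_poly (gring_mx M a) = char_poly (gring_mx N a).
Variable V : 'M[F]_(rdegree N).
Hypothesis simV : mxsimple N V.

Lemma rdegree_char_poly : rdegree M = rdegree N.
Proof. by have := congr1 (fun p : {poly F} => size p) (cpMN 0); rewrite !size_char_poly => -[]. Qed.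

(** If a does not kill some v in V, then v a generates V and v a b = v for some b. So a b has the
    eigenvalue 1 on N, hence on M by equality of the characteristic polynomials, although it acts as
    0 on M. *)
Lemma annihilator_simple a : gring_mx M a = 0 -> V *m gring_mx N a = 0.
Proof.
move=> Ma0; apply/eqP/negPn/negP=> nzVa.
have [modV nzV simVU] := simV.
have [i nzv] : exists i, row i (V *m gring_mx N a) != 0.
  apply/existsP; apply: contraNT nzVa; rewrite negb_exists => /forallP z.
  by apply/eqP/row_matrixP=> i; rewrite row0; apply/eqP; have := z i; rewrite negbK.
pose v := row i V; have va : row i (V *m gring_mx N a) = v *m gring_mx N a by rewrite row_mul.
rewrite va in nzv.
have vV : (v <= V)%MS by apply: row_sub.
have vaV : (v *m gring_mx N a <= V)%MS.
  by rewrite (mxmodule_envelop modV) // gring_mxP.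
have := simVU _ (cyclic_mx_module N (v *m gring_mx N a)).
rewrite cyclic_mx_sub // cyclic_mx_eq0 => /(_ isT nzv) sVc.
have /cyclic_mxP[B EB vB] := submx_trans vV sVc.
have [b defb] : exists b, mxvec B = b *m enveloping_algebra_mx N by apply/submxP.
have {EB defb} defB : B = gring_mx N b by rewrite /gring_mx /= -defb mxvecK.
pose c := a *m gring_mx (regular_repr F G) b.
have vc : v *m gring_mx N c = v by rewrite gring_mxA mulmxA -defB -vB.
have nzv' : v != 0 by apply: contraNneq nzv => ->; rewrite mul0mx.
have Mc0 : gring_mx M c = 0 by rewrite gring_mxA Ma0 mul0mx.
have : eigenvalue (gring_mx N c) 1.
  by apply/eigenvalueP; exists v; rewrite ?scale1r.
rewrite eigenvalue_root_char -cpMN Mc0 /char_poly /char_poly_mx map_mx0 subr0 det_scalar.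
by rewrite rootE hornerXn expr1n oner_eq0.
Qed.

(** Let e_j be the standard basis of M and L_k the right ideal of the group algebra elements that
    kill e_j for all j < k. L_0 is everything and does not kill a nonzero v in V; the last L_k
    annihilates M and therefore V. Where L_k does not kill v but L_{k+1} does, e_k a |-> v a is a
    well-defined surjection from e_k L_k onto V, which makes V a subquotient of M. *)
Lemma simple_subquotient : exists K1 K2 Q : representation F G,
  exseq K1 M Q /\ exseq K2 K1 (Representation (submod_repr (mxsimple_module simV))).
Proof.
have [modV nzV simVU] := simV.
have [v vV nzv] : exists2 v : 'rV_(rdegree N), (v <= V)%MS & v != 0.
  by exists (nz_row V); rewrite ?nz_row_sub ?nz_row_eq0.
pose g := #|G|; pose aG := regular_repr F G.
pose phi (w : 'rV[F]_(rdegree M)) : 'M[F]_(g, rdegree M) :=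
  lin1_mx (mulmx w \o gring_mx M).
pose psi : 'M[F]_(g, rdegree N) := lin1_mx (mulmx v \o gring_mx N).
have phiE w (a : 'rV_g) : a *m phi w = w *m gring_mx M a by rewrite mul_rV_lin1.
have psiE (a : 'rV_g) : a *m psi = v *m gring_mx N a by rewrite mul_rV_lin1.
pose L k : 'M[F]_g := (\bigcap_(j < rdegree M | (j < k)%N) kermx (phi (delta_mx 0 j)))%MS.
have LP k (a : 'rV_g) : (a <= L k)%MS =
    [forall j : 'I_(rdegree M), (j < k)%N ==> ((delta_mx 0 j : 'rV_(rdegree M)) *m gring_mx M a == 0)].
  apply/sub_bigcapmxP/forallP=> [h j|h j jk].
    by apply/implyP=> jk; apply/eqP; have /sub_kermxP := h j jk; rewrite phiE.
  by apply/sub_kermxP; rewrite phiE; apply/eqP; apply: (implyP (h j)).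
have LmJ k x : x \in G -> (L k *m aG x <= L k)%MS.
  move=> Gx; apply/row_subP=> i; rewrite row_mul LP; apply/forallP=> j; apply/implyP=> jk.
  have /eqP e0 : (delta_mx 0 j : 'rV_(rdegree M)) *m gring_mx M (row i (L k)) == 0.
    by have := row_sub i (L k); rewrite LP => /forallP/(_ j); rewrite jk.
  by rewrite gring_mxJ // mulmxA e0 mul0mx.
have exk : exists k, (L k *m psi == 0).
  exists (rdegree M); apply/eqP/row_matrixP=> i; rewrite row_mul row0 psiE.
  have := row_sub i (L (rdegree M)); set a := row i _; rewrite LP => /forallP aM.
  have /annihilator_simple Va0 : gring_mx M a = 0.
    apply/row_matrixP=> j; rewrite row0 rowE; apply/eqP.
    by apply: (implyP (aM j)); apply: ltn_ord.
  by case/submxP: vV => u ->; rewrite -mulmxA Va0 mulmx0.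
case: (ex_minnP exk) => -[|k] Lk0 mink.
  have /eqP := Lk0; rewrite /L big_pred0 // mul1mx => psi0.
  have [a] : exists a, mxvec 1%:M = a *m enveloping_algebra_mx N.
    by apply/submxP; apply: envelop_mx1.
  move=> defa; have := psiE a; rewrite psi0 mulmx0 /gring_mx /= -defa mxvecK mulmx1.
  by move=> v0; rewrite -v0 eqxx in nzv.
have nzk : L k *m psi != 0 by apply: contraTN (leqnn k.+1) => /mink; rewrite ltnNge => ->.
have ltk : (k < rdegree M)%N.
  rewrite ltnNge; apply: contra nzk => lek; apply/eqP.
  have -> : L k = L k.+1; last exact/eqP.
  apply: eq_bigl => j; have ltj := ltn_ord j.
  by rewrite ltnS (leq_trans ltj lek) (ltnW (leq_trans ltj lek)).
pose e := delta_mx 0 (Ordinal ltk) : 'rV[F]_(rdegree M).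
pose Y := L k *m phi e; pose X := L k *m psi; pose T := pinvmx Y *m X.
(* An a in L_k with e a = 0 lies in L_{k+1}, hence kills v: the map e a |-> v a is well defined. *)
have kerXY (b : 'rV_g) : b *m Y = 0 -> b *m X = 0.
  rewrite /Y /X !mulmxA phiE => h.
  have bL : (b *m L k <= L k.+1)%MS.
    rewrite LP; apply/forallP=> j; apply/implyP; rewrite ltnS leq_eqVlt => /orP[/eqP jk|jk].
      by rewrite (_ : j = Ordinal ltk) ?h //; apply: val_inj.
    by have := submxMl b (L k); rewrite LP => /forallP/(_ j)/implyP/(_ jk).
  by have /submxP[c ->] := bL; rewrite -mulmxA (eqP Lk0) mulmx0.
have YT : Y *m T = X.
  apply/eqP; rewrite -subr_eq0 -[X in _ - X]mul1mx /T mulmxA -mulmxBl; apply/eqP.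
  apply/row_matrixP=> i; rewrite row_mul row0; apply: kerXY.
  by rewrite -row_mul mulmxBl mul1mx mulmxKpV ?submx_refl // subrr row0.
pose K1 : 'M_(rdegree M) := <<Y>>%MS.
have YJ x : x \in G -> Y *m M x = L k *m aG x *m phi e.
  move=> Gx; apply/row_matrixP=> i; rewrite /Y !row_mul !phiE -mulmxA.
  by rewrite gring_mxJ.
have XJ x : x \in G -> X *m N x = L k *m aG x *m psi.
  move=> Gx; apply/row_matrixP=> i; rewrite /X !row_mul !psiE -mulmxA.
  by rewrite gring_mxJ.
have modK1 : mxmodule M K1.
  rewrite (eqmx_module _ (genmxE _)); apply/mxmoduleP=> x Gx.
  by rewrite YJ // submxMr // LmJ.
have XV : (X :=: V)%MS.
  have sXV : (X <= V)%MS.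
    apply/row_subP=> i; rewrite row_mul psiE.
    by rewrite (mxmodule_envelop modV) // gring_mxP.
  apply/eqmxP; rewrite sXV; rewrite -(genmxE X); apply: simVU; rewrite ?genmxE //.
    rewrite (eqmx_module _ (genmxE _)); apply/mxmoduleP=> x Gx.
    by rewrite XJ // submxMr // LmJ.
  by rewrite -mxrank_eq0 genmxE mxrank_eq0.
have TJ m (u : 'M_(m, _)) x : x \in G -> (u <= K1)%MS -> u *m M x *m T = u *m T *m N x.
  rewrite genmxE => Gx /submxP[b ->].
  rewrite -[b *m Y *m T]mulmxA YT -[b *m X *m _]mulmxA XJ // -[b *m Y *m _]mulmxA YJ //.
  have /submxP[c ->] := LmJ k x Gx.
  by rewrite -[c *m L k *m phi e]mulmxA -[c *m L k *m psi]mulmxA -/Y -/X -(mulmxA b) -(mulmxA c) YT.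
exists (Representation (submod_repr modK1)).
pose f : 'M_(\rank K1, \rank V) := in_submod V (val_submod 1%:M *m T).
have TV : (K1 *m T <= V)%MS by rewrite (eqmxMr _ (genmxE _)) YT XV.
have valTV : (val_submod (1%:M : 'M_(\rank K1)) *m T <= V)%MS.
  by apply: submx_trans TV; apply: submxMr; apply: val_submodP.
have eqf : @equivariant (Representation (submod_repr modK1))
      (Representation (submod_repr (mxsimple_module simV))) f.
  move=> x Gx /=; rewrite /f -in_submodJ // -TJ ?val_submodP //.
  rewrite -val_submodJ // mul1mx [in RHS]val_submodE -mulmxA.
  by rewrite [RHS]in_submodE -(mulmxA (submod_mx _ _)) -in_submodE.
have fullf : row_full f.
  rewrite -sub1mx -val_submodS val_submod1 /f in_submodK //.
  by rewrite -XV -YT submxMr // val_submod1 genmxE.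
have [K2 ex2] := exseq_onto eqf fullf.
exists K2, (Representation (factmod_repr modK1)); split=> //.
exact: exseq_sub.
Qed.

End CompositionFactors.

(** Induction on the degree: a simple V in N is also a subquotient of M. Stripping it leaves N / V
    on one side; on the other the pieces K2 and Q remain, and their direct sum serves as the new M.
    Cancelling the characteristic polynomial of V preserves the hypothesis. *)
Lemma exact_additive_char_poly (R : zmodType) (D : representation F G -> R)
    (M N : representation F G) :
    (forall U V W, exseq U V W -> D V = D U + D W) ->
    (forall a, char_poly (gring_mx M a) = char_poly (gring_mx N a)) ->
  D M = D N.
Proof.
move=> Dex; have [d] := ubnP (rdegree N); elim: d M N => // d IHd M N ltN cpMN.
have eqd := rdegree_char_poly cpMN.
have D0 U : rdegree U = 0%N -> D U = 0.
  move=> U0; have no_index (i : 'I_(rdegree U)) : False by rewrite U0 in i; case: i.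
  have : exseq U U U.
    exists 0, 0, 0, 0; split; first split.
    1-4: by apply/matrixP=> i; case: (no_index i).
    1-2: by move=> x Gx; rewrite mulmx0 mul0mx.
  by move/Dex=> e; apply: (addrI (D U)); rewrite addr0 -e.
have [N0|nzN] := eqVneq (rdegree N) 0%N; first by rewrite !D0 ?eqd.
have nz1 : (1%:M : 'M[F]_(rdegree N)) != 0.
  by rewrite -mxrank_eq0 mxrank1.
have [V simV] : exists V : 'M_(rdegree N), mxsimple N V.
  move: nz1 (mxmodule1 N); move: 1%:M => U nzU modU.
  have [m] := ubnP (\rank U); elim: m U nzU modU => // m IHm U nzU modU leU.
  have [simU | nsimU] := boolp.pselect (mxnonsimple N U); last first.
    by exists U; apply/mxsimpleP; split.
  case: simU => W /and4P[modW sWU nzW ltW]; apply: IHm nzW modW _.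
  exact: leq_trans ltW _.
have [K1 [K2 [Q [ex1 ex2]]]] := simple_subquotient cpMN simV.
have exN := exseq_sub (mxsimple_module simV); have [_ nzV _] := simV.
pose M' := dadd_grepr K2 Q; have exM' : exseq K2 M' Q := exseq_dadd K2 Q.
set VV := Representation (submod_repr _) in ex2 exN.
set N' := Representation (factmod_repr _) in exN.
have eqD : D M' = D N'.
  apply: IHd => [|a].
    rewrite -(exseq_dim exN) ltnS in ltN; apply: leq_trans ltN.
    by rewrite -add1n leq_add2r /= lt0n mxrank_eq0.
  have monV : char_poly (gring_mx VV a) != 0 by rewrite monic_neq0 ?char_poly_monic.
  apply: (mulfI monV); rewrite -(exseq_char_poly a exN) -cpMN (exseq_char_poly a ex1).
  by rewrite (exseq_char_poly a ex2) (exseq_char_poly a exM') -mulrA mulrCA.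
rewrite (Dex _ _ _ ex1) (Dex _ _ _ ex2) (Dex _ _ _ exN) -eqD (Dex _ _ _ exM').
by rewrite addrAC addrC.
Qed.

End ExactSequences.

(** * Homomorphism representations *)

Section HomRepresentation.
Variables (F : fieldType) (gT : finGroupType) (G : {group gT}).
Implicit Types M L U V W : representation F G.

Definition hom_mx M L (x : gT) : 'M[F]_(rdegree M * rdegree L) :=
  lin_mx (mulmxr (L x) \o mulmx (M x^-1%g)).

Lemma mxvec_hom M L x (X : 'M_(rdegree M, rdegree L)) :
  mxvec X *m hom_mx M L x = mxvec (M x^-1%g *m X *m L x).
Proof. by rewrite mul_vec_lin. Qed.

Lemma hom_mx_repr M L : mx_repr G (hom_mx M L).
Proof.
split=> [|x y Gx Gy]; apply/row_matrixP=> i; rewrite !rowE.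
  by rewrite -[_ *m hom_mx _ _ _]/(_ *m _) -(vec_mxK (delta_mx 0 i)) mxvec_hom invg1
     !repr_mx1 mul1mx !mulmx1.
rewrite mulmxA -(vec_mxK (delta_mx 0 i)) !mxvec_hom invMg !repr_mxM ?groupV //.
by rewrite !mulmxA.
Qed.

Definition hom_repr M L : representation F G :=
  Representation (MxRepresentation (hom_mx_repr M L)).

Lemma hom_fixP M L (H : {group gT}) (X : 'M_(rdegree M, rdegree L)) : H \subset G ->
  reflect (forall x, x \in H -> M x *m X = X *m L x)
          (mxvec X <= rfix_mx (hom_repr M L) H)%MS.
Proof.
move=> sHG; apply: (iffP (rfix_mxP _)) => eqX x Hx; have Gx := subsetP sHG x Hx.
  have := eqX x Hx; rewrite /= mxvec_hom => /(can_inj mxvecK) e.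
  by rewrite -{1}e -mulmxA mulmxA -repr_mxM ?groupV // mulgV repr_mx1 mul1mx.
by rewrite /= mxvec_hom -mulmxA -eqX // mulmxA -repr_mxM ?groupV // mulVg repr_mx1 mul1mx.
Qed.

Lemma lin_mulmx_comp m n q l (A : 'M[F]_(n, m)) (B : 'M_(q, n)) :
  lin_mx (mulmx A : 'M_(m, l) -> _) *m lin_mx (mulmx B : 'M_(n, l) -> _)
  = lin_mx (mulmx (B *m A) : 'M_(m, l) -> _).
Proof.
apply/row_matrixP=> i; rewrite !rowE mulmxA -(vec_mxK (delta_mx 0 i)).
by rewrite !mul_vec_lin /= mulmxA.
Qed.

Lemma lin_mulmx_add m n l (A B : 'M[F]_(n, m)) :
  lin_mx (mulmx A : 'M_(m, l) -> _) + lin_mx (mulmx B)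
  = lin_mx (mulmx (A + B) : 'M_(m, l) -> _).
Proof.
apply/row_matrixP=> i; rewrite linearD /= !rowE -(vec_mxK (delta_mx 0 i)).
by rewrite !mul_vec_lin /= mulmxDl linearD.
Qed.

Lemma lin_mulmx1 m l : lin_mx (mulmx (1%:M : 'M[F]_m) : 'M_(m, l) -> _) = 1%:M.
Proof.
apply/row_matrixP=> i; rewrite !rowE -(vec_mxK (delta_mx 0 i)).
by rewrite !mul_vec_lin /= mul1mx mulmx1.
Qed.

Lemma lin_mulmx0 m n l : lin_mx (mulmx (0 : 'M[F]_(n, m)) : 'M_(m, l) -> _) = 0.
Proof.
apply/row_matrixP=> i; rewrite !rowE -(vec_mxK (delta_mx 0 i)).
by rewrite !mul_vec_lin /= mul0mx linear0 mulmx0.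
Qed.

(** The linear splitting makes Hom(-, L) exact, with the arrows reversed. *)
Lemma hom_exseq L U V W : exseq U V W ->
  exseq (hom_repr W L) (hom_repr V L) (hom_repr U L).
Proof.
move=> [P1 [Q1 [P2 [Q2 [[e1 e2 e3 e4] eq1 eq2]]]]].
pose lin m n (A : 'M[F]_(m, n)) := lin_mx (mulmx A : 'M_(n, rdegree L) -> _).
have eqv (A B : representation F G) (P : 'M_(rdegree A, rdegree B)) :
    equivariant P -> @equivariant _ _ _ (hom_repr B L) (hom_repr A L) (lin _ _ P).
  move=> eqP x Gx; apply/row_matrixP=> i; rewrite !rowE !mulmxA.
  rewrite -(@vec_mxK _ (rdegree B) (rdegree L) (delta_mx 0 i)).
  have linE X : mxvec X *m lin _ _ P = mxvec (P *m X) by rewrite mul_vec_lin.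
  rewrite linE [mxvec _ *m hom_repr B L x]mxvec_hom.
  rewrite [LHS]linE [RHS]mxvec_hom.
  by rewrite !mulmxA eqP // groupV.
exists (lin _ _ P2), (lin _ _ Q2), (lin _ _ P1), (lin _ _ Q1).
split; [split | exact: eqv | exact: eqv].
- by rewrite /lin lin_mulmx_comp e2 lin_mulmx1.
- by rewrite /lin lin_mulmx_comp e1 lin_mulmx1.
- by rewrite /lin lin_mulmx_comp e3 lin_mulmx0.
by rewrite /lin !lin_mulmx_comp lin_mulmx_add addrC e4 lin_mulmx1.
Qed.

End HomRepresentation.

(* Lovasz: sorting homomorphisms to L by their image, the numbers of homomorphisms into all L determine,
   by induction on dim L, the numbers of surjections; so M and N surject onto each other. *)
Lemma mx_rsim_of_hom_rank (F : finFieldType) (gT : finGroupType) (G : {group gT})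
    (M N : representation F G) :
    (forall L, \rank (rfix_mx (hom_repr M L) G) = \rank (rfix_mx (hom_repr N L) G)) ->
  mx_rsim M N.
Proof.
move=> eqMN.
pose Homs (A L : representation F G) :=
  [set X : 'M[F]_(rdegree A, rdegree L) | (mxvec X <= rfix_mx (hom_repr A L) G)%MS].
pose Surj (A L : representation F G) := [set X in Homs A L | row_full X].
have HomsP (A L : representation F G) (X : 'M[F]_(rdegree A, rdegree L)) :
    reflect (forall x, x \in G -> A x *m X = X *m L x) (X \in Homs A L).
  by rewrite inE; apply: hom_fixP.
have cardHoms A L : #|Homs A L| = (#|F| ^ \rank (rfix_mx (hom_repr A L) G))%N.
  rewrite -card_rowg -(card_imset _ (can_inj mxvecK)); apply: eq_card => v.
  rewrite mem_rowg; apply/imsetP/idP=> [[X] | fv]; first by rewrite inE => hX ->.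
  by exists (vec_mx v); rewrite ?vec_mxK // inE vec_mxK.
(* Homomorphisms are sorted by the normal form of their row space; the full row space singles out
   the surjections. *)
have split_homs (A L : representation F G) : #|Homs A L| = (#|Surj A L| +
     \sum_(K : 'M_(rdegree L) | K != <<1%:M>>%MS) #|[set X in Homs A L | <<X>>%MS == K]|)%N.
  rewrite -sum1_card (partition_big (fun X => <<X>>%MS) predT) //= (bigD1 <<1%:M>>%MS) //=.
  congr (_ + _)%N.
    rewrite sum1dep_card; apply: eq_card => X; rewrite !inE; congr (_ && _).
    by rewrite -sub1mx; apply/eqP/idP=> [/genmxP/eqmxP-> // | s1X]; apply/genmxP; rewrite submx1.
  by apply: eq_bigr => K _; rewrite sum1dep_card; apply: eq_card => X; rewrite !inE.
have fib (A L : representation F G) (K : 'M_(rdegree L)) (modK : mxmodule L K) :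
    <<K>>%MS = K -> #|[set X in Homs A L | <<X>>%MS == K]| = #|Surj A (Representation (submod_repr modK))|.
  move=> genK; rewrite -(card_imset _ (can_inj (@val_submodK _ _ K _))).
  apply: eq_card => X; rewrite inE; apply/andP/imsetP=> [[hX /eqP defK] | ].
    have sXK : (X <= K)%MS by rewrite -defK genmxE.
    exists (in_submod K X); last by rewrite in_submodK.
    rewrite inE; apply/andP; split.
      apply/HomsP=> x Gx /=; apply: val_submod_inj.
      rewrite val_submodJ // in_submodK // -(HomsP _ _ _ hX x Gx).
      by rewrite val_submodE -mulmxA -val_submodE in_submodK.
    by rewrite -sub1mx -val_submodS val_submod1 in_submodK // -{1}defK genmxE.
  case=> Y; rewrite inE => /andP[hY fullY] ->; split.
    apply/HomsP=> x Gx; rewrite -val_submodJ // -(HomsP _ _ _ hY x Gx).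
    by rewrite [RHS]val_submodE -mulmxA -val_submodE.
  rewrite -{2}genK; apply/eqP/genmxP; rewrite val_submodP /=.
  by rewrite -{1}(val_submod1 K) val_submodS sub1mx.
have eqSurj L : #|Surj M L| = #|Surj N L|.
  have [d] := ubnP (rdegree L); elim: d L => // d IHd L ltL.
  suff eqS : (\sum_(K : 'M_(rdegree L) | K != <<1%:M>>%MS) #|[set X in Homs M L | <<X>>%MS == K]|
      = \sum_(K : 'M_(rdegree L) | K != <<1%:M>>%MS) #|[set X in Homs N L | <<X>>%MS == K]|)%N.
    by apply/eqP; rewrite -(eqn_add2r (\sum_(K : 'M_(rdegree L) | K != <<1%:M>>%MS)
        #|[set X in Homs M L | <<X>>%MS == K]|)) {2}eqS -!split_homs !cardHoms eqMN.
  (* Only a K in normal form that is a proper submodule can contribute, and it does so by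
     surjections onto a module of smaller degree. *)
  apply: eq_bigr => K neqK.
  have [genK|ngenK] := eqVneq <<K>>%MS K; last first.
    rewrite !eq_card0 // => X; rewrite inE; apply/andP=> -[_ /eqP defK];
    by move: ngenK; rewrite -defK genmx_id eqxx.
  have [modK|nmodK] := boolP (mxmodule L K); last first.
    rewrite !eq_card0 // => X; rewrite inE; apply/andP=> -[hX /eqP defK];
    case/negP: nmodK; rewrite -defK (eqmx_module _ (genmxE _)); apply/mxmoduleP=> x Gx;
    by rewrite -(HomsP _ _ _ hX x Gx) submxMl.
  rewrite !(fib _ _ _ modK) //; apply: IHd; rewrite ltnS in ltL; apply: leq_trans ltL => /=.
  rewrite ltn_neqAle rank_leq_row andbT; apply: contraNneq neqK => fullK.
  by rewrite -genK; apply/eqP/genmxP; rewrite submx1 sub1mx /row_full fullK eqxx.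
have surj_refl (A : representation F G) : (0 < #|Surj A A|)%N.
  apply/card_gt0P; exists 1%:M; rewrite inE /row_full mxrank1 eqxx andbT.
  by apply/HomsP=> x Gx; rewrite mulmx1 mul1mx.
have /card_gt0P[f] : (0 < #|Surj M N|)%N by rewrite eqSurj.
have /card_gt0P[g] : (0 < #|Surj N M|)%N by rewrite -eqSurj.
rewrite !inE -!/(_ \in Homs _ _) => /andP[_ /eqP fullg] /andP[hf /eqP fullf].
have dMN : rdegree M = rdegree N.
  apply/eqP; rewrite eqn_leq; apply/andP; split; [rewrite -fullg | rewrite -fullf];
    exact: rank_leq_row.
exists f => //; first by rewrite /row_free fullf dMN.
by move=> x Gx; have /HomsP-> : f \in Homs M N by rewrite inE.
Qed.

(** * Exactness of the weighted fixed rank *)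

Section FixedRank.
Variables (p : nat) (F : fieldType) (gT : finGroupType) (G : {group gT}).
Variables (I : finType) (z : I -> rat) (Hs : I -> {group gT}).
Hypothesis pF : p \in [pchar F].
Hypothesis sHs : forall i, Hs i \subset G.
Hypothesis weight0 : forall (P : {group gT}) (w : {set gT} -> rat),
  P \subset G -> (p.-group P)%g -> (P :!=: 1)%g ->
  (\sum_i z i / #|Hs i|%:R * \sum_(g in G) w ('N_G(P) :&: Hs i :^ g)%g = 0)%R.

Definition fixed_rank (V : representation F G) : rat :=
  \sum_i z i * (\rank (rfix_mx V (Hs i)))%:R.

Lemma rfix_tr n (r : mx_representation F G n) (K H : {group gT}) :
  K \subset H -> H \subset G -> (rfix_mx r K *m tr_mx r K H <= rfix_mx r H)%MS.
Proof.
move=> sKH sHG; apply/rfix_mxP=> h Hh; have Gh := subsetP sHG h Hh.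
have sKG := subset_trans sKH sHG.
rewrite mulmx_tr mulmx_suml (reindex_inj (@rcoset_inj _ h^-1%g)) /=.
rewrite (eq_bigl [in rcosets K H]) => [|C]; last first.
  apply/idP/idP=> /rcosetsP[x Hx].
    move/(congr1 (fun A => A :* h)%g); rewrite rcosetKV -rcosetM => ->.
    by apply/rcosetsP; exists (x * h)%g; rewrite ?groupM.
  by move->; apply/rcosetsP; exists (x * h^-1)%g; rewrite ?groupM ?groupV ?rcosetM.
apply: eq_bigr => _ /rcosetsP[x Hx ->]; have Gx := subsetP sHG x Hx.
have Gxh : (x * h^-1)%g \in G by rewrite groupM ?groupV.
rewrite -rcosetM !(rfix_repr sKG (submx_refl _)) //.
by rewrite -mulmxA -repr_mxM // mulgKV.
Qed.

Lemma rfix_family n (r : mx_representation F G n) :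
  mackey_family r (fun H => rfix_mx r H).
Proof.
split=> // [K H sKH sHG|H g sHG Gg|K H sKH sHG].
- exact: rfix_mxS.
- by rewrite rfix_mx_conjsg.
exact: rfix_tr.
Qed.

(** Fixed points are only left exact: the defect at H is W^H modulo the image B(H) of V^H. Both are
    Mackey families, and they agree at the trivial group, where V maps onto W; so [mackey_vanish]
    applies to the defect. *)
Lemma fixed_rank_exact U V W : exseq U V W -> fixed_rank V = fixed_rank U + fixed_rank W.
Proof.
move=> [P1 [Q1 [P2 [Q2 [[e1 e2 e3 e4] eq1 eq2]]]]].
pose B (H : {group gT}) : 'M[F]_(rdegree W) := <<rfix_mx V H *m P2>>%MS.
have fixP2 m (u : 'M_(m, _)) (H : {group gT}) : H \subset G -> (u <= rfix_mx V H)%MS ->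
    (u *m P2 <= rfix_mx W H)%MS.
  move=> sHG /rfix_mxP fixu; apply/rfix_mxP=> h Hh.
  by rewrite -mulmxA -eq2 ?(subsetP sHG) // mulmxA fixu.
have famB : mackey_family W B.
  split=> [H sHG|K H sKH sHG|H g sHG Gg|K H sKH sHG]; rewrite /B ?genmxE.
  - exact: fixP2.
  - by rewrite submxMr // rfix_mxS.
  - rewrite (eqmxMr _ (genmxE _)) -mulmxA -eq2 // mulmxA submxMr //.
    by rewrite rfix_mx_conjsg.
  rewrite (eqmxMr _ (genmxE _)) -mulmxA.
  have -> : P2 *m tr_mx W K H = tr_mx V K H *m P2.
    rewrite /tr_mx mulmx_sumr mulmx_suml; apply: eq_bigr => _ /rcosetsP[x Hx ->].
    rewrite eq2 //; have [k Kk ->] := mem_repr_rcosetP K x.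
    by rewrite groupM // (subsetP sHG) // (subsetP sKH).
  by rewrite mulmxA submxMr // rfix_tr.
have leBA (H : {group gT}) : H \subset G -> (B H <= rfix_mx W H)%MS.
  by move=> sHG; rewrite genmxE fixP2.
have B1 : (rfix_mx W 1%G <= B 1%G)%MS.
  have full1 n (r : mx_representation F G n) : (1%:M <= rfix_mx r 1%G)%MS.
    by apply/rfix_mxP=> x /set1P->; rewrite repr_mx1 mulmx1.
  rewrite genmxE (submx_trans (submx1 _)) // -e2.
  by rewrite submxMr // (submx_trans (submx1 _)) ?full1.
have := mackey_vanish pF sHs weight0 (rfix_family W) famB leBA B1.
pose rk (L : representation F G) i : rat := z i * (\rank (rfix_mx L (Hs i)))%:R.
rewrite (eq_bigr (fun i => rk W i - (rk V i - rk U i))).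
  by rewrite !sumrB => /eqP; rewrite subr_eq0 => /eqP eqW; rewrite /fixed_rank eqW addrC subrK.
move=> i _; rewrite -!mulrBr; congr (_ * (_ - _)).
rewrite genmxE -(mxrank_mul_ker (rfix_mx V (Hs i)) P2) natrD.
suff -> : \rank (rfix_mx V (Hs i) :&: kermx P2)%MS = \rank (rfix_mx U (Hs i)) by rewrite addrK.
have freeP1 : row_free P1 by apply/row_freeP; exists Q1.
rewrite -(mxrankMfree _ freeP1); apply/eqP; rewrite eqn_leq; apply/andP; split; apply: mxrankS.
  apply/rV_subP=> v; rewrite sub_capmx => /andP[fixv /sub_kermxP vP2].
  have defv : v = v *m Q1 *m P1.
    by rewrite -[LHS]mulmx1 -e4 mulmxDr !mulmxA vP2 mul0mx addr0.
  rewrite defv submxMr //; apply/rfix_mxP=> h Hh; have Gh := subsetP (sHs i) h Hh.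
  apply: (row_free_inj freeP1); rewrite /= -[LHS]mulmxA eq1 // mulmxA -defv.
  by move/rfix_mxP: fixv => ->.
rewrite sub_capmx; apply/andP; split; last by apply/sub_kermxP; rewrite -mulmxA e3 mulmx0.
apply/rfix_mxP=> h Hh; have Gh := subsetP (sHs i) h Hh.
by rewrite -mulmxA -eq1 // mulmxA rfix_mx_id.
Qed.

End FixedRank.

(** * Marks of Burnside ring elements *)

Local Open Scope group_scope.

Section Orbits.
Variables (gT : finGroupType) (D : {group gT}) (T : finType) (to : action D T).
Variable G : {group gT}.
Hypothesis sGD : G \subset D.
Implicit Types (K H : {group gT}).

Lemma stab_act x g : g \in G -> 'C_G[to x g | to] = 'C_G[x | to] :^ g.
Proof.
move=> Gg; have Dg := subsetP sGD g Gg.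
by rewrite conjIg (conjGid Gg) -(astab_setact_in to [set x] Dg) /setact imset_set1.
Qed.

Lemma mem_stab x a : a \in G -> (a \in 'C_G[x | to]) = (to x a == x).
Proof.
move=> Ga; have Da := subsetP sGD a Ga.
rewrite inE Ga /= -sub1set sub_astab1_in ?sub1set //.
by apply/afix1P/eqP.
Qed.

(** An element g is counted on the right exactly when A fixes x g, and each point of the orbit is x
    g for a full coset of the stabilizer. Clearing the stabilizer order turns marks into counts
    inside G. *)
Lemma card_fix_orbit x (A : {set gT}) : A \subset G ->
  (#|'C_G[x | to]| * #|'Fix_(orbit to G x | to)(A)|)%N = #|[set g in G | A \subset 'C_G[x | to] :^ g]|.
Proof.
move=> sAG; have sAD := subset_trans sAG sGD.
have fixE g : g \in G -> (A \subset 'C_G[x | to] :^ g) = (to x g \in 'Fix_to(A)).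
  by move=> Gg; rewrite -stab_act // subsetI sAG /= sub_astab1_in.
rewrite -[RHS]sum1_card [RHS](partition_big (to x) [in 'Fix_(orbit to G x | to)(A)]) /=; last first.
  by move=> g; rewrite inE => /andP[Gg fixg]; rewrite inE mem_orbit //= -fixE.
rewrite (eq_bigr (fun=> #|'C_G[x | to]|)) => [|y]; first by rewrite sum_nat_const mulnC.
rewrite inE => /andP[/imsetP[g Gg ->] fixy]; rewrite sum1dep_card.
rewrite -[RHS](card_rcoset _ g); apply: eq_card => h.
rewrite [RHS]mem_rcoset [LHS]inE [in LHS]inE; have [Gh|nGh] /= := boolP (h \in G); last first.
  by apply/esym/negbTE; apply: contra nGh => /setIP[Ghg _]; rewrite -(groupMr _ (groupVr Gg)).
have Dh := subsetP sGD h Gh; have Dg := subsetP sGD g Gg.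
rewrite mem_stab ?groupM ?groupV // actMin ?groupV // fixE //.
have -> : (to (to x h) g^-1 == x) = (to x h == to x g).
  by rewrite -(inj_eq (act_inj to g)) actKVin.
by case: eqVneq => [->|]; rewrite ?fixy ?andbF.
Qed.

End Orbits.

Section Marks.
Variables (gT : finGroupType).
Implicit Types (G H K L : {group gT}).

Lemma subDomRs G : G \subset [set: gT]%G. Proof. exact: subsetT. Qed.

Lemma rcosets_orbit H G : rcosets H G = orbit 'Rs G H.
Proof. by apply/setP=> C; apply/imsetP/imsetP=> -[x Gx ->]; exists x; rewrite //= rcosetE. Qed.

Lemma stab_coset H G : H \subset G -> 'C_G[gval H | 'Rs] = H.
Proof. by move=> sHG; rewrite astab1Rs (setIidPr sHG). Qed.

(** G/H is isomorphic to an orbit precisely when H is the stabilizer of one of its points. The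
    encoded class is thus a conjugacy class of subgroups, the form in which it is used from here
    on. *)
Lemma trans_class_orbit G (D : {group gT}) (T : finType) (to : action D T) x :
  G \subset D -> trans_class G to (orbit to G x) = orbit 'JG G 'C_G[x | to]%G.
Proof.
move=> sGD; apply/setP=> H; rewrite inE; apply/andP/imsetP=> [[] | [g Gg defH]].
  rewrite inE => sHG /existsP[f /and3P[/dinjectiveP injf /eqP imf /forall_inP eqf]].
  have rH : gval H \in rcosets H G by rewrite rcosets_orbit orbit_refl.
  have /imsetP[g Gg fH] : f H \in orbit to G x by rewrite -imf imset_f.
  exists g => //; apply/val_inj; rewrite /= -(stab_act to sGD) // -fH; apply/setP=> a.
  have [Ga|nGa] := boolP (a \in G); last first.
    by rewrite inE (negPf nGa); apply/negbTE; apply: contra nGa; apply: (subsetP sHG).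
  rewrite (mem_stab to sGD) // -(eqP (forall_inP (eqf _ rH) a Ga)) (inj_in_eq injf) //; last first.
    by rewrite rcosets_orbit mem_orbit.
  rewrite /= rcosetE; apply/idP/eqP=> [Ha | <-]; [exact: rcoset_id | exact: rcoset_refl].
have Hstab : H :=: 'C_G[to x g | to] by rewrite defH (stab_act to sGD).
have sHG : H \subset G by rewrite Hstab subsetIl.
split; first by rewrite inE.
pose y := to x g; have Dg := subsetP sGD g Gg.
pose f : {ffun {set gT} -> T} := [ffun C : {set gT} => to y (repr C)].
have fE a : a \in G -> f (H :* a) = to y a.
  move=> Ga; rewrite ffunE; have Da := subsetP sGD a Ga.
  case/rcosetP: (mem_repr_rcoset H a) => h Hh ->; have Gh := subsetP sHG h Hh; rewrite actMin ?(subsetP sGD) //.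
  by move: Hh; rewrite Hstab (mem_stab to sGD) // => /eqP->.
apply/existsP; exists f; apply/and3P; split.
- apply/dinjectiveP=> _ _ /rcosetsP[a Ga ->] /rcosetsP[b Gb ->]; rewrite !fE // => eqab.
  have [Da Db] := (subsetP sGD a Ga, subsetP sGD b Gb).
  apply/rcoset_eqP; rewrite mem_rcoset Hstab (mem_stab to sGD) ?groupM ?groupV //.
  by rewrite actMin ?groupV // -/y eqab actKin.
- apply/eqP/setP=> z; apply/imsetP/imsetP=> [[_ /rcosetsP[a Ga ->] ->] | [a Ga ->]].
    by exists (g * a); rewrite ?groupM // fE // actMin // (subsetP sGD).
  have Dga : g^-1 * a \in D by rewrite groupM ?groupV // (subsetP sGD).
  exists (H :* (g^-1 * a)); first by apply/rcosetsP; exists (g^-1 * a); rewrite ?groupM ?groupV.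
  by rewrite fE ?groupM ?groupV // -actMin // mulKVg.
apply/forall_inP=> _ /rcosetsP[a Ga ->]; apply/forall_inP=> b Gb.
by rewrite /= rcosetE -rcosetM !fE ?groupM // actMin ?(subsetP sGD).
Qed.

Lemma trans_class_coset G H : H \subset G ->
  trans_class G 'Rs%act (rcosets H G) = orbit 'JG G H.
Proof.
move=> sHG; rewrite rcosets_orbit (trans_class_orbit _ _ (subDomRs G)).
by congr (orbit _ _ _); apply: val_inj; rewrite /= stab_coset.
Qed.

Variable G : {group gT}.

Lemma trans_reprP (c : trans_type G) :
  (trans_repr c \subset G) /\ val c = orbit 'JG G (trans_repr c).
Proof.
have /imsetP[H sHG defc] := valP c; rewrite inE in sHG.
rewrite trans_class_coset // in defc.
rewrite /trans_repr; case: pickP => [K /= Kc | none]; last first.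
  by have := none H; rewrite defc orbit_refl.
have := Kc; rewrite defc => /imsetP[g Gg defK]; split.
  by rewrite defK /= -(conjGid Gg) conjSg.
by rewrite defK; apply/esym; apply: (orbit_act 'JG).
Qed.

Lemma trans_repr_sub (c : trans_type G) : trans_repr c \subset G.
Proof. by case: (trans_reprP c). Qed.

Lemma trans_type_of H : H \subset G -> {c : trans_type G | val c = orbit 'JG G H}.
Proof.
move=> sHG; have cP : orbit 'JG G H \in trans_classes G.
  by apply/imsetP; exists H; rewrite ?inE ?trans_class_coset.
by exists (exist (fun c => c \in trans_classes G) _ cP).
Qed.

(** An entry of the table of marks. *)
Definition nfix (A H : {set gT}) : nat := #|'Fix_(rcosets H G | 'Rs)(A)|.

Lemma card_nfix (A : {set gT}) H : A \subset G -> H \subset G ->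
  (#|H| * nfix A H)%N = #|[set g in G | A \subset H :^ g]|.
Proof.
move=> sAG sHG; have := @card_fix_orbit _ _ _ 'Rs%act G (subDomRs G) (gval H) A sAG.
by rewrite /nfix rcosets_orbit stab_coset.
Qed.

Lemma nfixJ (A : {set gT}) H g : A \subset G -> H \subset G -> g \in G ->
  nfix A (H :^ g) = nfix A H.
Proof.
move=> sAG sHG Gg; apply/eqP; rewrite -(eqn_pmul2l (cardG_gt0 H)) card_nfix //.
have sHgG : (H :^ g)%G \subset G by rewrite -(conjGid Gg) conjSg.
rewrite -{1}(cardJg H g) -(card_imset _ (mulgI g^-1)) (card_nfix sAG sHgG).
apply/eqP; apply: eq_card => x; apply/idP/imsetP=> [| [y]]; rewrite inE => /andP[Gx sA].
  exists (g * x); last by rewrite mulKg.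
  by rewrite inE groupM //= conjsgM.
by move->; rewrite inE groupM ?groupV //= -conjsgM mulKVg.
Qed.

Lemma nfix_orbit (A : {set gT}) H K : A \subset G -> H \subset G -> K \in orbit 'JG G H ->
  nfix A K = nfix A H.
Proof. by move=> sAG sHG /imsetP[g Gg ->]; apply: nfixJ. Qed.

Definition mark (A : {set gT}) : burnside G -> int :=
  burnside_lift (fun c => (nfix A (trans_repr c))%:Z).
HB.instance Definition _ A := GRing.Additive.on (mark A).

Lemma markE (A : {set gT}) x :
  mark A x = (\sum_c x c * (nfix A (trans_repr c))%:Z)%R.
Proof. by apply: eq_bigr => c _; rewrite mulrzz mulrC. Qed.

Lemma mark_gset (D : {group gT}) (T : finType) (to : action D T) (S : {set T}) (A : {set gT}) :
    G \subset D -> [acts G, on S | to] -> A \subset G ->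
  mark A (gset_class G to S) = #|'Fix_(S | to)(A)|%:Z.
Proof.
move=> sGD actS sAG; rewrite /gset_class raddf_sum /=.
have -> : #|'Fix_(S | to)(A)| = (\sum_(O in orbit to G @: S) #|'Fix_(O | to)(A)|)%N.
  rewrite -sum1_card; under eq_bigl do rewrite inE.
  rewrite (set_partition_big_cond _ (orbit_partition actS)) /=.
  by apply: eq_bigr => O _; rewrite -sum1_card; apply: eq_bigl => y; rewrite [RHS]inE.
rewrite -[RHS]natz natr_sum; apply: eq_bigr => _ /imsetP[x Sx ->].
have sCG : 'C_G[x | to]%G \subset G by apply: subsetIl.
have [c0 defc0] := trans_type_of sCG.
rewrite markE (bigD1 c0) //= big1 ?addr0 => [|c neqc]; last first.
  rewrite ffunE trans_class_orbit // -defc0 (inj_eq val_inj) (negPf neqc) mul0r //.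
rewrite ffunE trans_class_orbit // defc0 eqxx mul1r natz; congr (Posz _).
have [sr defr] := trans_reprP c0.
rewrite (@nfix_orbit A 'C_G[x | to]%G) //; last by rewrite -defc0 defr orbit_refl.
apply/eqP; rewrite -(eqn_pmul2l (cardG_gt0 'C_G[x | to]%G)) card_nfix //.
by rewrite -card_fix_orbit.
Qed.

Lemma actsRs H K : K \subset G -> [acts K, on rcosets H G | 'Rs].
Proof. by move=> sKG; apply: subset_trans sKG (actsRs_rcosets H G). Qed.

Lemma mark_coset (A : {set gT}) H : A \subset G -> mark A (coset_class G H) = (nfix A H)%:Z.
Proof.
by move=> sAG; rewrite /coset_class mark_gset ?subDomRs ?actsRs.
Qed.

Lemma coset_classE H c : H \subset G -> val c = orbit 'JG G H ->
  coset_class G H = [ffun c' => (c' == c)%:R%R].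
Proof.
move=> sHG defc; rewrite /coset_class /gset_class.
have -> : orbit 'Rs G @: rcosets H G = [set rcosets H G].
  rewrite rcosets_orbit; apply/setP=> O; rewrite inE; apply/imsetP/eqP=> [[x] | ->].
    by case/imsetP=> g Gg -> ->; apply: (orbit_act 'Rs).
  by exists (gval H); rewrite ?orbit_refl.
rewrite big_set1; apply/ffunP=> c'; rewrite !ffunE trans_class_coset // -defc.
by rewrite (inj_eq val_inj).
Qed.

Lemma coset_class_repr c : coset_class G (trans_repr c) = [ffun c' => (c' == c)%:R%R].
Proof. by case: (trans_reprP c) => sr defr; apply: coset_classE. Qed.

Lemma burnside_mulzE (x : burnside G) n c : ((x *~ n) c = x c *~ n)%R.
Proof. by case: n => n; rewrite ?NegzE ?mulrNz ?ffunE -!pmulrn ffunMnE. Qed.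

Lemma burnside_lift_weight (gT' : finGroupType) (H : {group gT'})
    (f : trans_type H -> burnside G) (r : trans_type G -> int) x :
  (\sum_c burnside_lift f x c * r c = \sum_d x d * \sum_c r c *~ f d c)%R.
Proof.
transitivity (\sum_c \sum_d f d c *~ x d * r c)%R.
  apply: eq_bigr => c _; rewrite sum_ffunE mulr_suml.
  by apply: eq_bigr => d _; rewrite burnside_mulzE.
rewrite exchange_big; apply: eq_bigr => d _; rewrite mulr_sumr; apply: eq_bigr => c _ /=.
by rewrite !mulrzz mulrAC mulrC [(f d c * _)%R]mulrC.
Qed.

End Marks.

Lemma mark_lift (gT1 gT2 : finGroupType) (G : {group gT1}) (L : {group gT2})
    (f : trans_type G -> burnside L) A (x : burnside G) :
  mark A (burnside_lift f x) = (\sum_c x c * mark A (f c))%R.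
Proof.
rewrite /burnside_lift raddf_sum /=; apply: eq_bigr => c _.
by rewrite raddfMz mulrzz mulrC.
Qed.

Section MarksMore.
Variable gT : finGroupType.
Implicit Types (G H K L U : {group gT}) (A : {set gT}).

Lemma nfix_gt0 G A H : A \subset G -> H \subset G ->
  (0 < nfix G A H)%N -> exists2 g, g \in G & A \subset H :^ g.
Proof.
move=> sAG sHG n0; have : (0 < #|H| * nfix G A H)%N by rewrite muln_gt0 cardG_gt0.
rewrite card_nfix // => /card_gt0P[g]; rewrite inE => /andP[Gg sA].
by exists g.
Qed.

Lemma nfix_self G H : H \subset G -> (0 < nfix G H H)%N.
Proof.
move=> sHG; have : (0 < #|H| * nfix G H H)%N.
  rewrite card_nfix //; apply/card_gt0P; exists 1.
  by rewrite inE group1 conjsg1 subxx.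
by rewrite muln_gt0 => /andP[].
Qed.

Lemma nfix0 G A H : A \subset G -> H \subset G ->
  (forall g, g \in G -> ~~ (A \subset H :^ g)) -> nfix G A H = 0%N.
Proof.
move=> sAG sHG no; apply/eqP; rewrite -leqn0 leqNgt; apply/negP.
by case/(nfix_gt0 sAG sHG) => g Gg sA; have := no g Gg; rewrite sA.
Qed.

Lemma nfixJl G A H g : A \subset G -> H \subset G -> g \in G ->
  nfix G (A :^ g) H = nfix G A H.
Proof.
move=> sAG sHG Gg; apply/eqP; rewrite -(eqn_pmul2l (cardG_gt0 H)) !card_nfix //; last first.
  by rewrite -(conjGid Gg) conjSg.
apply/eqP; rewrite -[RHS](card_imset _ (mulIg g)); apply: eq_card => x.
rewrite inE; apply/andP/imsetP=> [[Gx sA] | [y]].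
  exists (x * g^-1); last by rewrite mulgKV.
  by rewrite inE groupM ?groupV //= conjsgM -sub_conjg.
by rewrite inE => /andP[Gy sA] ->; rewrite groupM //= conjsgM conjSg.
Qed.

Lemma markJ G A g (x : burnside G) : A \subset G -> g \in G -> mark (A :^ g) x = mark A x.
Proof.
move=> sAG Gg; rewrite !markE; apply: eq_bigr => c _.
by rewrite nfixJl // trans_repr_sub.
Qed.

Lemma nfix_reprE G A H : A \subset G -> H \subset G ->
  nfix G A H = #|[set C in rcosets H G | A \subset H :^ repr C]|.
Proof.
move=> sAG sHG; apply: eq_card => C; rewrite in_setI [RHS]inE.
apply: andb_id2l => /rcosetsP[x Gx ->].
have [h Hh ->] := mem_repr_rcosetP H x; rewrite conjsgM conjGid //.
apply/afixP/subsetP=> fixA a Aa.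
  have eqH : H :* x :* a = H :* x by rewrite -[RHS](fixA a Aa) /= rcosetE.
  rewrite mem_conjg conjgE invgK.
  have : x * a \in H :* x by rewrite -eqH -rcosetM rcoset_refl.
  by rewrite mem_rcoset mulgA.
rewrite /= rcosetE -rcosetM; apply/rcoset_eqP.
by have := fixA a Aa; rewrite mem_conjg conjgE invgK mem_rcoset mulgA.
Qed.

(** The table of marks is triangular: at a subgroup of maximal order in the support of x, only its
    own class contributes. *)
Lemma mark_inj G (x : burnside G) :
  (forall T : {group gT}, T \subset G -> mark T x = 0%R) -> x = 0%R.
Proof.
move=> m0; apply/ffunP=> c0; rewrite ffunE; apply/eqP/negPn/negP=> nz0.
pose P c := x c != 0%R; have [c nzc maxc] := @arg_maxnP _ c0 P (fun c => #|trans_repr c|) nz0.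
have sTG := trans_repr_sub c.
have := m0 _ sTG; rewrite markE (bigD1 c) //= big1 ?addr0 => [|c' neqc].
  move/eqP; rewrite mulf_eq0 (negPf nzc) /= => /eqP[] n0.
  by have := nfix_self sTG; rewrite n0.
have [->|nzc'] := eqVneq (x c') 0%R; first by rewrite mul0r.
rewrite nfix0 ?mulr0 ?trans_repr_sub // => g Gg; apply: contra neqc => sT.
have eqT : (trans_repr c' :^ g)%G = trans_repr c.
  by apply/val_inj/eqP; rewrite eq_sym eqEcard sT /= cardJg; apply: maxc.
have [_ defc'] := trans_reprP c'; have [_ defc] := trans_reprP c.
rewrite -val_eqE /= [val c']defc' [val c]defc -eqT eq_sym; apply/eqP.
exact: (orbit_act 'JG).
Qed.

Lemma mark_eq G (x y : burnside G) :
  (forall T : {group gT}, T \subset G -> mark T x = mark T y) -> x = y.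
Proof.
move=> eqm; apply/eqP; rewrite -subr_eq0; apply/eqP/mark_inj => T sTG.
by rewrite raddfB /= eqm // subrr.
Qed.

Definition res G H : burnside G -> burnside H :=
  burnside_lift (fun c => gset_class H 'Rs%act (rcosets (trans_repr c) G)).
HB.instance Definition _ G H := GRing.Additive.on (@res G H).

Lemma mark_res G H A (x : burnside G) : H \subset G -> A \subset H ->
  mark A (res H x) = mark A x.
Proof.
move=> sHG sAH; rewrite mark_lift markE; apply: eq_bigr => c _.
by rewrite mark_gset ?subDomRs ?actsRs.
Qed.

(** A coset U g fixed by A lies over the coset H g, also fixed by A; over H x the fixed points are
    those of the conjugate of A by x^-1 on H/U. *)
Lemma nfix_ind G H A U : A \subset G -> H \subset G -> U \subset H ->
  nfix G A U = (\sum_(C in rcosets H G | A \subset H :^ repr C) nfix H (A :^ (repr C)^-1) U)%N.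
Proof.
move=> sAG sHG sUH; have sUG := subset_trans sUH sHG.
apply/eqP; rewrite -(eqn_pmul2l (cardG_gt0 U)) card_nfix // big_distrr /=; apply/eqP.
rewrite -sum1_card big_mkcondr /= (partition_big (fun g => H :* g) [in rcosets H G]) /=; last first.
  by move=> g; rewrite inE => /andP[Gg _]; apply/rcosetsP; exists g.
apply: eq_bigr => _ /rcosetsP[y Gy ->].
have [h Hh /= eqr] := mem_repr_rcosetP H y; set x := repr (H :* y) in eqr *.
have Gx : x \in G by rewrite eqr groupM // (subsetP sHG).
have -> : H :* y = H :* x.
  by apply/rcoset_eqP; rewrite mem_rcoset eqr invMg mulgA mulgV mul1g groupV.
rewrite sum1dep_card; case: ifP => [sAHx | nsA]; last first.
  apply: eq_card0 => g; rewrite !inE; apply/negbTE; apply/negP=> /andP[/andP[Gg sA] /eqP eqH].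
  move/negP: nsA; apply; apply: subset_trans sA _.
  have : g \in H :* x by rewrite -eqH rcoset_refl.
  case/rcosetP=> k Hk ->; rewrite conjsgM conjSg.
  by rewrite -(conjGid Hk) conjSg.
rewrite card_nfix //; last by rewrite sub_conjgV.
rewrite -[RHS](card_imset _ (mulIg x)); apply: eq_card => g.
rewrite !inE; apply/andP/imsetP=> [[/andP[Gg sA] /eqP eqH] | [k]].
  exists (g * x^-1); last by rewrite mulgKV.
  have Hk : g * x^-1 \in H by rewrite -mem_rcoset -eqH rcoset_refl.
  by rewrite inE Hk /= sub_conjgV -conjsgM mulgKV.
rewrite inE sub_conjgV -conjsgM => /andP[Hk sA] ->.
rewrite groupM // ?(subsetP sHG) //; split=> //.
by apply/eqP/rcoset_eqP; rewrite mem_rcoset mulgK.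
Qed.

Lemma mark_ind G H A (y : burnside H) : A \subset G -> H \subset G ->
  mark A (ind G y) = (\sum_(C in rcosets H G | A \subset H :^ repr C) mark (A :^ (repr C)^-1) y)%R.
Proof.
move=> sAG sHG; rewrite mark_lift.
under [RHS]eq_bigr do rewrite markE.
rewrite exchange_big /=; apply: eq_bigr => c _.
rewrite mark_coset // -mulr_sumr (nfix_ind sAG sHG (trans_repr_sub c)).
by rewrite -[in LHS]natz natr_sum; congr (_ * _)%R; apply: eq_bigr => C _; rewrite natz.
Qed.

Lemma mark_ind_res G H A (x : burnside G) : A \subset G -> H \subset G ->
  mark A (ind G (res H x)) = ((nfix G A H)%:Z * mark A x)%R.
Proof.
move=> sAG sHG; rewrite mark_ind // nfix_reprE //.
rewrite (eq_bigr (fun=> mark A x)) => [|C /andP[/rcosetsP[y Gy ->] sA]].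
  rewrite sumr_const -mulr_natl natz; congr (_%:Z * _)%R.
  by apply: eq_card => C; rewrite !inE.
have [h Hh eqr] := mem_repr_rcosetP H y.
have Gr : repr (H :* y) \in G by rewrite eqr groupM // (subsetP sHG).
by rewrite mark_res ?sub_conjgV // markJ ?groupV.
Qed.

(* Conditioning the sum on the value of [K :&: H_c :^ g] expresses it through the marks at subgroups of K. *)
Lemma mark_weight0 G K (z : burnside G) (w : {set gT} -> rat) : K \subset G ->
    (forall T : {group gT}, T \subset K -> mark T z = 0%R) ->
  (\sum_c (z c)%:~R / #|trans_repr c|%:R * \sum_(g in G) w (K :&: trans_repr c :^ g) = 0)%R.
Proof.
move=> sKG m0.
(* [e T] is the total weight of the pairs (c, g) with K :&: H_c^g equal to T; the mark at T collects
   these weights over all T' between T and K. *)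
pose e (T : {group gT}) : rat :=
  (\sum_c (z c)%:~R / #|trans_repr c|%:R *
    #|[set g in G | K :&: trans_repr c :^ g == T]|%:R)%R.
have markT (T : {group gT}) : T \subset K ->
    ((mark T z)%:~R = \sum_(T' : {group gT} | (T \subset T') && (T' \subset K)) e T' :> rat)%R.
  move=> sTK; rewrite markE rmorph_sum exchange_big /=; apply: eq_bigr => c _.
  rewrite -mulr_sumr -natr_sum rmorphM /=; have sHG := trans_repr_sub c.
  have Hc0 : (#|trans_repr c|%:R != 0 :> rat)%R by rewrite pnatr_eq0 -lt0n cardG_gt0.
  rewrite -mulrA; congr (_ * _)%R; apply: (mulfI Hc0); rewrite mulVKf //.
  rewrite -[((_ : nat)%:Z)%:~R]/(_%:R)%R -natrM card_nfix ?(subset_trans sTK) //; congr (_%:R)%R.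
  rewrite -sum1_card (partition_big (fun g => K :&: trans_repr c :^ g)%G
     (fun T' : {group gT} => (T \subset T') && (T' \subset K))) /=; last first.
    by move=> g; rewrite inE => /andP[Gg sT]; rewrite subsetI sTK sT subsetIl.
  apply: eq_bigr => T' /andP[sTT' sT'K]; rewrite sum1dep_card; apply: eq_card => g.
  rewrite !inE -val_eqE /=; apply/andP/andP=> [[/andP[Gg sT] eqT] | [Gg eqT]] //.
  by split=> //; rewrite Gg /=; move: sTT'; rewrite -(eqP eqT) subsetI => /andP[].
(* Moebius inversion, as a descending induction on T inside K. *)
have e0 (T : {group gT}) : T \subset K -> e T = 0%R.
  have [m] := ubnP (#|K| - #|T|); elim: m T => // m IHm T ltT sTK.
  have := markT T sTK; rewrite m0 // (bigD1 T) /= ?subxx // big1 ?addr0 => [<- //|T'].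
  case/andP=> /andP[sTT' sT'K] neqT; apply: IHm => //.
  have ltTT' : (#|T| < #|T'|)%N.
    by rewrite proper_card // properEneq sTT' andbT eq_sym.
  rewrite ltnS in ltT; apply: leq_trans ltT; apply: ltn_sub2l => //.
  exact: leq_trans ltTT' (subset_leq_card sT'K).
transitivity (\sum_(T : {group gT} | T \subset K) w T * e T)%R; last first.
  by apply: big1 => T sTK; rewrite e0 // mulr0.
under [RHS]eq_bigr do rewrite mulr_sumr.
rewrite exchange_big /=; apply: eq_bigr => c _.
rewrite [X in (_ * X)%R](partition_big (fun g => K :&: trans_repr c :^ g)%G
     (fun T' : {group gT} => T' \subset K)) /=; last first.
  by move=> g _; apply: subsetIl.
rewrite mulr_sumr; apply: eq_bigr => T sTK; rewrite mulrCA; congr (_ * _)%R.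
rewrite (eq_bigr (fun=> w T)) => [|g /andP[_ /eqP <-]] //.
rewrite sumr_const [RHS]mulr_natr; congr (_ *+ _)%R; apply: eq_card => g.
by rewrite !inE -val_eqE.
Qed.

Lemma infl_dom G (N : {group gT}) : N <| G ->
  G \subset [group of coset_morphism N @*^-1 [set: coset_of N]%G].
Proof. by move=> nsNG; rewrite /= -sub_morphim_pre ?subsetT // normal_norm. Qed.

Lemma acts_infl G (N : {group gT}) (K : {group coset_of N}) : N <| G ->
  [acts G, on rcosets K (G / N) | 'Rs \o coset_morphism N].
Proof.
move=> nsNG; have sGD := infl_dom nsNG; apply/subsetP=> a Ga; rewrite !inE.
apply/andP; split; first by have := subsetP sGD a Ga; rewrite !inE.
apply/subsetP=> C; rewrite !inE => /rcosetsP[x Gx ->]; rewrite /= rcosetE -rcosetM.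
by apply/rcosetsP; exists (x * coset N a); rewrite ?groupM ?mem_quotient.
Qed.

Lemma mark_infl G (N : {group gT}) A (y : burnside (G / N)%G) : N <| G -> A \subset G ->
  mark A (infl y) = mark (A / N) y.
Proof.
move=> nsNG sAG; have nNG := normal_norm nsNG; rewrite /infl mark_lift markE.
apply: eq_bigr => c _; congr (_ * _)%R.
pose to := ('Rs \o coset_morphism N)%act; have sGD := infl_dom nsNG.
have toE (C : {set coset_of N}) a : to C a = C :* coset N a by rewrite /= rcosetE.
have actG := acts_infl (trans_repr c) nsNG.
rewrite (@mark_gset _ _ [group of coset_morphism N @*^-1 [set: coset_of N]%G]) //.
congr (Posz _); apply: eq_card => C; rewrite !in_setI; apply: andb_id2l => SC.
apply/afixP/afixP => fixA.
  move=> _ /morphimP[a Na Aa ->]; rewrite /= rcosetE -toE; exact: fixA.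
by move=> a Aa; rewrite toE -rcosetE; apply: fixA; apply: mem_morphim => //; apply: (subsetP nNG); apply: (subsetP sAG).
Qed.

Lemma mark1 G (T : {group gT}) : T \subset G -> mark T (coset_class G G) = 1%R.
Proof.
move=> sTG; rewrite mark_coset //; congr Posz; apply/eqP.
rewrite -(eqn_pmul2l (cardG_gt0 G)) card_nfix // muln1; apply/eqP/eq_card => g.
by rewrite inE andb_idr // => Gg; rewrite conjGid.
Qed.

Lemma nfix_proper G K : K \proper G -> nfix G G K = 0%N.
Proof.
move=> prKG; apply: nfix0 => // [|g Gg]; first exact: proper_sub.
by rewrite -{1}(conjGid Gg) conjSg; case/andP: prKG.
Qed.

(** G/G is the only transitive set with a point fixed by G, so the mark at G reads off a single
    coefficient. *)
Lemma trans_type_top G : exists c0 : trans_type G,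
  [/\ trans_repr c0 = G, forall c, c != c0 -> trans_repr c \proper G &
      forall y : burnside G, mark G y = y c0].
Proof.
have [c0 def0] := trans_type_of (subxx G); have [_ defr0] := trans_reprP c0.
have reprG : trans_repr c0 = G.
  have : trans_repr c0 \in orbit 'JG%act G G by rewrite -def0 defr0 orbit_refl.
  by case/imsetP=> g Gg ->; apply: val_inj; rewrite /= conjGid.
have properc c : c != c0 -> trans_repr c \proper G.
  move=> neqc; rewrite properE trans_repr_sub /=; apply: contra neqc => sGc.
  have [_ defc] := trans_reprP c; rewrite -val_eqE /= [val c]defc [val c0]defr0 reprG.
  by apply/eqP; congr (orbit _ _ _); apply/val_inj/eqP; rewrite eqEsubset trans_repr_sub.
exists c0; split=> // y; rewrite markE (bigD1 c0) //= big1 ?addr0 => [|c neqc].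
  by rewrite reprG -(mark_coset _ (subxx G)) mark1 // mulr1.
by rewrite nfix_proper ?mulr0 ?properc.
Qed.

Lemma trans_repr_proper G (y : burnside G) c :
  mark G y = 0%R -> y c != 0%R -> trans_repr c \proper G.
Proof.
have [c0 [_ properc ->]] := trans_type_top G.
by move=> y0; have [->|/properc //] := eqVneq c c0; rewrite y0 eqxx.
Qed.

End MarksMore.

(** * Additive functionals on representations *)

Local Close Scope group_scope.

Section AdditiveFunctionals.
Import boolp classical_sets ring_quotient generic_quotient freeg.
Local Open Scope quotient_scope.
Variables (F : fieldType) (gT : finGroupType) (G : {group gT}).
Implicit Types U W : representation F G.

(** These are the maps that descend to [rep_group]; the class map [rep_class] is itself one of them.
    Equality in the quotient is handled through them. *)
Definition additive_functional (R : zmodType) (T : representation F G -> R) : Prop :=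
  (forall U W, mx_rsim U W -> T U = T W) /\
  (forall U W, T (dadd_grepr U W) = T U + T W).

Definition copies W k := iter k (dadd_grepr W) (@grepr0 F gT G).

Lemma functional0 (R : zmodType) (T : representation F G -> R) :
  additive_functional T -> T (@grepr0 F gT G) = 0.
Proof.
case=> Tsim Tadd; apply: (addrI (T (@grepr0 F gT G))); rewrite addr0 -Tadd.
apply: Tsim; exists 0 => //; first by rewrite /row_free mxrank0.
by move=> x Gx; apply/matrixP=> -[].
Qed.

Lemma functional_copies (R : zmodType) (T : representation F G -> R) W k :
  additive_functional T -> T (copies W k) = T W *+ k.
Proof.
move=> Tf; elim: k => [|k IHk]; first by rewrite functional0.
by case: (Tf) => _ Tadd; rewrite /copies iterS Tadd -/(copies W k) IHk mulrS.
Qed.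

Lemma functional_sum (R : zmodType) (T : representation F G -> R) (I : Type) (s : seq I) (f : I -> representation F G) :
  additive_functional T -> T (\big[@dadd_grepr F gT G/@grepr0 F gT G]_(i <- s) f i) = \sum_(i <- s) T (f i).
Proof.
move=> Tf; have [_ Tadd] := Tf; elim: s => [|i s IHs]; first by rewrite !big_nil functional0.
by rewrite !big_cons Tadd IHs.
Qed.

Lemma zspan_ind (V : zmodType) (A : set V) (P : set V) z :
    P 0 -> (forall x y, P x -> P y -> P (x - y)) -> (forall x, A x -> P x) ->
  z \in zspan A -> P z.
Proof.
move=> P0 PB AP /asboolP h; apply: h; split=> //; split=> [|x y /set_mem Px /set_mem Py].
  exact/mem_set.
by apply/mem_set/PB.
Qed.

Lemma mem_zspan (V : zmodType) (A : set V) z : A z -> z \in zspan A.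
Proof. by move=> Az; apply/asboolP=> S [_ AS]; apply: AS. Qed.


Lemma rep_class_functional : additive_functional (@rep_class F gT G).
Proof.
split=> U W.
  move=> simUW; apply/eqP; rewrite -Quotient.idealrBE.
  by apply: mem_zspan; left; exists U, W.
rewrite /rep_class -raddfD; apply/eqP; rewrite -Quotient.idealrBE.
by apply: mem_zspan; right; exists U, W.
Qed.

Definition perm_rep (c : trans_type G) : representation F G :=
  permutation_module F (actsRs_rcosets (trans_repr c) G).

Lemma functional_relation (T : representation F G -> int) (x : burnside G) :
  additive_functional T -> burnside_to_rep F x = 0 -> \sum_c x c * T (perm_rep c) = 0.
Proof.
case=> Tsim Tadd x0.
pose T' (D : {freeg (modules F G) / int}) : int := fglift (T : modules F G -> int^o) D.
have T'B a b : T' (a - b) = T' a - T' b by apply: (lift_is_additive (T : modules F G -> int^o)).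
have T'0 : T' 0 = 0 by rewrite -(subrr 0) T'B subrr.
have T'N b : T' (- b) = - T' b by rewrite -[- b]sub0r T'B T'0 sub0r.
have T'D a b : T' (a + b) = T' a + T' b by rewrite -{1}[b]opprK T'B T'N opprK.
have T'U (W : representation F G) : T' << (W : modules F G) >> = T W by rewrite /T' liftU; apply: mul1r.
have T'span z : z \in zspan (@rep_relations F gT G) -> T' z = 0.
  apply: (@zspan_ind _ _ (fun z => T' z = 0)) => // [a b Ta Tb|a].
    by rewrite T'B Ta Tb subrr.
  case=> [[U [W [simUW ->]]] | [U [W ->]]].
    by rewrite T'B !T'U (Tsim _ _ simUW) subrr.
  by rewrite T'B T'D !T'U Tadd subrr.
pose y : {freeg (modules F G) / int} := \sum_c << (perm_rep c : modules F G) >> *~ x c.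
have y0 : y \in zspan (@rep_relations F gT G).
  rewrite -[y]subr0 Quotient.idealrBE raddf0 raddf_sum; apply/eqP; rewrite -[RHS]x0.
  by apply: eq_bigr => c _; rewrite raddfMz.
transitivity (T' y); last exact: T'span.
have T'sum (I : Type) (s : seq I) (f : I -> {freeg (modules F G) / int}) :
    T' (\sum_(i <- s) f i) = \sum_(i <- s) T' (f i).
  by elim: s => [|i s IHs]; rewrite ?big_nil // !big_cons T'D IHs.
have T'n a k : T' (a *+ k) = T' a *+ k.
  by elim: k => [|k IHk]; rewrite ?mulr0n // !mulrS T'D IHk.
have T'z a (k : int) : T' (a *~ k) = T' a *~ k.
  case: k => k; first exact: T'n.
  by rewrite NegzE !mulrNz -[X in T' X]sub0r T'B T'0 sub0r -!pmulrn T'n.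
rewrite /y T'sum; apply: eq_bigr => c _; rewrite T'z T'U.
by rewrite mulrzz mulrC.
Qed.

(** x is represented by the pair [pos_part x], [pos_part (- x)], so that statements about x become
    comparisons of two modules. Negative coefficients count as 0 in one and reappear with the
    opposite sign in the other. *)
Definition pos_part (x : burnside G) : representation F G :=
  \big[@dadd_grepr F gT G/@grepr0 F gT G]_(c <- index_enum (trans_type G))
     copies (perm_rep c) (if 0 <= x c then `|x c|%N else 0%N).

Lemma functional_pos (R : zmodType) (T : representation F G -> R) x : additive_functional T ->
  T (pos_part x) - T (pos_part (- x)) = \sum_c T (perm_rep c) *~ x c.
Proof.
move=> Tf; rewrite !functional_sum // -sumrB; apply: eq_bigr => c _.
rewrite !functional_copies // ffunE oppr_ge0 abszN.
case: (x c) => n; last by rewrite /= sub0r NegzE mulrNz.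
rewrite [0 <= _]isT /= lez_nat leqn0; case: eqP => [-> | _]; rewrite ?mulr0n subr0 //.
Qed.

End AdditiveFunctionals.

Section SplitSums.
Variables (F : fieldType) (gT : finGroupType) (G : {group gT}).
Implicit Types U V W L : representation F G.

(** V is the direct sum of U and W up to isomorphism. With W zero this covers isomorphisms, so a
    single rank computation gives both halves of [additive_functional]. *)
Definition equiv_split U V W :=
  exists P1, exists Q1, exists P2, exists Q2,
    [/\ @split_exact F (rdegree U) (rdegree V) (rdegree W) P1 Q1 P2 Q2,
        equivariant P1, equivariant Q1, equivariant P2 & equivariant Q2].

Lemma equiv_split_dadd U W : equiv_split U (dadd_grepr U W) W.
Proof.
exists (row_mx 1%:M 0), (col_mx 1%:M 0), (col_mx 0 1%:M), (row_mx 0 1%:M).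
split=> [|x Gx|x Gx|x Gx|x Gx].
- split; rewrite ?mul_row_col ?mul_col_row ?mulmx1 ?mulmx0 ?mul0mx ?addr0 ?add0r //.
  by rewrite add_block_mx !addr0 !add0r -scalar_mx_block.
- by rewrite /= mul_row_block mul_mx_row !mulmx1 !mul1mx !mulmx0 !mul0mx !addr0.
- by rewrite /= mul_block_col mul_col_mx !mulmx1 !mul1mx !mulmx0 !mul0mx !addr0.
- by rewrite /= mul_block_col mul_col_mx !mulmx1 !mul1mx !mulmx0 !mul0mx !add0r.
by rewrite /= mul_row_block mul_mx_row !mulmx1 !mul1mx !mulmx0 !mul0mx !add0r.
Qed.

Lemma equiv_split_rsim U V : mx_rsim U V -> equiv_split U V (@grepr0 F gT G).
Proof.
case=> f eqd freef eqf.
have fullf : row_full f by rewrite /row_full (eqP freef) eqd.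
have fK : pinvmx f *m f = 1%:M by apply: mulVpmx.
have Kf : f *m pinvmx f = 1%:M by apply: mulmxVp.
exists f, (pinvmx f), 0, 0; split=> [||x Gx|x Gx|x Gx] //.
- split=> //; rewrite ?mulmx0 ?addr0 //; by apply/matrixP=> -[].
- by rewrite -[LHS]mul1mx -fK -[in LHS]mulmxA [f *m _]mulmxA -eqf // -!mulmxA Kf mulmx1.
- by rewrite mulmx0 mul0mx.
by rewrite mulmx0 mul0mx.
Qed.

Lemma equiv_split_hom L U V W : equiv_split U V W ->
  equiv_split (hom_repr W L) (hom_repr V L) (hom_repr U L).
Proof.
move=> [P1 [Q1 [P2 [Q2 [[e1 e2 e3 e4] eq1 eq2 eq3 eq4]]]]].
pose lin m n (A : 'M[F]_(m, n)) := lin_mx (mulmx A : 'M_(n, rdegree L) -> _).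
have eqv (A B : representation F G) (P : 'M_(rdegree A, rdegree B)) :
    equivariant P -> @equivariant _ _ _ (hom_repr B L) (hom_repr A L) (lin _ _ P).
  move=> eqP x Gx; apply/row_matrixP=> i; rewrite !rowE !mulmxA.
  rewrite -(@vec_mxK _ (rdegree B) (rdegree L) (delta_mx 0 i)).
  have linE X : mxvec X *m lin _ _ P = mxvec (P *m X) by rewrite mul_vec_lin.
  rewrite linE [mxvec _ *m hom_repr B L x]mxvec_hom.
  rewrite [LHS]linE [RHS]mxvec_hom.
  by rewrite !mulmxA eqP // groupV.
exists (lin _ _ P2), (lin _ _ Q2), (lin _ _ P1), (lin _ _ Q1).
split; [split | exact: eqv ..].
- by rewrite /lin lin_mulmx_comp e2 lin_mulmx1.
- by rewrite /lin lin_mulmx_comp e1 lin_mulmx1.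
- by rewrite /lin lin_mulmx_comp e3 lin_mulmx0.
by rewrite /lin !lin_mulmx_comp lin_mulmx_add addrC e4 lin_mulmx1.
Qed.

Lemma rfix_equivariant U V (f : 'M_(rdegree U, rdegree V)) (H : {group gT}) m (u : 'M_(m, _)) :
  H \subset G -> equivariant f -> (u <= rfix_mx U H)%MS -> (u *m f <= rfix_mx V H)%MS.
Proof.
move=> sHG eqf /rfix_mxP fixu; apply/rfix_mxP=> h Hh.
by rewrite -mulmxA -eqf ?(subsetP sHG) // mulmxA fixu.
Qed.

Lemma rank_rfix_split U V W (H : {group gT}) : H \subset G -> equiv_split U V W ->
  \rank (rfix_mx V H) = (\rank (rfix_mx U H) + \rank (rfix_mx W H))%N.
Proof.
move=> sHG [P1 [Q1 [P2 [Q2 [[e1 e2 e3 e4] eq1 eq2 eq3 eq4]]]]].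
rewrite -(mxrank_mul_ker (rfix_mx V H) P2) addnC.
have freeP1 : row_free P1 by apply/row_freeP; exists Q1.
rewrite -(mxrankMfree (rfix_mx U H) freeP1); congr (_ + _)%N; apply/eqP; rewrite eqn_leq.
  apply/andP; split; apply: mxrankS.
    apply/rV_subP=> v; rewrite sub_capmx => /andP[fixv /sub_kermxP vP2].
    have -> : v = v *m Q1 *m P1.
      by rewrite -[LHS]mulmx1 -e4 mulmxDr !mulmxA vP2 mul0mx addr0.
    by rewrite submxMr // rfix_equivariant.
  rewrite sub_capmx rfix_equivariant ?submx_refl //=.
  by apply/sub_kermxP; rewrite -mulmxA e3 mulmx0.
apply/andP; split; apply: mxrankS; first by rewrite rfix_equivariant.
rewrite -[rfix_mx W H]mulmx1 -e2 mulmxA submxMr //.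
by rewrite rfix_equivariant.
Qed.

Lemma hom_rank_functional L :
  additive_functional (fun U : representation F G => (\rank (rfix_mx (hom_repr U L) G))%:Z).
Proof.
split=> U W => [simUW | ].
  rewrite (rank_rfix_split (subxx G) (equiv_split_hom L (equiv_split_rsim simUW))).
  suff -> : \rank (rfix_mx (hom_repr (@grepr0 F gT G) L) G) = 0%N by [].
  by apply/eqP; rewrite -leqn0; apply: leq_trans (rank_leq_row _) _.
by rewrite (rank_rfix_split (subxx G) (equiv_split_hom L (equiv_split_dadd U W))) addnC PoszD.
Qed.

Section Reciprocity.
Variables (L : representation F G) (H : {group gT}).
Hypothesis sHG : H \subset G.

Definition coset_hom (u : 'rV[F]_(rdegree L)) : 'M[F]_(#|rcosets H G|, rdegree L) :=
  \matrix_i (u *m L (repr (enum_val i))).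

Lemma coset_hom_is_linear : linear coset_hom.
Proof. by move=> a u v; apply/row_matrixP=> i; rewrite linearP /= !rowK mulmxDl scalemxAl. Qed.

HB.instance Definition _ := GRing.isLinear.Build F _ _ _ coset_hom coset_hom_is_linear.

(* Frobenius reciprocity: a homomorphism from [F[G/H]] is determined by the image of the coset H. *)
Lemma rank_hom_perm :
  \rank (rfix_mx (hom_repr (permutation_module F (actsRs_rcosets H G)) L) G) = \rank (rfix_mx L H).
Proof.
set M := permutation_module F _.
have rH : gval H \in rcosets H G by rewrite rcosets_orbit orbit_refl.
pose idx (C : {set gT}) : 'I_#|rcosets H G| := enum_rank_in rH C.
have idxK C : C \in rcosets H G -> enum_val (idx C) = C by move=> rC; rewrite enum_rankK_in.
have cosetM x y : x \in G -> y \in G -> ('Rs%act (H :* x) y = H :* (x * y))%g.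
  by move=> _ _; rewrite /= rcosetE rcosetM.
have rcM C x : C \in rcosets H G -> x \in G -> 'Rs%act C x \in rcosets H G.
  case/rcosetsP=> y Gy -> Gx; rewrite cosetM //.
  by apply/rcosetsP; exists (y * x)%g; rewrite ?groupM.
have rowM (Y : 'M_(#|rcosets H G|, rdegree L)) i x : x \in G ->
    row i (M x *m Y) = row (idx ('Rs%act (enum_val i) x)) Y.
  move=> Gx; rewrite row_mul; have rC := rcM _ x (enum_valP i) Gx.
  have -> : row i (M x) = delta_mx 0 (idx ('Rs%act (enum_val i) x)).
    apply/rowP=> j; rewrite !mxE eqxx /=; congr (_%:R); congr nat_of_bool.
    by rewrite -(inj_eq enum_val_inj) idxK // eq_sym.
  by rewrite -rowE.
pose B := lin1_mx (mxvec \o coset_hom).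
have BE u : u *m B = mxvec (coset_hom u) by rewrite mul_rV_lin1.
have freeB : row_free B.
  rewrite -kermx_eq0; apply/eqP/row_matrixP=> i; rewrite row0.
  set u := row i _; have : u *m B = 0 by rewrite -row_mul mulmx_ker row0.
  rewrite BE => /eqP; rewrite mxvec_eq0 => /eqP/(congr1 (row (idx H))).
  have Gr : repr (enum_val (idx H)) \in G.
    rewrite idxK // -[gval H]mulg1; have [h Hh ->] := mem_repr_rcosetP H 1%g.
    by rewrite mulg1 (subsetP sHG).
  by rewrite rowK row0 => /(congr1 (mulmx^~ (L (repr (enum_val (idx H)))^-1%g))); rewrite repr_mxK // mul0mx.
rewrite -(mxrankMfree (rfix_mx L H) freeB); apply/eqP; rewrite eqn_leq.
apply/andP; split; apply: mxrankS; apply/rV_subP=> v.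
  rewrite -[v]vec_mxK; move: (vec_mx v) => Y /(hom_fixP _ (subxx G)) eqY.
  have rowY i x : x \in G -> row (idx ('Rs%act (enum_val i) x)) Y = row i Y *m L x.
    by move=> Gx; rewrite -rowM // eqY // row_mul.
  pose u := row (idx H) Y.
  have fixu : (u <= rfix_mx L H)%MS.
    apply/rfix_mxP=> h Hh; rewrite /u -rowY ?(subsetP sHG) //; congr (row (idx _) Y).
    by rewrite idxK //= rcosetE rcoset_id.
  have -> : Y = coset_hom u.
    apply/row_matrixP=> i; rewrite rowK.
    have [x Gx defC] := rcosetsP (enum_valP i).
    have [h Hh eqr] := mem_repr_rcosetP H x.
    have Gr : repr (enum_val i) \in G by rewrite defC eqr groupM // (subsetP sHG).
    rewrite -rowY //; congr (row _ Y); apply: enum_val_inj; rewrite idxK; last first.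
      by rewrite rcM // enum_valP.
    by rewrite idxK //= rcosetE defC rcoset_repr.
  by rewrite -BE submxMr.
case/submxP=> w ->; rewrite mulmxA BE; set u := w *m _.
have /rfix_mxP fixu : (u <= rfix_mx L H)%MS by apply: submxMl.
apply/hom_fixP => // x Gx; apply/row_matrixP=> i; rewrite rowM // row_mul !rowK.
have rC := enum_valP i; rewrite idxK ?rcM //.
have [y Gy ->] := rcosetsP rC; rewrite cosetM //.
have fixu' : (u <= rfix_mx L H)%MS by apply/rfix_mxP.
rewrite !(rfix_repr sHG fixu') ?groupM //.
by rewrite repr_mxM // mulmxA.
Qed.

End Reciprocity.
End SplitSums.

(** Frobenius reciprocity identifies dim L^H with dim Hom_G(F_p[G/H], L). Equality in [rep_group] is
    thereby replaced by homogeneous linear equations in the integer coefficients of x. *)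
Lemma is_relationP (p : nat) (gT : finGroupType) (G : {group gT}) (x : burnside G) :
  x \in is_relation p (G:=G) <->
  forall L : representation 'F_p G, \sum_c x c * (\rank (rfix_mx L (trans_repr c)))%:Z = 0.
Proof.
split=> [/eqP x0 L | fix0].
  rewrite -[RHS](functional_relation (hom_rank_functional L) x0).
  by apply: eq_bigr => c _; rewrite rank_hom_perm ?trans_repr_sub.
have simMN : mx_rsim (pos_part 'F_p x) (pos_part 'F_p (- x)).
  apply: mx_rsim_of_hom_rank => L; apply/eqP; rewrite -eqz_nat -subr_eq0; apply/eqP.
  rewrite (functional_pos x (hom_rank_functional L)) -[RHS](fix0 L).
  by apply: eq_bigr => c _; rewrite rank_hom_perm ?trans_repr_sub // mulrzz mulrC.
have [repsim _] := rep_class_functional 'F_p G.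
rewrite unfold_in /burnside_to_rep; apply/eqP.
transitivity (rep_class (pos_part 'F_p x) - rep_class (pos_part 'F_p (- x))).
  by rewrite (functional_pos x (rep_class_functional 'F_p G)).
by rewrite (repsim _ _ simMN) subrr.
Qed.

Lemma is_relation_saturated (p : nat) (gT : finGroupType) (G : {group gT}) (x : burnside G) (n : int) :
  n != 0 -> x *~ n \in is_relation p (G:=G) -> x \in is_relation p (G:=G).
Proof.
move=> nz /is_relationP nx; apply/is_relationP=> L; apply: (mulfI nz); rewrite mulr0 -[RHS](nx L).
rewrite mulr_sumr; apply: eq_bigr => c _.
by rewrite burnside_mulzE mulrA mulrzz [n * _]mulrC.
Qed.

(** * Permutation modules *)

Section PermutationModules.
Variables (F : fieldType) (gT : finGroupType) (G D : {group gT}).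
Variables (T : finType) (to : action D T).
Implicit Types S U : {set T}.

(** The partial identity between F[S] and F[U]: an inclusion when S is contained in U, a projection
    when U is contained in S. *)
Definition incl_mx S U : 'M[F]_(#|S|, #|U|) :=
  \matrix_(i, j) (enum_val i == enum_val j)%:R.

Lemma sum_enum_val (U : {set T}) (f : T -> F) (x : T) :
  \sum_(k < #|U|) (x == enum_val k)%:R * f (enum_val k) = (x \in U)%:R * f x.
Proof.
have [Ux|nUx] := boolP (x \in U); last first.
  rewrite mul0r big1 // => k _; case: eqP => [eqx|]; rewrite ?mul0r //.
  by case/negP: nUx; rewrite eqx enum_valP.
rewrite (bigD1 (enum_rank_in Ux x)) //= enum_rankK_in // eqxx mul1r big1 ?addr0 ?mul1r //.
move=> k neqk; case: eqP => [eqx|]; rewrite ?mul0r //.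
by case/eqP: neqk; apply: enum_val_inj; rewrite enum_rankK_in.
Qed.

Lemma incl_mx_mul S U S' :
  incl_mx S U *m incl_mx U S' =
  \matrix_(i, j) ((enum_val i \in U) && (enum_val i == enum_val j))%:R.
Proof.
apply/matrixP=> i j; rewrite !mxE.
under eq_bigr do rewrite !mxE.
by rewrite (sum_enum_val U (fun y => (y == enum_val j)%:R)) -natrM mulnb.
Qed.

Lemma incl_equivariant S U (actS : [acts G, on S | to]) (actU : [acts G, on U | to]) :
  @equivariant _ _ _ (permutation_module F actS) (permutation_module F actU) (incl_mx S U).
Proof.
move=> x Gx; apply/matrixP=> i j; rewrite !mxE.
have actSx : to (enum_val i) x \in S by rewrite (acts_act actS) ?enum_valP.
under eq_bigr do rewrite !mxE [_ == enum_val _]eq_sym.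
under [RHS]eq_bigr do rewrite !mxE.
rewrite (sum_enum_val U (fun y => (to y x == enum_val j)%:R)) -natrM mulnb.
under eq_bigr do rewrite eq_sym.
rewrite (sum_enum_val S (fun y => (y == enum_val j)%:R)) actSx mul1r.
congr (nat_of_bool _)%:R; case: eqP => [eqj|]; rewrite ?andbF // andbT.
by have := enum_valP j; rewrite -eqj (acts_act actU) // => ->.
Qed.

Lemma perm_split S S1 S2 (actS : [acts G, on S | to]) (act1 : [acts G, on S1 | to])
    (act2 : [acts G, on S2 | to]) : S = S1 :|: S2 -> [disjoint S1 & S2] ->
  equiv_split (permutation_module F act1) (permutation_module F actS) (permutation_module F act2).
Proof.
move=> defS dis; have sS1 : S1 \subset S by rewrite defS subsetUl.
have sS2 : S2 \subset S by rewrite defS subsetUr.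
exists (incl_mx S1 S), (incl_mx S S1), (incl_mx S S2), (incl_mx S2 S).
split; try exact: incl_equivariant.
split; rewrite ?incl_mx_mul; apply/matrixP=> i j; rewrite !mxE.
- by rewrite (subsetP sS1) ?enum_valP //= (inj_eq enum_val_inj).
- by rewrite (subsetP sS2) ?enum_valP //= (inj_eq enum_val_inj).
- case: eqP => [eqi|]; rewrite ?andbF //.
  by have := disjointFr dis (enum_valP i); rewrite eqi enum_valP.
have : enum_val i \in S1 :|: S2 by rewrite -defS enum_valP.
rewrite inE (inj_eq enum_val_inj) => /orP[S1i|S2i].
  by rewrite S1i (disjointFr dis S1i) addr0.
by rewrite S2i (disjointFl dis S2i) add0r.
Qed.

End PermutationModules.

Lemma perm_rsim (F : fieldType) (gT : finGroupType) (G D1 D2 : {group gT})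
   (T1 T2 : finType) (to1 : action D1 T1) (to2 : action D2 T2) (S1 : {set T1}) (S2 : {set T2})
   (act1 : [acts G, on S1 | to1]) (act2 : [acts G, on S2 | to2]) :
  gset_isom G to1 S1 to2 S2 ->
  mx_rsim (permutation_module F act1) (permutation_module F act2).
Proof.
case/existsP=> f /and3P[/dinjectiveP injf /eqP imf /forall_inP eqf].
have fS2 i : f (enum_val (i : 'I_#|S1|)) \in S2 by rewrite -imf imset_f ?enum_valP.
pose B : 'M[F]_(#|S1|, #|S2|) := \matrix_(i, j) (f (enum_val i) == enum_val j)%:R.
exists B => /=.
- by rewrite -imf card_in_imset.
- apply/row_freeP; exists B^T; apply/matrixP=> i j; rewrite !mxE.
  under eq_bigr do rewrite !mxE.
  rewrite (sum_enum_val S2 (fun y => (f (enum_val j) == y)%:R)) fS2 mul1r.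
  congr (nat_of_bool _)%:R; rewrite eq_sym (inj_in_eq injf) ?enum_valP //.
  exact: (inj_eq enum_val_inj).
move=> x Gx; apply/matrixP=> i j; rewrite !mxE.
under eq_bigr do rewrite !mxE.
under [RHS]eq_bigr do rewrite !mxE.
rewrite (sum_enum_val S1 (fun y => (f y == enum_val j)%:R)) (acts_act act1) // enum_valP mul1r.
rewrite (sum_enum_val S2 (fun y => (to2 y x == enum_val j)%:R)) fS2 mul1r.
by rewrite (eqP (forall_inP (eqf _ (enum_valP i)) x Gx)).
Qed.

Section GsetFunctional.
Variables (F : fieldType) (gT : finGroupType) (G D : {group gT}).
Variables (X : finType) (to : action D X).
Hypothesis sGD : G \subset D.

Lemma gset_class_orbit x (c : trans_type G) : val c = orbit 'JG%act G 'C_G[x | to]%G ->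
  gset_class G to (orbit to G x) = [ffun c' => (c' == c)%:R].
Proof.
move=> defc; rewrite /gset_class.
have -> : orbit to G @: orbit to G x = [set orbit to G x].
  apply/setP=> O; rewrite inE; apply/imsetP/eqP=> [[y /imsetP[g Gg ->] ->] | ->].
    apply/orbit_in_eqP => //; exact: mem_orbit.
  by exists x; rewrite ?orbit_refl.
rewrite big_set1; apply/ffunP=> c'; rewrite !ffunE trans_class_orbit // -defc.
by rewrite (inj_eq val_inj).
Qed.

Lemma gset_classU (S1 S2 : {set X}) : [acts G, on S1 | to] -> [acts G, on S2 | to] ->
  [disjoint S1 & S2] ->
  gset_class G to (S1 :|: S2) = gset_class G to S1 + gset_class G to S2.
Proof.
move=> act1 act2 dis; apply: mark_eq => A sAG.
have actU : [acts G, on S1 :|: S2 | to].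
  apply/subsetP=> g Gg; have Dg := subsetP sGD g Gg.
  rewrite !inE Dg /=; apply/subsetP=> y; rewrite !inE.
  by rewrite (astabs_act _ (subsetP act1 g Gg)) (astabs_act _ (subsetP act2 g Gg)).
rewrite raddfD /= !mark_gset //.
rewrite setIUl -PoszD cardsU; congr (Posz _).
rewrite (_ : _ :&: _ :&: _ = set0) ?cards0 ?subn0 //.
apply/setP=> y; rewrite !inE; apply/negP=> /andP[/andP[S1y _] /andP[S2y _]].
by have := disjointFr dis S1y; rewrite S2y.
Qed.

(** Orbits are peeled off one at a time. Restriction and inflation call for this generality: they
    produce permutation modules on sets that need not be transitive or consist of cosets in the
    acting group. *)
Lemma functional_gset (R : zmodType) (T : representation F G -> R) (S : {set X})
    (actS : [acts G, on S | to]) : additive_functional T ->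
  T (permutation_module F actS) = \sum_c T (perm_rep F c) *~ gset_class G to S c.
Proof.
move=> Tf; have [Tsim Tadd] := Tf.
have Tsplit U V W : equiv_split U V W -> T V = T U + T W.
  move=> [P1 [Q1 [P2 [Q2 [spl eq1 eq2 eq3 eq4]]]]]; rewrite -Tadd.
  have [e1 e2 e3 e4] := spl.
  apply: Tsim; exists (row_mx Q1 P2) => [||x Gx].
  - by rewrite /= (split_exact_dim spl).
  - by apply/row_freeP; exists (col_mx P1 Q2); rewrite mul_row_col.
  by rewrite /= mul_row_block mul_mx_row eq2 // eq3 // !mulmx0 addr0 add0r.
have [m] := ubnP #|S|; elim: m S actS => // m IHm S actS ltS.
have [S0|[x Sx]] := set_0Vmem S.
  have -> : T (permutation_module F actS) = 0.
    rewrite -(functional0 Tf); apply: Tsim; exists 0 => /=.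
    - by rewrite S0 cards0.
    - by rewrite /row_free mxrank0 S0 cards0.
    by move=> y Gy; rewrite mulmx0 mul0mx.
  rewrite big1 // => c _; rewrite S0 /gset_class imset0 big_set0 ffunE.
  exact: mulr0z.
pose O := orbit to G x; pose S' := S :\: O.
have sOS : O \subset S by rewrite acts_sub_orbit.
have actO : [acts G, on O | to] by apply: acts_orbit.
have actS' : [acts G, on S' | to].
  apply/subsetP=> g Gg; have := subsetP actS g Gg; have := subsetP actO g Gg.
  have Dg := subsetP sGD g Gg.
  move=> aO aS; rewrite !inE Dg /=; apply/subsetP=> y; rewrite !inE.
  by rewrite (astabs_act _ aO) (astabs_act _ aS).
have defS : S = O :|: S' by rewrite -{1}(setID S O) (setIidPr sOS).
have dis : [disjoint O & S'].
  by rewrite -setI_eq0 /S' setDE setICA setICr setI0.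
rewrite (Tsplit _ _ _ (perm_split F actS actO actS' defS dis)).
have -> : gset_class G to S = gset_class G to O + gset_class G to S'.
  by rewrite {1}defS gset_classU.
rewrite (IHm _ actS'); last first.
  rewrite ltnS in ltS; apply: leq_trans ltS; rewrite proper_card // properE subsetDl /=.
  by apply/subsetPn; exists x => //; rewrite !inE orbit_refl.
under [RHS]eq_bigr do rewrite ffunE mulrzDr.
rewrite big_split /=; congr (_ + _).
have [c defc] := trans_type_of (subsetIl G _ : 'C_G[x | to]%G \subset G).
rewrite (gset_class_orbit defc) (bigD1 c) //= ffunE eqxx mulr1z big1 => [|c' neqc].
  rewrite addr0; apply/esym/Tsim/perm_rsim.
  have [sr defr] := trans_reprP c.
  have : trans_repr c \in trans_class G to O.
    by rewrite trans_class_orbit // -defc defr orbit_refl.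
  by rewrite inE => /andP[].
by rewrite ffunE (negPf neqc) mulr0z.
Qed.

End GsetFunctional.

(** An orbit with stabilizer U has |H : U| points, so the factor |H| can be spread over them,
    leaving |U| at each point. *)
Lemma gset_weight (gT : finGroupType) (H D : {group gT}) (X : finType) (to : action D X)
    (S : {set X}) (phi : {set gT} -> nat) :
    H \subset D -> [acts H, on S | to] ->
    (forall (U : {group gT}) h, U \subset H -> h \in H -> phi (U :^ h)%g = phi U) ->
  (#|H|%:Z * \sum_(c : trans_type H) (phi (trans_repr c))%:Z * gset_class H to S c
   = \sum_(y in S) (#|'C_H[y | to]%g| * phi 'C_H[y | to]%g)%:Z).
Proof.
move=> sHD actS phiJ.
have classE c : gset_class H to S c =
    \sum_(O in orbit to H @: S) (val c == trans_class H to O)%:R.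
  by rewrite /gset_class sum_ffunE; apply: eq_bigr => O _; rewrite ffunE.
rewrite (set_partition_big _ (orbit_partition actS)) /=.
have -> : \sum_(c : trans_type H) (phi (trans_repr c))%:Z * gset_class H to S c =
   \sum_(c : trans_type H) \sum_(O in orbit to H @: S)
      (phi (trans_repr c))%:Z * (val c == trans_class H to O)%:R.
  by apply: eq_bigr => c _; rewrite classE mulr_sumr.
rewrite exchange_big mulr_sumr /=; apply: eq_bigr => _ /imsetP[x Sx ->].
have sCH : 'C_H[x | to]%G \subset H by apply: subsetIl.
have [c defc] := trans_type_of sCH; have [sr defr] := trans_reprP c.
rewrite (bigD1 c) //= big1 ?addr0 => [|c' neqc]; last first.
  by rewrite trans_class_orbit // -defc (inj_eq val_inj) (negPf neqc) mulr0.
rewrite trans_class_orbit // defc eqxx mulr1.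
have -> : phi (trans_repr c) = phi 'C_H[x | to]%g.
  have : trans_repr c \in orbit 'JG%act H 'C_H[x | to]%G by rewrite -defc defr orbit_refl.
  by case/imsetP=> h Hh -> /=; rewrite (phiJ 'C_H[x | to]%G).
rewrite (eq_bigr (fun=> (#|'C_H[x | to]%g| * phi 'C_H[x | to]%g)%:Z)) => [|_ /imsetP[h Hh ->]].
  by rewrite sumr_const -(card_orbit_in_stab to x sHD) -mulr_natl natz -!PoszM mulnA.
by rewrite (stab_act to sHD) // cardJg (phiJ 'C_H[x | to]%G).
Qed.

(** Mackey's formula for F[G/K] restricted to H, with each double coset spread over its elements g
    so that no quotient of orders appears. *)
Lemma rank_hom_coset (F : fieldType) (gT : finGroupType) (G H K : {group gT}) (L : representation F G) :
    H \subset G -> K \subset G ->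
  (#|H| * (#|K| * \rank (rfix_mx (hom_repr (permutation_module F (actsRs_rcosets K G)) L) H)))%N
  = (\sum_(g in G) #|K :&: (H :^ g)%g| * \rank (rfix_mx L (K :&: (H :^ g)%g)))%N.
Proof.
move=> sHG sKG; set M := permutation_module F _.
pose LH := Representation (subg_repr L sHG).
have actH : [acts H, on rcosets K G | 'Rs%act] by apply: actsRs.
pose MH := permutation_module F actH.
(* A fixed space of H sees only the matrices of elements of H, so the two sides agree by
   conversion. *)
have rankE : \rank (rfix_mx (hom_repr M L) H) = \rank (rfix_mx (hom_repr MH LH) H).
  by [].
have sum_class := functional_gset (subDomRs H) actH (hom_rank_functional LH).
apply/eqP; rewrite -eqz_nat rankE !PoszM mulrCA; apply/eqP.
rewrite [X in _ * (_ * X)]sum_class.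
pose phi (U : {set gT}) := \rank (rfix_mx L U).
have phiJ (U : {group gT}) h : U \subset G -> h \in G -> phi (U :^ h)%g = phi U.
  move=> sUG Gh; rewrite /phi rfix_mx_conjsg // mxrankMfree // row_free_unit.
  exact: repr_mx_unit.
have sHT : H \subset [set: gT]%G by apply: subsetT.
have -> : \sum_(c : trans_type H)
      (\rank (rfix_mx (hom_repr (perm_rep F c) LH) H))%:Z *~ gset_class H 'Rs%act (rcosets K G) c =
    \sum_(c : trans_type H) (phi (trans_repr c))%:Z * gset_class H 'Rs%act (rcosets K G) c.
  by apply: eq_bigr => c _; rewrite (rank_hom_perm LH (trans_repr_sub c)) mulrzz.
rewrite (@gset_weight _ _ _ _ _ _ phi sHT actH); last first.
  by move=> U h sUH Hh; apply: phiJ; [apply: subset_trans sUH sHG | apply: (subsetP sHG)].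
rewrite -[RHS]natz natr_sum.
rewrite [RHS](reindex_inj invg_inj) /= [RHS](eq_bigl [in G]) => [|g]; last by rewrite /= groupV.
rewrite [RHS](partition_big (fun g => K :* g)%g [in rcosets K G]) /=; last first.
  by move=> g Gg; apply/rcosetsP; exists g.
rewrite mulr_sumr; apply: eq_bigr => _ /rcosetsP[y Gy ->].
rewrite (eq_bigr (fun=> (#|'C_H[(K :* y)%g | 'Rs]%g| * phi 'C_H[(K :* y)%g | 'Rs]%g)%:Z)) => [|g /andP[Gg /eqP <-]].
  rewrite sumr_const -mulr_natl natz; congr (_%:Z * _).
  rewrite -(card_rcoset K y); apply: eq_card => g; rewrite [RHS]unfold_in /=.
  apply/idP/andP=> [Kg | [Gg /eqP <-]]; last exact: rcoset_refl.
  have /rcosetP[k Kk defg] := Kg.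
  split; first by rewrite defg groupM // (subsetP sKG).
  by apply/eqP/rcoset_eqP.
rewrite natz; congr Posz.
have -> : 'C_H[(K :* g)%g | 'Rs]%g = ((K :&: H :^ g^-1) :^ g)%g.
  rewrite conjIg conjsgKV setIC; congr (_ :&: _).
  apply/setP=> a; apply/astab1P/idP => /=; rewrite rcosetE -rcosetM.
    move=> eqK; have : (g * a)%g \in (K :* g)%g by rewrite -eqK rcoset_refl.
    by rewrite mem_rcoset mem_conjg conjgE invgK mulgA.
  by rewrite mem_conjg conjgE invgK => Ka; apply/rcoset_eqP; rewrite mem_rcoset -mulgA.
by rewrite cardJg (phiJ (K :&: H :^ g^-1)%G) // subIset // sKG.
Qed.

(** * Integral characteristic polynomials of permutation modules *)

Section IntegralCharPoly.
Variables (gT : finGroupType) (G : {group gT}).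

Definition int_row (F : fieldType) (b : gT -> int) : 'rV[F]_#|G| :=
  \row_i (b (enum_val i))%:~R.

(** Both characteristic polynomials are images of one integral polynomial; this carries information
    from [algC], where characters decide, to ['F_p]. *)
Definition same_int_char_poly (F K : fieldType) (U : representation F G) (V : representation K G) :=
  forall b : gT -> int, exists2 P : {poly int},
    char_poly (gring_mx U (int_row F b)) = map_poly intr P &
    char_poly (gring_mx V (int_row K b)) = map_poly intr P.

Lemma same_int_dadd F K U1 U2 V1 V2 : @same_int_char_poly F K U1 V1 -> @same_int_char_poly F K U2 V2 ->
  same_int_char_poly (dadd_grepr U1 U2) (dadd_grepr V1 V2).
Proof.
move=> h1 h2 b; have [P1 e1 e2] := h1 b; have [P2 e3 e4] := h2 b.
exists (P1 * P2); rewrite (exseq_char_poly _ (exseq_dadd _ _)) rmorphM /=.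
  by rewrite e1 e3.
by rewrite e2 e4.
Qed.

Lemma same_int_grepr0 F K : same_int_char_poly (@grepr0 F gT G) (@grepr0 K gT G).
Proof. by move=> b; exists 1; rewrite /char_poly det_mx00 rmorph1. Qed.

Lemma same_int_perm F K c : same_int_char_poly (@perm_rep F gT G c) (@perm_rep K gT G c).
Proof.
move=> b; set S := rcosets (trans_repr c) G.
pose A : 'M[int]_#|S| := \sum_(g < #|G|) b (enum_val g) *:
   \matrix_(i, j) ('Rs%act (enum_val i) (enum_val g) == enum_val j :> {set gT})%:R.
have AE (R : fieldType) : char_poly (gring_mx (@perm_rep R gT G c) (int_row R b)) = map_poly intr (char_poly A).
  rewrite map_char_poly; congr char_poly.
  rewrite /gring_mx /= mulmx_sum_row linear_sum /= /A (raddf_sum (map_mx intr)).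
  apply: eq_bigr => g _; rewrite linearZ /= rowK mxvecK !mxE.
  by apply/matrixP=> i j; rewrite !mxE rmorphM rmorph_nat.
by exists (char_poly A).
Qed.

Lemma same_int_pos_part F K x : same_int_char_poly (@pos_part F gT G x) (@pos_part K gT G x).
Proof.
rewrite /pos_part; elim: (index_enum _) => [|c s IHs]; rewrite ?big_nil ?big_cons.
  exact: same_int_grepr0.
apply: same_int_dadd => //; elim: (if _ then _ else _) => [|k IHk]; first exact: same_int_grepr0.
by apply: same_int_dadd => //; apply: same_int_perm.
Qed.

End IntegralCharPoly.

Section CyclicMarks.
Variables (gT : finGroupType) (G : {group gT}).

Lemma cfRepr_functional : additive_functional (fun U : representation algC G => cfRepr U).
Proof. by split=> [U W /cfRepr_sim | U W]; last exact: cfRepr_dadd. Qed.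

Lemma cfRepr_perm c g : g \in G ->
  cfRepr (perm_rep algC c) g = (nfix G <[g]>%g (trans_repr (G:=G) c))%:R.
Proof.
move=> Gg; rewrite cfunE Gg mulr1n /mxtrace /nfix.
set S := rcosets (trans_repr c) G.
rewrite -[RHS]/(#|_|%:R) -sum1_card natr_sum.
rewrite (eq_bigl (fun C => (C \in S) && ('Rs%act C g == C))) => [|C]; last first.
  rewrite inE; congr (_ && _); apply/idP/eqP => [/afixP/(_ g (cycle_id g)) // | eqC].
  by rewrite -sub_astab1 cycle_subG; apply/astab1P.
rewrite big_mkcondr /= [RHS]big_enum_val /=; apply: eq_bigr => i _.
by rewrite !mxE; case: eqP.
Qed.

(* Reduce modulo p the integral characteristic polynomials, which agree because the characters do. *)
Lemma char_poly_pos_part (p : nat) (z : burnside G) :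
    (forall g, g \in G -> mark <[g]>%g z = 0) ->
  forall a, char_poly (gring_mx (pos_part 'F_p z) a) = char_poly (gring_mx (pos_part 'F_p (- z)) a).
Proof.
(* [b] lifts the coordinates of a from F_p to the integers. *)
move=> m0 a; pose b g : int := (a 0 (gring_index G g) : nat)%:Z.
have -> : a = int_row G 'F_p b.
  apply/rowP=> i; rewrite mxE /b gring_valK -[in RHS]pmulrn.
  by rewrite natr_Zp.
have simC : mx_rsim (pos_part algC z) (pos_part algC (- z)).
  apply/cfRepr_rsimP; rewrite -subr_eq0 (functional_pos z cfRepr_functional); apply/eqP.
  apply/cfun_inP=> g Gg; rewrite cfunE sum_cfunE.
  rewrite (eq_bigr (fun c => (nfix G <[g]>%g (trans_repr c))%:R *~ z c)) => [|c _]; last first.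
    rewrite -cfRepr_perm //; case: (z c) => n; first by rewrite -!pmulrn muln_cfunE.
    by rewrite NegzE !mulrNz -!pmulrn cfunE muln_cfunE.
  have := congr1 (fun n : int => n%:~R : algC) (m0 g Gg); rewrite /= markE rmorph_sum /= => sum0; apply: etrans sum0.
  by apply: eq_bigr => c _; rewrite rmorphM /= mulrC mulrzr.
have [P1 e1 c1] := same_int_pos_part 'F_p algC z b.
have [P2 e2 c2] := same_int_pos_part 'F_p algC (- z) b.
rewrite e1 e2; congr (map_poly _ _).
have [Q1 [Q2 [Q3 [Q4 [spl eq1 _ eq3 _]]]]] := equiv_split_rsim simC.
have := char_poly_split spl (gring_mx_equivariant (int_row G algC b) eq1) (gring_mx_equivariant (int_row G algC b) eq3).
rewrite c1 c2 {1}/char_poly det_mx00 mulr1.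
(* The integers embed in [algC], so the two integral polynomials coincide. *)
by move/(map_inj_poly (@intr_inj _) (rmorph0 _)).
Qed.

End CyclicMarks.

(** * Elements whose marks vanish at all proper subgroups *)

Section PrimitiveIdempotent.
Variables (p : nat) (gT : finGroupType) (G : {group gT}).
Hypothesis p_prime : prime p.

(** For D = D_z(Hom(-, L)), the value at F_p[z] is the sum of the z_c D(F_p[G/H_c]). Mackey's
    formula writes D(F_p[G/H_c]) through intersections with H_c, so it vanishes for proper H_c,
    below which all marks of z are 0. The remaining term is z_G D_z(L), and z_G is the nonzero mark
    at G. *)
Lemma idempotent_relation (z : burnside G) :
    (forall T : {group gT}, T \proper G -> mark T z = 0) ->
    ~~ cyclic G -> 'O_p(G)%g = 1%g ->
  z \in is_relation p (G:=G).
Proof.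
move=> m0 ncG Op1; apply/is_relationP=> L.
have [mG0|mGn0] := eqVneq (mark G z) 0.
  have -> : z = 0.
    apply: mark_inj => T sTG; have [->|neqT] := eqVneq (T : {set gT}) G; first by [].
    by apply: m0; rewrite properEneq neqT.
  by apply: big1 => c _; rewrite ffunE mul0r.
have pF : p \in [pchar 'F_p] by apply: pchar_Fp.
have sub_repr (c : trans_type G) : trans_repr c \subset G := trans_repr_sub c.
pose z' (c : trans_type G) : rat := (z c)%:~R.
have weight0 (P : {group gT}) (w : {set gT} -> rat) :
    P \subset G -> (p.-group P)%g -> (P :!=: 1)%g ->
    \sum_c z' c / #|trans_repr c|%:R * \sum_(g in G) w ('N_G(P) :&: trans_repr c :^ g)%g = 0.
  move=> sPG pP ntP; apply: (@mark_weight0 _ G 'N_G(P)%G) => [|T sTN]; first exact: subsetIl.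
  apply: m0; apply: sub_proper_trans sTN _; rewrite properE subsetIl /=.
  (* Otherwise P would be a normal p-subgroup of G and lie in O_p(G) = 1. *)
  apply: contra ntP => sGN; rewrite -subG1 -Op1.
  apply: pcore_max => //; rewrite /normal sPG.
  by apply: subset_trans sGN (subsetIr _ _).
pose D (M : representation 'F_p G) := fixed_rank z' (@trans_repr gT G) (hom_repr M L).
have Dex U V W : exseq U V W -> D V = D U + D W.
  move=> ex; rewrite addrC.
  exact: (fixed_rank_exact pF sub_repr weight0 (hom_exseq L ex)).
have cycproper g : g \in G -> <[g]>%g \proper G.
  move=> Gg; rewrite properE cycle_subG Gg /=; apply: contra ncG => sG.
  by apply: cyclicS sG (cycle_cyclic g).
have eqD : D (pos_part 'F_p z) = D (pos_part 'F_p (- z)).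
  by apply: exact_additive_char_poly Dex _; apply: char_poly_pos_part => g Gg; apply: m0 (cycproper g Gg).
have D0 : D (@grepr0 'F_p gT G) = 0.
  have : exseq (@grepr0 'F_p gT G) (@grepr0 'F_p gT G) (@grepr0 'F_p gT G).
    exists 0, 0, 0, 0; split; first split; try by apply/matrixP=> -[].
      by move=> x Gx; rewrite mulmx0 mul0mx.
    by move=> x Gx; rewrite mulmx0 mul0mx.
  by move/Dex=> e; apply: (addrI (D (@grepr0 'F_p gT G))); rewrite addr0 -e.
have Dfun : additive_functional D.
  split=> U W; last by apply: Dex; apply: exseq_dadd.
  move=> simUW; have [Q1 [Q2 [Q3 [Q4 [spl eq1 _ eq3 _]]]]] := equiv_split_rsim simUW.
  have ex : exseq U W (@grepr0 'F_p gT G) by exists Q1, Q2, Q3, Q4.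
  by rewrite (Dex _ _ _ ex) D0 addr0.
have Dperm (c : trans_type G) : D (perm_rep 'F_p c) =
    (#|trans_repr c|%:R)^-1 * \sum_i z' i / #|trans_repr i|%:R *
     \sum_(g in G) (#|trans_repr c :&: (trans_repr i :^ g)%g| *
        \rank (rfix_mx L (trans_repr c :&: (trans_repr i :^ g)%g)))%:R.
  rewrite mulr_sumr; apply: eq_bigr => i _.
  have Hi0 : (#|trans_repr i|%:R != 0 :> rat) by rewrite pnatr_eq0 -lt0n cardG_gt0.
  have Hc0 : (#|trans_repr c|%:R != 0 :> rat) by rewrite pnatr_eq0 -lt0n cardG_gt0.
  rewrite -natr_sum -(rank_hom_coset L (sub_repr i) (sub_repr c)) !natrM.
  rewrite mulrCA -mulrA; congr (_ * _); rewrite [RHS]mulrCA mulKf //.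
  by rewrite [RHS]mulKf.
have := functional_pos z Dfun; rewrite eqD subrr => sumD.
have [cG [reprG properc markG]] := trans_type_top G.
move: sumD; rewrite (bigD1 cG) //= big1 ?addr0 => [|c neqc]; last first.
  rewrite Dperm (@mark_weight0 _ G (trans_repr c) z (fun T => (#|T| * \rank (rfix_mx L T))%:R)) //.
    by rewrite mulr0 mul0rz.
  by move=> T sT; apply: m0; apply: sub_proper_trans sT (properc c neqc).
move/esym/eqP; rewrite -mulrzr mulf_eq0 intr_eq0 -markG (negPf mGn0) orbF Dperm reprG.
have G0 : (#|G|%:R != 0 :> rat) by rewrite pnatr_eq0 -lt0n cardG_gt0.
rewrite mulf_eq0 invr_eq0 (negPf G0) /= => /eqP sum0.
apply: (@intr_inj rat); rewrite rmorph_sum rmorph0; apply: (mulfI G0); rewrite mulr0 -[RHS]sum0.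
rewrite mulr_sumr; apply: eq_bigr => c _.
rewrite (eq_bigr (fun=> (#|trans_repr c| * \rank (rfix_mx L (trans_repr c)))%:R)) => [|g Gg].
  have Hc0 : (#|trans_repr c|%:R != 0 :> rat) by rewrite pnatr_eq0 -lt0n cardG_gt0.
  rewrite sumr_const natrM rmorphM /= -[_%:Z%:~R]/(_%:R) -[RHS]mulrA.
  by rewrite -mulrnAr mulKf // mulrCA mulr_natl.
have sub_g : (trans_repr c :^ g)%g \subset G by rewrite -(conjGid Gg) conjSg.
rewrite (setIidPr sub_g) cardJg rfix_mx_conjsg // mxrankMfree // row_free_unit.
exact: repr_mx_unit.
Qed.

End PrimitiveIdempotent.

(** * Marks of relations at hypo-elementary subgroups *)

Section FixedPairing.
Variables (F : fieldType) (gT : finGroupType) (G : {group gT}).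
Implicit Types U V W : representation F G.

Definition dual_mx U (x : gT) : 'M[F]_(rdegree U) := (U x^-1%g)^T.

Lemma dual_mx_repr U : mx_repr G (dual_mx U).
Proof.
split=> [|x y Gx Gy]; rewrite /dual_mx; first by rewrite invg1 repr_mx1 trmx1.
by rewrite invMg repr_mxM ?groupV // trmx_mul.
Qed.

Definition dual_repr U : representation F G :=
  Representation (MxRepresentation (dual_mx_repr U)).

(** The pairing of the invariants of U with those of its dual; its rank is the multiplicity of the
    trivial module as a direct summand of U. *)
Definition fix_pairing U := rfix_mx U G *m (rfix_mx (dual_repr U) G)^T.

Lemma rfix_split U V W P1 Q1 P2 Q2 : @split_exact F (rdegree U) (rdegree V) (rdegree W) P1 Q1 P2 Q2 ->
    equivariant P1 -> equivariant Q1 -> equivariant P2 -> equivariant Q2 ->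
  (rfix_mx V G :=: col_mx (rfix_mx U G *m P1) (rfix_mx W G *m Q2))%MS.
Proof.
move=> [e1 e2 e3 e4] eq1 eq2 eq3 eq4; apply/eqmxP/andP; split; last first.
  rewrite col_mx_sub; apply/andP; split.
    exact: (rfix_equivariant (subxx G) eq1).
  exact: (rfix_equivariant (subxx G) eq4).
rewrite -addsmxE -[X in (X <= _)%MS]mulmx1 -e4 mulmxDr !mulmxA.
apply: addmx_sub_adds; apply: submxMr.
  exact: (rfix_equivariant (subxx G) eq2).
exact: (rfix_equivariant (subxx G) eq3).
Qed.

Lemma mxrank_mul_tr_eqmx m1 m2 m3 m4 n (A : 'M[F]_(m1, n)) (A' : 'M_(m2, n))
    (B : 'M_(m3, n)) (B' : 'M_(m4, n)) : (A :=: A')%MS -> (B :=: B')%MS ->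
  \rank (A *m B^T) = \rank (A' *m B'^T).
Proof.
move=> eqA eqB; rewrite (eqmxMr _ eqA) -mxrank_tr trmx_mul trmxK (eqmxMr _ eqB).
by rewrite -mxrank_tr trmx_mul trmxK.
Qed.

Lemma rank_pairing_split n1 n2 n3 (P1 : 'M[F]_(n1, n2)) Q1 (P2 : 'M_(n2, n3)) Q2
    m1 m2 m3 m4 (A : 'M_(m1, n1)) (A' : 'M_(m2, n1)) (B : 'M_(m3, n3)) (B' : 'M_(m4, n3)) :
  split_exact P1 Q1 P2 Q2 ->
  \rank (col_mx (A *m P1) (B *m Q2) *m (col_mx (A' *m Q1^T) (B' *m P2^T))^T) =
    (\rank (A *m A'^T) + \rank (B *m B'^T))%N.
Proof.
move=> spl; have [e1 e2 e3 _] := spl; have e5 := split_exact_mul0 spl.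
have cancel2 m n q l k (X : 'M[F]_(m, n)) (Y : 'M_(n, q)) (Z : 'M_(q, l)) (D : 'M_(l, k)) :
    X *m Y *m (Z *m D) = X *m (Y *m Z) *m D by rewrite !mulmxA.
rewrite tr_col_mx !trmx_mul !trmxK mul_col_row !cancel2 e1 e2 e3 e5 !mulmx1 !mulmx0 !mul0mx.
exact: rank_diag_block_mx.
Qed.

Lemma fix_pairing_split U V W : equiv_split U V W ->
  \rank (fix_pairing V) = (\rank (fix_pairing U) + \rank (fix_pairing W))%N.
Proof.
move=> [P1 [Q1 [P2 [Q2 [spl eq1 eq2 eq3 eq4]]]]]; have [e1 e2 e3 e4] := spl.
have e5 := split_exact_mul0 spl.
have eqT A B (f : 'M_(rdegree A, rdegree B)) :
    equivariant f -> @equivariant _ _ _ (dual_repr B) (dual_repr A) f^T.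
  by move=> eqf x Gx; rewrite /= /dual_mx -!trmx_mul eqf // groupV.
have spl' : @split_exact F (rdegree (dual_repr U)) (rdegree (dual_repr V)) (rdegree (dual_repr W)) Q1^T P1^T Q2^T P2^T.
  split; rewrite -?trmx_mul ?e1 ?e2 ?e5 ?trmx1 ?trmx0 //.
  by rewrite -raddfD e4 /= trmx1.
have eqV := rfix_split spl eq1 eq2 eq3 eq4.
have eqV' := rfix_split spl' (eqT _ _ _ eq2) (eqT _ _ _ eq1) (eqT _ _ _ eq4) (eqT _ _ _ eq3).
rewrite [LHS](mxrank_mul_tr_eqmx eqV eqV'); exact: (rank_pairing_split _ _ _ _ spl).
Qed.

Lemma fix_pairing_functional : additive_functional (fun U => (\rank (fix_pairing U))%:Z).
Proof.
split=> U W => [simUW | ].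
  rewrite (fix_pairing_split (equiv_split_rsim simUW)).
  suff -> : \rank (fix_pairing (@grepr0 F gT G)) = 0%N by rewrite addn0.
  by apply/eqP; rewrite -leqn0; apply: leq_trans (rank_leq_row _) _.
by rewrite (fix_pairing_split (equiv_split_dadd U W)) PoszD.
Qed.

(** Both spaces of invariants are spanned by the all-one vector, and its pairing with itself is |G :
    H|. *)
Lemma fix_pairing_coset (H : {group gT}) : H \subset G ->
  \rank (fix_pairing (permutation_module F (actsRs_rcosets H G))) = (#|G : H|%g%:R != 0 :> F).
Proof.
move=> sHG; set M := permutation_module F _.
have rH : gval H \in rcosets H G by rewrite rcosets_orbit orbit_refl.
have rcM C x : C \in rcosets H G -> x \in G -> 'Rs%act C x \in rcosets H G.
  case/rcosetsP=> y Gy -> Gx; rewrite /= rcosetE -rcosetM.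
  by apply/rcosetsP; exists (y * x)%g; rewrite ?groupM.
have dualM x : dual_repr M x = M x.
  apply/matrixP=> i j; rewrite !mxE; congr (nat_of_bool _)%:R.
  by rewrite (canF_eq (actKV _ x)) eq_sym.
have fixM m (u : 'M_(m, _)) x j k : u *m M x = u -> x \in G ->
    enum_val k = 'Rs%act (enum_val j) x -> forall i, u i k = u i j.
  move=> ux Gx defk i; rewrite -{1}ux mxE (bigD1 j) //= mxE defk eqxx mulr1 big1 ?addr0 //.
  move=> j' neqj; rewrite mxE defk (inj_eq (act_inj _ x)) (inj_eq enum_val_inj).
  by rewrite (negPf neqj) mulr0.
pose one : 'rV[F]_#|rcosets H G| := const_mx 1.
have fix_one x : x \in G -> one *m M x = one.
  move=> Gx; apply/rowP=> j; rewrite !mxE.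
  have rj : 'Rs%act (enum_val j) x^-1%g \in rcosets H G by rewrite rcM ?groupV ?enum_valP.
  rewrite (bigD1 (enum_rank_in rH ('Rs%act (enum_val j) x^-1%g))) //= !mxE enum_rankK_in //.
  rewrite actKV eqxx mulr1 big1 ?addr0 // => i neqi; rewrite !mxE mul1r.
  case: eqP => // eqj; case/eqP: neqi; apply: enum_val_inj.
  by rewrite enum_rankK_in // -eqj actK.
have eqone (r : mx_representation F G #|rcosets H G|) :
    (forall x, r x = M x) -> (rfix_mx r G :=: one)%MS.
  move=> eqVM.
  apply/eqmxP/andP; split; last first.
    by apply/rfix_mxP=> x Gx; rewrite eqVM fix_one.
  apply/rV_subP=> u /rfix_mxP fixu; apply/sub_rVP; exists (u 0 (enum_rank_in rH (gval H))).
  apply/rowP=> j; rewrite !mxE mulr1.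
  have [x Gx defj] := rcosetsP (enum_valP j).
  apply: (fixM _ _ x) => //; first by rewrite -eqVM fixu.
  by rewrite enum_rankK_in // defj /= rcosetE.
have eq1 := eqone M (fun=> erefl).
have eq2 := eqone (dual_repr M) dualM.
rewrite /fix_pairing [LHS](mxrank_mul_tr_eqmx eq1 eq2).
have -> : one *m one^T = (#|G : H|%g%:R)%:M.
  apply/matrixP=> i j; rewrite !ord1 !mxE mulr1n.
  under eq_bigr do rewrite !mxE mulr1.
  by rewrite sumr_const card_ord.
by rewrite -scalemx1; case: eqP => [->|/eqP n0]; rewrite ?scale0r ?mxrank0 // mxrank_scale_nz ?mxrank1.
Qed.

End FixedPairing.

(** For an H-module L, dim Hom_H(U, L) is an additive functional of the G-module U; on a permutation
    module it is computed from the class of the restricted set. *)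
Lemma res_relation (p : nat) (gT : finGroupType) (G H : {group gT}) (x : burnside G) :
  H \subset G -> x \in is_relation p (G:=G) -> res H x \in is_relation p (G:=H).
Proof.
move=> sHG /eqP x0; apply/is_relationP=> L.
pose rH (U : representation 'F_p G) : representation 'F_p H :=
  Representation (subg_repr U sHG).
have Tf := hom_rank_functional L.
have rTf : additive_functional (fun U => (\rank (rfix_mx (hom_repr (rH U) L) H))%:Z).
  case: Tf => Tsim Tadd; split=> U W; last by rewrite -Tadd.
  case=> f eqd freef eqf; apply: Tsim; exists f => // y Hy.
  by apply: eqf; apply: (subsetP sHG).
rewrite -[RHS](functional_relation rTf x0).
rewrite burnside_lift_weight; apply: eq_bigr => d _; congr (_ * _).
have actH : [acts H, on rcosets (trans_repr d) G | 'Rs%act] by apply: actsRs.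
have -> : \rank (rfix_mx (hom_repr (rH (perm_rep 'F_p d)) L) H) =
   \rank (rfix_mx (hom_repr (permutation_module 'F_p actH) L) H) by [].
rewrite [RHS](functional_gset (subDomRs H) actH Tf).
by apply: eq_bigr => c _; rewrite rank_hom_perm ?trans_repr_sub.
Qed.

Section HypoElementary.
Variables (p : nat) (gT : finGroupType).
Hypothesis p_prime : prime p.
Implicit Types G H K N : {group gT}.

Lemma hypo_elementaryP G : hypo_elementary p G = cyclic (G / 'O_p(G)).
Proof.
apply/existsP/idP=> [[P /and3P[nsPG pP cycGP]] | cycG]; last first.
  by exists 'O_p(G)%G; rewrite pcore_normal pcore_pgroup.
have sPO : P \subset 'O_p(G)%g by apply: pcore_max.
rewrite -(isog_cyclic (third_isog sPO nsPG (pcore_normal _ _))).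
exact: quotient_cyclic.
Qed.

(** The cyclic group G / O_p(G) has trivial p-core, hence order prime to p. *)
Lemma hypo_pcore_Hall G : hypo_elementary p G -> (p.-Sylow(G) 'O_p(G))%g.
Proof.
rewrite hypo_elementaryP => cycG; rewrite /pHall pcore_sub pcore_pgroup /=.
have := nilpotent_pcore_Hall p (abelian_nil (cyclic_abelian cycG)).
rewrite trivg_pcore_quotient /pHall => /and3P[_ _].
by rewrite indexg1 card_quotient // gFnorm.
Qed.

(* For P = O_p(G), the marks at the groups P <g> average to the number of orbits of length prime to p,
   which the rank of the fixed pairing detects. *)
Lemma mark_hypo_relation G (x : burnside G) : hypo_elementary p G ->
    (forall H, H \proper G -> hypo_elementary p H -> mark H x = 0) ->
  x \in is_relation p (G:=G) -> mark G x = 0.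
Proof.
move=> hypoG IH /eqP x0; set P := 'O_p(G)%g.
have nsPG : (P <| G)%g := pcore_normal p G; have sPG := normal_sub nsPG.
have sylP : (p.-Sylow(G) P)%g := hypo_pcore_Hall hypoG.
have pF : p \in [pchar 'F_p] by apply: pchar_Fp.
(* P is the Sylow p-subgroup of G, so the length of G/H is prime to p exactly when H contains P. *)
have indexE H : H \subset G -> (#|G : H|%g%:R != 0 :> 'F_p) = (P \subset H).
  move=> sHG; rewrite -(dvdn_pcharf pF); apply/idP/idP=> [np | sPH].
    have [Q sylQ] := Sylow_exists p H.
    have sQH := pHall_sub sylQ; apply: subset_trans sQH; apply: pcore_sub_Hall.
    rewrite pHallE (subset_trans (pHall_sub sylQ)) //= (card_Hall sylQ) -(Lagrange sHG) partnM //.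
    by rewrite (@part_p'nat p #|G : H|%g) ?muln1 // p'natE.
  apply/negP=> pH; case/and3P: sylP => _ _; rewrite p'natE // => /negP; apply.
  by apply: dvdn_trans pH (indexgS G sPH).
have sum0 : \sum_(c | P \subset trans_repr (G:=G) c) x c = 0.
  rewrite -[RHS](functional_relation (fix_pairing_functional _ _) x0) big_mkcond /=.
  apply: eq_bigr => c _; rewrite fix_pairing_coset ?trans_repr_sub // indexE ?trans_repr_sub //.
  by case: (_ \subset _); rewrite ?mulr1 ?mulr0.
pose E g := (P <*> <[g]>)%G.
have sEG g : g \in G -> E g \subset G by move=> Gg; rewrite join_subG sPG cycle_subG.
have nfixE H : H \subset G -> (\sum_(g in G) nfix G (E g) H = (P \subset H) * #|G|)%N.
  move=> sHG; have [sPH|nsPH] := boolP (P \subset H); last first.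
    apply: big1 => g Gg; apply: nfix0 => // [|y Gy]; first exact: sEG.
    apply: contra nsPH => /(subset_trans (joing_subl _ _)) sPHy.
    by rewrite -(conjSg _ _ y) (normsP (normal_norm nsPG)).
  have actG : [acts G, on rcosets H G | 'Rs%act] := actsRs_rcosets H G.
  (* When the normal subgroup P lies in H it acts trivially on G/H, so [E g] and g have the same
     fixed points; the count is the Cauchy-Frobenius formula for a single orbit. *)
  rewrite mul1n -[RHS]mul1n -[X in (X * _)%N](_ : #|orbit 'Rs%act G @: rcosets H G| = 1%N).
    rewrite -(Frobenius_Cauchy actG); apply: eq_bigr => g Gg.
    rewrite /nfix; apply: eq_card => C; rewrite !in_setI; apply: andb_id2l => /rcosetsP[y Gy ->].
    rewrite -!sub_astab1 join_subG cycle_subG sub1set andb_idl // => _.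
    apply/subsetP=> a Pa; apply/astab1P; rewrite /= rcosetE -rcosetM; apply/rcoset_eqP.
    have Ny : (y^-1)%g \in 'N(P)%g by rewrite groupV (subsetP (normal_norm nsPG)).
    rewrite mem_rcoset; have : (a ^ y^-1)%g \in H by rewrite (subsetP sPH) // memJ_norm.
    by rewrite conjgE invgK mulgA.
  rewrite rcosets_orbit; apply/eqP/cards1P; exists (orbit 'Rs%act G H).
  apply/setP=> O; rewrite inE; apply/imsetP/eqP=> [[C /imsetP[g Gg ->] ->] | ->].
    exact: (orbit_act 'Rs).
  by exists (gval H); rewrite ?orbit_refl.
have sumE : \sum_(g in G) mark (E g) x = 0.
  under eq_bigr do rewrite markE.
  rewrite exchange_big /= -[RHS](mul0r #|G|%:Z) -[in RHS]sum0 [in RHS]big_mkcond mulr_suml.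
  apply: eq_bigr => c _; rewrite -mulr_sumr.
  have := congr1 Posz (nfixE _ (trans_repr_sub c)); rewrite -[Posz (\sum_(i in G) _)]natz natr_sum.
  under eq_bigr do rewrite natz; move=> ->.
  by case: (_ \subset _); rewrite ?mul1n ?mulr0 ?mul0r.
have hypoE g : g \in G -> hypo_elementary p (E g).
  move=> Gg; apply/existsP; exists 'O_p(G)%G.
  have nPE : E g \subset 'N(P)%g by apply: subset_trans (sEG g Gg) (normal_norm nsPG).
  rewrite pcore_pgroup /normal joing_subl nPE /=.
  have Ng : g \in 'N(P)%g by apply: (subsetP nPE); rewrite mem_gen // inE cycle_id orbT.
  by rewrite /= quotientYidl ?cycle_subG // quotient_cycle // cycle_cyclic.
have markE0 g : g \in G -> mark (E g) x = (E g == G)%:R * mark G x.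
  move=> Gg; case: eqVneq => [->|neqE]; first by rewrite mul1r.
  by rewrite mul0r IH ?hypoE // properEneq sEG // andbT.
(* The mark at G occurs once for each g with P <g> = G; a g lifting a generator of G / P shows that
   this number is not 0. *)
move: sumE; rewrite (eq_bigr _ markE0) -mulr_suml => /eqP; rewrite mulf_eq0 => /orP[|/eqP //].
have /cyclicP[xb defx] : cyclic (G / P) by rewrite -hypo_elementaryP.
have : xb \in (G / P)%g by rewrite defx cycle_id.
case/morphimP=> g Ng Gg def_g.
have EgG : E g = G.
  apply/val_inj/eqP; rewrite eqEsubset sEG //=.
  rewrite -(quotientSGK (normal_norm nsPG)) ?joing_subl // defx /= quotientYidl ?cycle_subG //.
  by rewrite def_g mem_quotient ?cycle_id.
rewrite (bigD1 g) //= EgG eqxx -[1]/(1%:R) -natr_sum -natrD pnatr_eq0.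
by [].
Qed.

Lemma relation_mark_hypo G (x : burnside G) : x \in is_relation p (G:=G) ->
  forall H, H \subset G -> hypo_elementary p H -> mark H x = 0.
Proof.
move=> Kx H; have [m] := ubnP #|H|; elim: m H => // m IHm H ltH sHG hypoH.
rewrite -(mark_res x sHG (subxx H)); apply: mark_hypo_relation => // [K prKH hypoK|].
  rewrite mark_res ?(proper_sub prKH) //; apply: IHm hypoK.
    by rewrite ltnS in ltH; apply: leq_trans (proper_card prKH) ltH.
  exact: subset_trans (proper_sub prKH) sHG.
exact: res_relation.
Qed.

End HypoElementary.

(** * The relations are determined by their marks *)

Section BurnsideProduct.
Variables (gT : finGroupType) (G : {group gT}).
Implicit Types (H K T : {group gT}) (x y w : burnside G).

(* The product of the Burnside ring, by Frobenius reciprocity: [G/H] * w = Ind_H^G Res_H w. *)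
Definition burnside_mul y w : burnside G :=
  \sum_c ind G (res (trans_repr c) w) *~ y c.

Lemma mark_mul y w T : T \subset G -> mark T (burnside_mul y w) = mark T y * mark T w.
Proof.
move=> sTG; rewrite raddf_sum markE mulr_suml; apply: eq_bigr => c _ /=.
by rewrite raddfMz mulrzz /= mark_ind_res ?trans_repr_sub // mulrC mulrA.
Qed.

(* Multiplication by [G/K] - |(G/K)^H| kills the mark at H. *)
Lemma mark_kill (s : seq ({group gT} * {group gT})) :
    (forall hk, hk \in s -> hk.2 \subset G) ->
  exists x : burnside G, forall T, T \subset G ->
    mark T x = \prod_(hk <- s) ((nfix G T hk.2)%:Z - (nfix G hk.1 hk.2)%:Z).
Proof.
elim: s => [|[H K] s IHs] sKG.
  by exists (coset_class G G) => T sTG; rewrite big_nil mark1.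
have [|x markx] := IHs; first by move=> hk shk; apply: sKG; rewrite inE shk orbT.
have {}sKG : K \subset G by apply: (sKG (H, K)); rewrite mem_head.
exists (burnside_mul (coset_class G K - coset_class G G *+ nfix G H K) x) => T sTG.
by rewrite mark_mul // raddfB raddfMn /= mark1 // mark_coset // big_cons markx //= natz.
Qed.

(** A multiple of the primitive idempotent at G of the rational Burnside ring. The factor for a
    proper H is [G/H] - |(G/H)^H|, whose mark at G is -|(G/H)^H|, which is not 0. *)
Lemma primitive_idempotent :
  exists2 z : burnside G, mark G z != 0 & forall T, T \proper G -> mark T z = 0.
Proof.
pose s := [seq (H, H) | H : {group gT} <- enum [pred H : {group gT} | H \proper G]].
have sP hk : hk \in s -> hk.2 \subset G.
  by case/mapP=> H; rewrite mem_enum inE => /proper_sub sHG ->.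
have [x markx] := mark_kill sP; exists x => [|T prTG]; last first.
  rewrite markx ?proper_sub // big_map (bigD1_seq T) ?enum_uniq ?mem_enum //=.
  by rewrite subrr mul0r.
rewrite markx // prodf_seq_neq0; apply/allP=> hk /mapP[H]; rewrite mem_enum inE => prHG -> /=.
by rewrite nfix_proper // sub0r oppr_eq0 -lt0n nfix_self ?proper_sub.
Qed.

Lemma sum_coset_class (U : {group gT}) (phi : {set gT} -> int) : U \subset G ->
    (forall (V : {group gT}) g, V \subset G -> g \in G -> phi (V :^ g)%g = phi V) ->
  \sum_c coset_class G U c * phi (trans_repr c) = phi U.
Proof.
move=> sUG phiJ; have [c defc] := trans_type_of sUG.
have [sr defr] := trans_reprP c.
rewrite (coset_classE sUG defc) (bigD1 c) //= ffunE eqxx mul1r big1 => [|c' neqc].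
  have : trans_repr c \in orbit 'JG%act G U by rewrite -defc defr orbit_refl.
  by case/imsetP=> g Gg ->; rewrite addr0 phiJ.
by rewrite ffunE (negPf neqc) mul0r.
Qed.

End BurnsideProduct.

Lemma ind_relation (p : nat) (gT : finGroupType) (G H : {group gT}) (y : burnside H) :
  H \subset G -> y \in is_relation p (G:=H) -> ind G y \in is_relation p (G:=G).
Proof.
move=> sHG /is_relationP y0; apply/is_relationP=> L.
rewrite -[RHS](y0 (Representation (subg_repr L sHG))).
rewrite burnside_lift_weight; apply: eq_bigr => d _; congr (_ * _).
have sdG : trans_repr d \subset G := subset_trans (trans_repr_sub d) sHG.
rewrite -(@sum_coset_class _ G (trans_repr d) (fun V => (\rank (rfix_mx L V))%:Z) sdG).
  by apply: eq_bigr => c _; rewrite mulrzz mulrC.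
move=> V g sVG Gg; congr Posz; rewrite rfix_mx_conjsg // mxrankMfree // row_free_unit.
exact: repr_mx_unit.
Qed.

Section Inflation.
Variables (F : fieldType) (gT : finGroupType) (G N : {group gT}).
Hypothesis nsNG : (N <| G)%g.

Lemma infl_mx_repr (U : representation F (G / N)%g) : mx_repr G (fun x => U (coset N x)).
Proof.
have nNG := subsetP (normal_norm nsNG).
split=> [|x y Gx Gy]; first by rewrite morph1 repr_mx1.
by rewrite morphM ?nNG // repr_mxM ?mem_quotient.
Qed.

Definition infl_repr U : representation F G :=
  Representation (MxRepresentation (infl_mx_repr U)).

End Inflation.

Lemma infl_relation (p : nat) (gT : finGroupType) (G N : {group gT}) (y : burnside (G / N)%G) :
  (N <| G)%g -> y \in is_relation p (G:=(G / N)%G) -> infl y \in is_relation p (G:=G).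
Proof.
move=> nsNG /eqP y0; apply/is_relationP=> L.
have Tf := hom_rank_functional L.
pose T (U : representation 'F_p (G / N)%g) := (\rank (rfix_mx (hom_repr (infl_repr nsNG U) L) G))%:Z.
have iTf : additive_functional T.
  case: Tf => Tsim Tadd; split=> U W; last by rewrite /T -Tadd.
  case=> f eqd freef eqf; apply: Tsim; exists f => // x Gx.
  by apply: eqf; rewrite mem_quotient.
rewrite -[RHS](functional_relation iTf y0).
rewrite burnside_lift_weight; apply: eq_bigr => d _; congr (_ * _).
have sGD := infl_dom nsNG; have actG := acts_infl (trans_repr d) nsNG.
have -> : T (perm_rep 'F_p d) = (\rank (rfix_mx (hom_repr (permutation_module 'F_p actG) L) G))%:Z by [].
rewrite [RHS](functional_gset sGD actG Tf).
by apply: eq_bigr => c _; rewrite rank_hom_perm ?trans_repr_sub.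
Qed.

Lemma hypo_elementaryS (p : nat) (gT : finGroupType) (G H : {group gT}) :
  H \subset G -> hypo_elementary p G -> hypo_elementary p H.
Proof.
move=> sHG /existsP[P /and3P[nsPG pP cycGP]]; apply/existsP; exists (P :&: H)%G.
rewrite /= setIC (normalGI sHG nsPG) (pgroupS (subsetIr H P)) // setIC //=.
rewrite (isog_cyclic (second_isog (subset_trans sHG (normal_norm nsPG)))).
exact: cyclicS (quotientS P sHG) cycGP.
Qed.

Lemma relation_of_marks (p : nat) (gT : finGroupType) (G : {group gT}) (x : burnside G) :
    prime p ->
    (forall H : {group gT}, H \subset G -> hypo_elementary p H -> mark H x = 0) ->
  x \in is_relation p (G:=G).
Proof.
move=> p_prime; have [m] := ubnP #|G|; elim: m gT G x => // m IHm gT G x ltG m0.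
rewrite ltnS in ltG.
have [hypoG|nhypoG] := boolP (hypo_elementary p G).
  suff -> : x = 0 by apply: rpred0.
  by apply: mark_inj => T sTG; apply: m0 => //; apply: hypo_elementaryS hypoG.
have [z nzz z0] := primitive_idempotent G.
have [zeta Kzeta nzzeta] : exists2 zeta, zeta \in is_relation p (G:=G) & mark G zeta != 0.
  set P := 'O_p(G)%G; have nsPG : (P <| G)%g := pcore_normal p G.
  have [P1|ntP] := eqVneq (P :> {set gT}) 1%g.
    exists z => //; apply: idempotent_relation => //.
    by apply: contra nhypoG => cycG; rewrite hypo_elementaryP quotient_cyclic.
  (* [zb] is a relation by induction: G / P is not p-hypo-elementary either, so the marks of [zb]
     vanish at all p-hypo-elementary subgroups. *)
  have [zb nzzb zb0] := primitive_idempotent (G / P)%G.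
  exists (infl zb); last by rewrite mark_infl.
  apply: infl_relation => //; apply: IHm => [|H sHG hypoH].
    apply: leq_trans ltG; rewrite ltn_quotient ?normal_sub //.
  apply: zb0; rewrite properE sHG /=; apply: contra nhypoG => sGH.
  have defH : H = (G / P)%G by apply/val_inj/eqP; rewrite eqEsubset sHG.
  move: hypoH; rewrite defH !hypo_elementaryP trivg_pcore_quotient.
  by rewrite -(isog_cyclic (quotient1_isog _)).
(* [w] is a multiple of x, corrected by [zeta] so that its mark at G vanishes. *)
pose w := x *~ mark G zeta - zeta *~ mark G x.
have Mw T : mark T w = mark T x * mark G zeta - mark T zeta * mark G x.
  by rewrite raddfB /= (raddfMz (mark T)) (raddfMz (mark T) (mark G x)) /= !mulrzz.
have wG0 : mark G w = 0 by rewrite Mw mulrC subrr.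
have w0 (H : {group gT}) : H \subset G -> hypo_elementary p H -> mark H w = 0.
  move=> sHG hypoH; rewrite Mw (m0 H) // (relation_mark_hypo p_prime Kzeta sHG) //.
  by rewrite !mul0r subrr.
(* A multiple of the complementary idempotent: on [w] it acts as the integer [mark G z], while its
   support consists of proper subgroups. So a multiple of [w] is a combination of induced
   restrictions of [w], which are relations by induction. *)
pose y := coset_class G G *~ mark G z - z.
have My (T : {group gT}) : T \subset G -> mark T y = mark G z - mark T z.
  by move=> sTG; rewrite raddfB /= raddfMz /= mark1 // intz.
have yG0 : mark G y = 0 by rewrite My // subrr.
have Kw : w \in is_relation p (G:=G).
  apply: (is_relation_saturated nzz).
  have -> : w *~ mark G z = burnside_mul y w.
    apply: mark_eq => T sTG; rewrite mark_mul // My // raddfMz mulrzz mulrC /=.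
    have [->|neqT] := eqVneq T G; first by rewrite wG0 !mulr0.
    by rewrite (z0 T) ?subr0 // properEneq sTG andbT.
  apply: rpred_sum => c _; have [->|nzc] := eqVneq (y c) 0; first by rewrite mulr0z rpred0.
  have prc := trans_repr_proper yG0 nzc.
  apply: rpredMz; apply: ind_relation; first exact: proper_sub.
  apply: IHm => [|H sH hypoH]; first exact: leq_trans (proper_card prc) ltG.
  rewrite (mark_res w (proper_sub prc) sH); apply: w0 => //.
  exact: subset_trans sH (proper_sub prc).
apply: (is_relation_saturated nzzeta).
by rewrite -(subrK (zeta *~ mark G x) (x *~ _)) rpredD // rpredMz.
Qed.

(** * Dress groups *)

Local Open Scope group_scope.

Section Residual.
Variables (q : nat) (gT : finGroupType).
Implicit Types G H K V T : {group gT}.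

(* The usual O^q(G): the smallest normal subgroup of q-power index. *)
Definition residual (G : {set gT}) := <<[set x in G | q^'.-elt x]>>.
Canonical residual_group G := [group of residual G].

Lemma residual_sub G : residual G \subset G.
Proof. by rewrite gen_subG; apply/subsetP=> x; rewrite inE => /andP[]. Qed.

Lemma mem_residual G x : x \in G -> q^'.-elt x -> x \in residual G.
Proof. by move=> Gx q'x; rewrite mem_gen // inE Gx. Qed.

Lemma residualS G H : G \subset H -> residual G \subset residual H.
Proof.
move=> sGH; rewrite gen_subG; apply/subsetP=> x; rewrite inE => /andP[Gx q'x].
exact: mem_residual (subsetP sGH x Gx) q'x.
Qed.

Lemma residualJ G g : residual (G :^ g) = residual G :^ g.
Proof.
rewrite /residual -genJ; congr <<_>>; apply/setP=> x.
by rewrite mem_conjg !inE mem_conjg p_eltJ.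
Qed.

Lemma residual_id G : residual (residual G) = residual G.
Proof.
apply/eqP; rewrite eqEsubset residual_sub gen_subG; apply/subsetP=> x.
by rewrite inE => /andP[Gx q'x]; rewrite !mem_residual.
Qed.

Lemma residual_normal G : residual G <| G.
Proof.
rewrite /normal residual_sub; apply/subsetP=> g Gg.
by rewrite inE -residualJ conjGid.
Qed.

Lemma residual_min G K : K <| G -> q.-group (G / K) -> residual G \subset K.
Proof.
move=> nsKG qGK; rewrite gen_subG; apply/subsetP=> x; rewrite inE => /andP[Gx q'x].
have Nx := subsetP (normal_norm nsKG) x Gx.
rewrite coset_idr // -[coset K x](@constt_p_elt _ q) ?(mem_p_elt qGK) ?mem_quotient //.
by apply: constt1P; apply: morph_p_elt.
Qed.

Hypothesis q_prime : prime q.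

Lemma residual_pgroup G : q.-group (G / residual G).
Proof.
have nRG := normal_norm (residual_normal G).
apply/pgroupP=> r r_prime /(Cauchy r_prime)[_ /morphimP[x Nx Gx ->] ox].
have: q.-elt (coset (residual G) x.`_q) by rewrite morph_p_elt ?p_elt_constt // groupX.
have -> : coset (residual G) x.`_q = coset (residual G) x.
  have eq1 : coset (residual G) (x.`_q^') = 1.
    by apply: coset_id; rewrite mem_residual ?groupX // p_elt_constt.
  by rewrite -[in RHS](consttC q x) morphM ?groupX //= eq1 mulg1.
by rewrite /p_elt ox pnatE.
Qed.

Lemma residual_max G : residual G \subset G /\ q.-nat #|G : residual G|.
Proof.
split; first exact: residual_sub.
by rewrite -card_quotient ?normal_norm ?residual_normal //; apply: residual_pgroup.
Qed.

Lemma residual_eq K V : V <| K -> residual V = V -> q.-group (K / V) -> residual K = V.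
Proof.
move=> nsVK defV qKV; apply/eqP; rewrite eqEsubset residual_min //.
by rewrite -{1}defV residualS ?normal_sub.
Qed.

(** A Sylow q-subgroup Q of H covers H / O^q(H). It acts on the points fixed by O^q(H), and its
    nontrivial orbits have length divisible by q. *)
Lemma nfix_residual G H K : H \subset G -> K \subset G ->
  nfix G H K = nfix G (residual H) K %[mod q].
Proof.
move=> sHG sKG; have [Q sylQ] := Sylow_exists q H.
have sQH := pHall_sub sylQ; have nRH := normal_norm (residual_normal H).
have defH : residual H * Q = H.
  apply/eqP; rewrite eqEsubset mul_subG ?residual_sub //= -quotientSK //.
  by rewrite (pHall_id (quotient_pHall (subset_trans sQH nRH) sylQ) (residual_pgroup H)).
have qQ := pHall_pgroup sylQ; have sQG := subset_trans sQH sHG.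
set S := 'Fix_(rcosets K G | 'Rs)(residual H).
have actQ : [acts Q, on S | 'Rs].
  apply: actsI; first exact: actsRs.
  have nRQ := subset_trans sQH nRH.
  exact: acts_fix_norm.
apply: etrans (esym (pgroup_fix_mod qQ actQ)); congr (_ %% q)%N; rewrite /nfix.
apply: (congr1 (fun A : {set {set gT}} => #|A|)).
rewrite -setIA; congr (_ :&: _); rewrite -{1}defH; apply/setP=> C; rewrite [RHS]in_setI.
apply/afixP/andP=> [fixC | [/afixP fixR /afixP fixQ] _ /mulsgP[a b Ra Qb ->]].
  split; apply/afixP=> a Aa; apply: fixC.
    by rewrite -[a]mulg1 mem_mulg.
  by rewrite -[a]mul1g mem_mulg ?group1.
by rewrite actM fixR ?fixQ.
Qed.

(* With V = O^q(H), take K / V a Sylow q-subgroup of N_G(V) / V: then (G/K)^V has |N_G(V) : K| points. *)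
Lemma nfix_residual_prime G H : H \subset G -> ~~ (residual G \subset H) ->
  exists2 K : {group gT}, K \proper G & ~~ (q %| nfix G H K)%N.
Proof.
move=> sHG nsRH; set V := residual_group H; set N := 'N_G(V)%G.
have sVG : V \subset G := subset_trans (residual_sub H) sHG.
have [Q sylQ] := Sylow_exists q N; have sQN := pHall_sub sylQ.
have sVN : V \subset N by rewrite subsetI sVG normG.
have nVQ : Q \subset 'N(V) := subset_trans sQN (subsetIr _ _).
set K := (V <*> Q)%G; have sKN : K \subset N by rewrite join_subG sVN.
have sKG : K \subset G := subset_trans sKN (subsetIl _ _).
have sVK : V \subset K := joing_subl _ _.
have nsVK : V <| K by rewrite /normal sVK (subset_trans sKN (subsetIr _ _)).
have qKV : q.-group (K / V) by rewrite /= quotientYidl // quotient_pgroup // (pHall_pgroup sylQ).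
have defV : residual K = V by apply: residual_eq => //; apply: residual_id.
exists K.
  rewrite properE sKG; apply: contra nsRH => sGK.
  have defG : K = G by apply/val_inj/eqP; rewrite eqEsubset sKG.
  by rewrite -defG defV residual_sub.
have -> : (q %| nfix G H K)%N = (q %| nfix G V K)%N.
  by rewrite /dvdn (nfix_residual sHG sKG).
have -> : nfix G V K = #|N : K|.
  apply/eqP; rewrite -(eqn_pmul2l (cardG_gt0 K)) card_nfix // Lagrange //.
  apply/eqP/eq_card => g; rewrite [RHS]in_setI inE; apply: andb_id2l => Gg; apply/idP/idP=> [sVKg | Ng].
    (* V is the residual of itself and of K, so if V lies in K^g, it lies in the residual V^g of
       K^g. *)
    have : V \subset V :^ g.
      suff : residual V \subset residual (K :^ g) by rewrite residualJ defV residual_id.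
      exact: residualS.
    by rewrite -sub_conjgV -groupV inE.
  by rewrite -(normP Ng) conjSg.
have /and3P[_ _] := sylQ; rewrite p'natE //; apply: contra => qNK.
exact: dvdn_trans qNK (indexgS N (joing_subr V Q)).
Qed.

End Residual.

(** * Marks of relations and the Dress condition *)

Section DressMarks.
Variables (p q : nat) (gT : finGroupType).
Hypotheses (p_prime : prime p) (q_prime : prime q).
Implicit Types G H K T : {group gT}.

(** The preimage C of a cyclic normal subgroup of q-power index in G / P is p-hypo-elementary and
    contains O^q(G). Conversely O_p(O^q(G)) is normal in G, and O^q(G) modulo it is cyclic of
    q-power index. *)
Lemma Dress_residual G : Dress_group p q G = hypo_elementary p (residual q G).
Proof.
apply/existsP/idP=> [[P /and3P[nsPG pP /existsP[Cb /and3P[nsCb cycCb qCb]]]] | hypoR].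
  have [C defC sPC sCG] := inv_quotientN nsPG nsCb.
  have hypoC : hypo_elementary p C.
    by apply/existsP; exists P; rewrite (normalS sPC (normal_sub sCG) nsPG) pP -defC.
  apply: hypo_elementaryS hypoC; apply: residual_min => //.
  rewrite -(isog_pgroup _ (third_isog sPC nsPG sCG)) -defC.
  by rewrite /pgroup card_quotient ?normal_norm.
have nsRG := residual_normal q G; set P := 'O_p(residual q G).
have nsPG : P <| G := gFnormal_trans _ nsRG.
exists 'O_p(residual q G)%G; rewrite nsPG pcore_pgroup; apply/existsP.
exists (residual_group q G / P)%G; rewrite quotient_normal //=.
rewrite -(hypo_elementaryP p (residual_group q G)) hypoR /=.
have [sRG qR] := residual_max q G.
by rewrite index_quotient_eq ?normal_norm // subIset // pcore_sub orbT.
Qed.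

Lemma mark_residual_mod G (x : burnside G) :
  (q %| mark G x - mark (residual q G) x)%Z.
Proof.
rewrite !markE -sumrB; apply: rpred_sum => c _; rewrite -mulrBr dvdz_mull //.
rewrite -eqz_mod_dvd !modz_nat eqz_nat; apply/eqP.
exact: nfix_residual (subxx G) (trans_repr_sub c).
Qed.

Lemma Dress_mark_dvd G (x : burnside G) : Dress_group p q G -> x \in is_relation p (G:=G) ->
  (q %| mark G x)%Z.
Proof.
rewrite Dress_residual => hypoR Kx; have := mark_residual_mod x.
by rewrite (relation_mark_hypo p_prime Kx (residual_sub q G) hypoR) subr0.
Qed.

(** Marks at subgroups H not containing O^q(G) can be killed at no cost modulo q: with K from
    [nfix_residual_prime], the factor [G/K] - |(G/K)^H| has the mark -|(G/K)^H| at G, prime to q. So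
    only p-hypo-elementary subgroups above O^q(G) matter. *)
Lemma relation_above_residual G (x : burnside G) :
    (forall H, H \subset G -> hypo_elementary p H -> residual q G \subset H -> mark H x = 0%R) ->
  exists2 y, y \in is_relation p (G:=G) & exists2 u, ~~ (q %| u)%Z & mark G y = (mark G x * u)%R.
Proof.
move=> x0; pose P H := (H \subset G) && ~~ (residual q G \subset H).
(* [G] is a mere default: by [KfP] the search succeeds whenever [P H] holds. *)
pose Kf H := odflt G [pick K : {group gT} | (K \proper G) && ~~ (q %| nfix G H K)%N].
have KfP H : P H -> Kf H \proper G /\ ~~ (q %| nfix G H (Kf H))%N.
  case/andP=> sHG nsRH; rewrite /Kf; case: pickP => [K /andP[] // | none].
  have [K prK nqK] := nfix_residual_prime q_prime sHG nsRH.
  by have := none K; rewrite prK nqK.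
pose s := [seq (H, Kf H) | H <- enum [pred H : {group gT} | P H]].
have [|y marky] := @mark_kill gT G s.
  by move=> hk /mapP[H]; rewrite mem_enum inE => /KfP[prK _] -> /=; apply: proper_sub.
exists (burnside_mul y x).
  apply: relation_of_marks => // H sHG hypoH; rewrite mark_mul //.
  have [sRH|nsRH] := boolP (residual q G \subset H); first by rewrite x0 // mulr0.
  have PH : P H by rewrite /P sHG.
  rewrite marky // big_map (bigD1_seq H) ?enum_uniq ?mem_enum //=.
  by rewrite subrr !mul0r.
exists (mark G y); last by rewrite mark_mul // mulrC.
rewrite marky // big_map big_seq; elim/big_rec: _ => [|H u]; rewrite dvdzE absz_nat.
  by rewrite dvdn1 neq_ltn prime_gt1 ?orbT.
rewrite mem_enum inE dvdzE => /KfP[prK nqK] nqu /=.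
by rewrite nfix_proper // sub0r abszM abszN absz_nat Euclid_dvdM // negb_or nqK.
Qed.

Lemma relation_not_Dress G : ~~ Dress_group p q G ->
  exists2 y, y \in is_relation p (G:=G) & ~~ (q %| mark G y)%Z.
Proof.
rewrite Dress_residual => nhypoR.
have [|y Ky [u nqu marky]] := @relation_above_residual G (coset_class G G).
  by move=> H _ hypoH sRH; case/negP: nhypoR; apply: hypo_elementaryS hypoH.
by exists y; rewrite // marky mark1 // mul1r.
Qed.

End DressMarks.

Section HypoQuotients.
Variables (p : nat) (gT : finGroupType).
Implicit Types G H K N P T : {group gT}.

Lemma hypo_elementary_quotient G N : G \subset 'N(N) ->
  hypo_elementary p G -> hypo_elementary p (G / N).
Proof.
move=> nNG /existsP[P /and3P[nsPG pP /cyclicP[xb defGP]]].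
have [sPG nPG] := andP nsPG; have nNP := subset_trans sPG nNG.
have : xb \in G / P by rewrite defGP cycle_id.
case/morphimP=> x Nx Gx def_x.
have nNx : <[x]> \subset 'N(N) by rewrite cycle_subG (subsetP nNG).
have defG : G :=: P <*> <[x]>.
  apply/eqP; rewrite eqEsubset join_subG sPG cycle_subG Gx !andbT.
  rewrite -(quotientSGK nPG) ?joing_subl // quotientYidl ?cycle_subG //.
  by rewrite quotient_cycle // defGP def_x.
apply/existsP; exists (P / N)%G; rewrite quotient_normal //= quotient_pgroup //=.
have -> : G / N = (P / N) <*> (<[x]> / N) by rewrite defG quotientY.
rewrite quotientYidl; first by rewrite !quotient_cyclic ?cycle_cyclic.
by apply: subset_trans (quotientS N _) (normal_norm (quotient_normal N nsPG)); rewrite cycle_subG.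
Qed.

Lemma hypo_elementary_pquotient G P : P <| G -> p.-group P ->
  hypo_elementary p (G / P) = hypo_elementary p G.
Proof.
move=> nsPG pP; have sPO : P \subset 'O_p(G) by apply: pcore_max.
rewrite !hypo_elementaryP pquotient_pcore //.
exact: isog_cyclic (third_isog sPO nsPG (pcore_normal p G)).
Qed.

Lemma hypo_elementary_p'group G : p^'.-group G -> hypo_elementary p G = cyclic G.
Proof.
move=> p'G; rewrite hypo_elementaryP (_ : 'O_p(G) = 1).
  by rewrite -(isog_cyclic (quotient1_isog G)).
by rewrite -(setIidPl (pcore_sub p G)) coprime_TIg // (pnat_coprime (pcore_pgroup p G)).
Qed.

(** O_p(H) is O_p(G) :&: H, so H / O_p(H) is the image of H in G / O_p(G). *)
Lemma hypo_elementary_normal_cyclic G H : H <| G -> hypo_elementary p H -> cyclic (H / 'O_p(G)).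
Proof.
move=> nsHG; rewrite hypo_elementaryP => cycH; have nsPG := pcore_normal p G.
have defO : 'O_p(G) :&: H = 'O_p(H).
  apply/eqP; rewrite eqEsubset subsetI pcore_sub andbT; apply/andP; split.
    apply: pcore_max; first exact: pgroupS (subsetIl _ _) (pcore_pgroup p G).
    by rewrite /= setIC (normalGI (normal_sub nsHG) nsPG).
  by rewrite pcore_max ?pcore_pgroup // gFnormal_trans.
by rewrite -(isog_cyclic (second_isog (subset_trans (normal_sub nsHG) (gFnorm _ _)))) /= defO.
Qed.

End HypoQuotients.

Section TwoPrimes.
Variables (p q : nat) (gT : finGroupType).
Implicit Types G H K N P T V : {group gT}.

Lemma sub_residual G V : V \subset G -> q^'.-group V -> V \subset residual q G.
Proof.
move=> sVG q'V; apply/subsetP=> v Vv.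
by rewrite mem_residual ?(subsetP sVG) // (mem_p_elt q'V).
Qed.

Lemma residual_quotient G N : N <| G -> residual q (G / N) \subset residual q G / N.
Proof.
move=> nsNG; apply: residual_min; first by rewrite quotient_normal ?residual_normal.
rewrite /pgroup card_quotient ?normal_norm ?quotient_normal ?residual_normal //.
have [sRG qR] := residual_max q G; apply: pnat_dvd qR; apply: index_quotient.
by rewrite subIset // normal_norm.
Qed.

End TwoPrimes.

(** Modulo P = O_p(G) both residuals become cyclic. A Sylow r-subgroup lies in the one for a prime
    other than r, so it is cyclic; and the index of the Fitting subgroup is a power of q1 and also
    of q2, so G / P is nilpotent, hence cyclic. *)
Lemma Dress_two_primes (p q1 q2 : nat) (gT : finGroupType) (G : {group gT}) :
    prime q1 -> prime q2 -> q1 != q2 -> Dress_group p q1 G -> Dress_group p q2 G ->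
  hypo_elementary p G.
Proof.
move=> q1_prime q2_prime neq12 D1 D2; rewrite hypo_elementaryP.
set P := 'O_p(G)%G; have nsPG : P <| G := pcore_normal p G.
have cycR q : Dress_group p q G -> cyclic (residual q G / P).
  rewrite Dress_residual; exact: (hypo_elementary_normal_cyclic (residual_normal q G)).
have nsR q : (residual_group q G / P)%G <| G / P.
  by rewrite quotient_normal ?residual_normal.
apply: nil_Zgroup_cyclic.
  apply/forall_inP=> V /SylowP[r r_prime sylV].
  have sVR q : r != q -> V \subset residual q G / P.
    move=> neqr; apply: subset_trans (residual_quotient q nsPG).
    apply: sub_residual (pHall_sub sylV) _.
    by apply: sub_in_pnat (pHall_pgroup sylV) => i _ /eqP->.
  have [eqr|neqr] := eqVneq r q1; last exact: cyclicS (sVR _ neqr) (cycR _ D1).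
  by apply: cyclicS (cycR _ D2); apply: sVR; rewrite eqr.
suff -> : (G / P)%G = 'F(G / P)%G by apply: Fitting_nil.
have nF q : Dress_group p q G -> q.-nat #|G / P : 'F(G / P)|.
  move=> Dq; have [sRG qR] := residual_max q G.
  have sRF : (residual_group q G / P)%G \subset 'F(G / P).
    by rewrite Fitting_max ?abelian_nil ?cyclic_abelian ?cycR.
  have nP : G :&: residual q G \subset 'N(P) by rewrite subIset // normal_norm.
  exact: pnat_dvd (dvdn_trans (indexgS (G / P) sRF) (index_quotient nP)) qR.
apply/val_inj/eqP; rewrite eqEsubset Fitting_sub andbT -indexg_eq1 /=.
apply/eqP; apply: (pnat_1 (nF _ D1)); apply: sub_in_pnat (nF _ D2) => i _ /eqP->.
by rewrite !inE eq_sym.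
Qed.

Lemma nfix_normal (gT : finGroupType) (G M : {group gT}) (A : {set gT}) :
  M <| G -> A \subset M -> nfix G A M = #|G : M|.
Proof.
move=> nsMG sAM; have [sMG nMG] := andP nsMG.
apply/eqP; rewrite -(eqn_pmul2l (cardG_gt0 M)) card_nfix ?(subset_trans sAM) // Lagrange //.
apply/eqP/eq_card => g; rewrite inE andb_idr // => Gg.
by rewrite (normsP nMG).
Qed.

Lemma nfix_normal0 (gT : finGroupType) (G M : {group gT}) (A : {set gT}) :
  M <| G -> A \subset G -> ~~ (A \subset M) -> nfix G A M = 0%N.
Proof.
move=> nsMG sAG nsAM; apply: nfix0 => // [|g Gg]; first exact: normal_sub.
by rewrite (normsP (normal_norm nsMG)).
Qed.

(** * Relations whose mark at G is exactly q *)

Definition q_relation (p q : nat) (gT : finGroupType) (G : {group gT}) :=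
  exists2 y : burnside G, mark G y = q%:Z &
    forall H : {group gT}, H \subset G -> hypo_elementary p H -> mark H y = 0%R.

Lemma q_relation_infl p q (gT : finGroupType) (G N : {group gT}) :
  N <| G -> q_relation p q (G / N)%G -> q_relation p q G.
Proof.
move=> nsNG [y markG mark0]; exists (infl y); first by rewrite mark_infl.
move=> H sHG hypoH; rewrite mark_infl //.
apply: (mark0 (H / N)%G); first exact: quotientS.
exact: hypo_elementary_quotient (subset_trans sHG (normal_norm nsNG)) hypoH.
Qed.

Section OrderSquare.
Variables (p q : nat) (gT : finGroupType) (A : {group gT}).
Hypotheses (q_prime : prime q) (cardA : #|A| = (q ^ 2)%N) (ncycA : ~~ cyclic A).
Hypothesis neq_pq : p != q.

Let S := [set M : {group gT} | (M \subset A) && (#|M| == q)].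

(** All q^2 - 1 nontrivial elements of A have order q, and each subgroup of order q contains q - 1
    of them. *)
Lemma card_order_q_subgroups : #|S| = q.+1.
Proof.
have q_gt1 := prime_gt1 q_prime.
have cyc_order a : a \in A^# -> #[a] = q.
  case/setD1P=> nta Aa; have : (#[a] %| q ^ 2)%N by rewrite -cardA order_dvdG.
  case/(dvdn_pfactor _ _ q_prime) => -[|[|[|//]]] _ oa.
  - by case/eqP: nta; apply/eqP; rewrite -order_eq1 oa.
  - by rewrite oa expn1.
  case/negP: ncycA; apply/cyclicP; exists a; apply/eqP.
  by rewrite eq_sym eqEcard cycle_subG Aa -orderE oa cardA leqnn.
have sumS : (#|A^#| = \sum_(M in S) q.-1)%N.
  rewrite -sum1_card (partition_big (fun a => <[a]>%G) [in S]) /=; last first.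
    by move=> a A'a; rewrite inE cycle_subG -orderE cyc_order // eqxx; case/setD1P: A'a => _ ->.
  apply: eq_bigr => M; rewrite inE => /andP[sMA /eqP oM]; rewrite sum1dep_card.
  have -> : q.-1 = #|M^#| by rewrite -oM (cardsD1 1) group1.
  apply: eq_card => a; rewrite inE !in_setD1.
  apply/andP/andP=> [[/andP[nta Aa] /eqP <-] | [nta Ma]]; first by rewrite nta cycle_id.
  have A'a : a \in A^# by rewrite in_setD1 nta (subsetP sMA).
  rewrite nta (subsetP sMA) //; split=> //; apply/eqP/val_inj/eqP.
  by rewrite eqEcard cycle_subG Ma -orderE cyc_order ?oM /=.
move: sumS; rewrite sum_nat_const => sumS; apply/eqP.
rewrite -(@eqn_pmul2r q.-1) -?sumS; last by rewrite -subn1 subn_gt0.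
have : (#|A| = #|A^#|.+1)%N by rewrite (cardsD1 1) group1.
rewrite cardA => e; have -> : #|A^#| = (q ^ 2 - 1 ^ 2)%N by rewrite e subn1.
by rewrite subn_sqr subn1 addn1 mulnC.
Qed.

(* The relation is q [A/A] - (sum of the [A/M] over the q + 1 subgroups M of order q) + [A/1]. *)
Lemma q_relation_order_square : q_relation p q A.
Proof.
have q_gt0 := prime_gt0 q_prime; have q_gt1 := prime_gt1 q_prime.
have qA : q.-group A by rewrite /pgroup cardA pnatX pnat_id.
have abA : abelian A by apply: (p2group_abelian qA); rewrite cardA pfactorK.
have nsA (M : {group gT}) : M \subset A -> M <| A by move=> sMA; rewrite -sub_abelian_normal.
have sumE (T : {set gT}) : mark T (\sum_(M in S) coset_class A M)%R = (\sum_(M in S) mark T (coset_class A M))%R.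
  exact: raddf_sum.
exists (coset_class A A *+ q - \sum_(M in S) coset_class A M + coset_class A 1%G)%R.
  rewrite (raddfD (mark A)) (raddfB (mark A)) (raddfMn (mark A)) /= sumE mark1 // big1 => [|M]; last first.
    rewrite inE => /andP[sMA /eqP oM]; rewrite mark_coset // nfix_proper //.
    by rewrite properEcard sMA oM cardA -{1}(expn1 q) ltn_exp2l.
  rewrite mark_coset // nfix_proper ?addr0 ?subr0 ?natz // properEcard sub1G cards1 cardA.
  by rewrite -{1}(expn0 q) ltn_exp2l.
move=> H sHA hypoH.
(* A is noncyclic of order prime to p, hence not p-hypo-elementary. *)
have prHA : H \proper A.
  rewrite properEneq sHA andbT; apply: contra ncycA => /eqP eqHA.
  rewrite -(@hypo_elementary_p'group p) -?eqHA //.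
  rewrite (val_inj eqHA : H = A); apply: sub_in_pnat qA => i _ /eqP->.
  by rewrite !inE eq_sym.
have markE1 : mark H (coset_class A A *+ q - \sum_(M in S) coset_class A M + coset_class A 1%G)%R =
    (q%:Z - \sum_(M in S) (q * (H \subset M))%:Z + (q ^ 2 * (H \subset [1 gT]))%:Z)%R.
  rewrite (raddfD (mark H)) (raddfB (mark H)) (raddfMn (mark H)) /= sumE mark1 // natz mark_coset //.
  have -> : nfix A H 1 = (q ^ 2 * (H \subset [1 gT]))%N.
    have [s1|ns1] := boolP (H \subset [1 gT]); last by rewrite muln0 nfix_normal0 ?normal1.
    by rewrite muln1 nfix_normal ?normal1 // indexg1 cardA.
  congr (_ - _ + _)%R; apply: eq_bigr => M; rewrite inE => /andP[sMA /eqP oM].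
  rewrite mark_coset //; congr Posz.
  have [s1|ns1] := boolP (H \subset M); last by rewrite muln0 nfix_normal0 ?nsA.
  rewrite muln1 nfix_normal ?nsA // -divgS // cardA oM.
  by rewrite expnS expn1 mulnK.
rewrite markE1.
(* For H = 1 the value is q - (q + 1) q + q^2 = 0; for H of order q only M = H contributes, which
   gives q - q = 0. *)
have [H1|ntH] := eqVneq (H :> {set gT}) 1.
  rewrite H1 subxx muln1 (eq_bigr (fun=> q%:Z)) => [|M _]; last by rewrite sub1G muln1.
  rewrite sumr_const card_order_q_subgroups mulrS opprD addrA subrr sub0r.
  by rewrite -mulr_natl natz -PoszM mulnn addNr.
have nsH1 : (H \subset [1 gT]) = false by rewrite subG1; apply/negbTE.
rewrite nsH1 muln0 addr0.
have oH : #|H| = q.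
  have : (#|H| %| q ^ 2)%N by rewrite -cardA cardSg.
  case/(dvdn_pfactor _ _ q_prime) => -[|[|[|//]]] _ oH.
  - by case/eqP: ntH; apply: card1_trivg.
  - by rewrite oH expn1.
  by move: (proper_card prHA); rewrite oH cardA ltnn.
have SH : H \in S by rewrite inE sHA oH eqxx.
rewrite (bigD1 H) //= subxx muln1 big1 ?addr0 ?subrr // => M /andP[]; rewrite inE.
case/andP=> sMA /eqP oM neqMH; case: (boolP (H \subset M)) => [sHM|_]; last by rewrite muln0.
by case/eqP: neqMH; apply/val_inj/eqP; rewrite eq_sym eqEcard sHM oM oH /=.
Qed.

End OrderSquare.

(** The Frattini quotient of a noncyclic q-group is elementary abelian of rank at least 2, so it has
    a noncyclic quotient of order q^2, from which the relation is inflated. *)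
Lemma q_relation_pgroup (p q : nat) (gT : finGroupType) (E : {group gT}) :
  prime q -> p != q -> q.-group E -> ~~ cyclic E -> q_relation p q E.
Proof.
move=> q_prime neq_pq qE ncycE; apply: (q_relation_infl (Phi_normal E)).
have abelB := Phi_quotient_abelem qE; set B := (E / 'Phi(E))%G in abelB *.
have ncycB : ~~ cyclic B by apply: contra ncycE => cycB; apply: Phi_quotient_cyclic.
have qB : q.-group B := abelem_pgroup abelB.
have oB := card_pgroup qB.
have n_gt1 : (1 < logn q #|B|)%N.
  rewrite ltnNge; apply: contra ncycB; rewrite leq_eqVlt ltnS leqn0.
  case/orP=> /eqP n; first by apply: prime_cyclic; rewrite oB n expn1.
  have -> : B = 1%G by apply/val_inj/card_le1_trivg; rewrite oB n.
  exact: cyclic1.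
have [Y [sYB nsYB oY]] := normal_pgroup qB (normal_refl B) (leq_subr 2 _).
have oBY : #|B / Y| = (q ^ 2)%N.
  rewrite card_quotient ?normal_norm // -divgS // oB oY -{1}(subnK n_gt1) expnD mulKn //.
  by rewrite expn_gt0 prime_gt0.
apply: (q_relation_infl nsYB); apply: q_relation_order_square => //.
apply/negP=> cycBY; have := cyclic_abelem_prime (quotient_abelem Y abelB) cycBY.
rewrite trivg_card1 /= oBY -{2}(expn0 q) eqn_exp2l ?prime_gt1 // => /(_ isT)/eqP.
by rewrite -[X in _ == X]expn1 eqn_exp2l ?prime_gt1.
Qed.

(** Let U = O^q(G), P = O_p(U) and Z the preimage of the centralizer of U / P. All p-hypo-elementary
    subgroups above U lie in Z. If Z < G, a normal subgroup M of index q above Z gives q [G/G] -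
    [G/M], whose marks vanish at all of them. If Z = G, then G / P is nilpotent with noncyclic
    q-part and q is not p, so a relation can be inflated from that q-part. *)
Lemma Dress_relation_exact (p q : nat) (gT : finGroupType) (G : {group gT}) :
    prime p -> prime q -> Dress_group p q G -> ~~ hypo_elementary p G ->
  exists2 y, y \in is_relation p (G:=G) & exists2 u, ~~ (q %| u)%Z & mark G y = (q%:Z * u)%R.
Proof.
move=> p_prime q_prime; rewrite Dress_residual => hypoU nhypoG.
set U := residual_group q G in hypoU *; have nsUG : U <| G := residual_normal q G.
have [sUG nUG] := andP nsUG.
have [_ qGU] := residual_max q G.
set P := 'O_p(U)%G; have nsPG : P <| G := gFnormal_trans _ nsUG.
have [sPG nPG] := andP nsPG; have pP : p.-group P := pcore_pgroup p U.
have sPU : P \subset U := pcore_sub p U.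
have cycUb : cyclic (U / P) by rewrite -hypo_elementaryP.
have [Zb defZ] : exists Z : {group coset_of P}, Z :=: 'C_(G / P)(U / P).
  by exists 'C_(G / P)(U / P)%G.
have nsZb : Zb <| G / P.
  rewrite defZ; have nUb : G / P \subset 'N(U / P) by rewrite normal_norm ?quotient_normal.
  by have := subcent_normal (G / P) (U / P); rewrite (setIidPl nUb).
have [Z defZb sPZ nsZG] := inv_quotientN nsPG nsZb.
have [sZG nZG] := andP nsZG.
have sUZ : U \subset Z.
  rewrite -(quotientSGK (subset_trans sUG nPG) sPZ) -defZb defZ subsetI quotientS //=.
  by rewrite -[_ \subset _]/(abelian _) cyclic_abelian.
(* H / O_p(H) is abelian and U is normal, so [H, U] lies in O_p(H) :&: U. This is a normal
   p-subgroup of U, hence contained in P, and H centralizes U / P. *)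
have sHZ (H : {group gT}) : H \subset G -> hypo_elementary p H -> U \subset H -> H \subset Z.
  move=> sHG hypoH sUH; have nPH := subset_trans sHG nPG; have nUH := subset_trans sHG nUG.
  rewrite -(quotientSGK nPH sPZ) -defZb defZ subsetI quotientS //=.
  rewrite quotient_cents2 ?(subset_trans sUG nPG) //.
  have sHU : [~: H, U] \subset U by rewrite commg_subr.
  have sHO : [~: H, U] \subset 'O_p(H).
    apply: subset_trans (commgS H sUH) _; apply: der1_min; first exact: gFnorm.
    by apply: cyclic_abelian; rewrite -hypo_elementaryP.
  apply: subset_trans (_ : _ \subset 'O_p(H) :&: U) _; first by rewrite subsetI sHO.
  apply: pcore_max; first exact: pgroupS (subsetIl _ _) (pcore_pgroup p H).
  by rewrite /= setIC (normalGI sUH (pcore_normal p H)).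
have [eqZG|neqZG] := eqVneq (Z :> {set gT}) G; last first.
  have qGZ : q.-group (G / Z).
    rewrite /pgroup card_quotient //; apply: pnat_dvd qGU; exact: indexgS.
  have n_gt0 : (0 < logn q #|G / Z|)%N.
    rewrite lt0n; apply: contra neqZG => /eqP n0; rewrite eqEsubset sZG /=.
    by rewrite -quotient_sub1 // subG1 trivg_card1 (card_pgroup qGZ) n0.
  have [Mb [sMb nsMb oMb]] := normal_pgroup qGZ (normal_refl _) (leq_subr 1 _).
  have [M defMb sZM nsMG] := inv_quotientN nsZG nsMb.
  have iGM : #|G : M| = q.
    rewrite -(index_quotient_eq _ (normal_sub nsMG) nZG); last by rewrite subIset // sZM orbT.
    rewrite -defMb -divgS // (card_pgroup qGZ) oMb -{1}(subnK n_gt0) expnD mulKn ?expn1 //.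
    by rewrite expn_gt0 prime_gt0.
  pose x0 := (coset_class G G *+ q - coset_class G M)%R.
  have markx0 (T : {group gT}) : T \subset G -> mark T x0 = (q%:Z - (nfix G T M)%:Z)%R.
    by move=> sTG; rewrite (raddfB (mark T)) (raddfMn (mark T)) /= mark1 // natz mark_coset.
  have [|y Ky [u nqu marky]] := @relation_above_residual p q _ p_prime q_prime G x0.
    move=> H sHG hypoH sUH; rewrite markx0 // (nfix_normal nsMG) ?iGM ?subrr //.
    exact: subset_trans (sHZ H sHG hypoH sUH) sZM.
  exists y => //; exists u => //; rewrite marky markx0 // nfix_proper ?subr0 //.
  rewrite properE normal_sub //=; rewrite -indexg_eq1 iGM.
  by rewrite neq_ltn prime_gt1 ?orbT.
have sUZG : U / P \subset 'Z(G / P).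
  have sGZ : G \subset Z by rewrite eqZG.
  rewrite /center subsetI quotientS //= centsC; apply: subset_trans (quotientS P sGZ) _.
  by rewrite -defZb defZ subsetIr.
(* U / P is central, so G / P modulo its center is a q-group. *)
have nilGb : nilpotent (G / P).
  rewrite -quotient_center_nil; apply: (@pgroup_nil _ q).
  rewrite /pgroup card_quotient ?gFnorm //.
  apply: pnat_dvd qGU; apply: dvdn_trans (indexgS _ sUZG) _; apply: index_quotient.
  by rewrite subIset // nPG.
set Gb := (G / P)%G in nilGb.
have nhypoGb : ~~ hypo_elementary p Gb by rewrite hypo_elementary_pquotient.
have defGb := nilpotent_pcoreC q nilGb.
have cycQ' : cyclic 'O_q^'(Gb).
  apply: cyclicS cycUb; apply: subset_trans (residual_quotient q nsPG).
  by apply: sub_residual; rewrite ?pcore_sub ?pcore_pgroup.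
have [_ defGbM cQQ' tiQQ'] := dprodP defGb.
(* If p = q, then G / P modulo its p-core is cyclic, which would make G p-hypo-elementary. *)
have [eqpq|neqpq] := eqVneq p q.
  case/negP: nhypoGb; rewrite hypo_elementaryP eqpq.
  have -> : Gb / 'O_q(Gb) = 'O_q^'(Gb) / 'O_q(Gb) by rewrite -[RHS]quotientMidl defGbM.
  exact: quotient_cyclic.
have ncycQ : ~~ cyclic 'O_q(Gb).
  apply: contra nhypoGb => cycQ.
  have cycGb : cyclic Gb.
    by rewrite (cyclic_dprod defGb cycQ cycQ') (pnat_coprime (pcore_pgroup q Gb) (pcore_pgroup q^' Gb)).
  by rewrite hypo_elementaryP quotient_cyclic.
have [y marky y0] : q_relation p q G.
  apply: (q_relation_infl nsPG); apply: (q_relation_infl (pcore_normal q^' Gb)).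
  have isoQ : 'O_q(Gb) \isog Gb / 'O_q^'(Gb).
    have -> : Gb / 'O_q^'(Gb) = 'O_q(Gb) / 'O_q^'(Gb) by rewrite -[RHS]quotientMidr defGbM.
    apply: quotient_isog; last by rewrite setIC.
    exact: subset_trans (pcore_sub _ _) (gFnorm _ _).
  apply: q_relation_pgroup => //.
    by rewrite /= -(isog_pgroup q isoQ) pcore_pgroup.
  by rewrite /= -(isog_cyclic isoQ).
exists y; first by apply: relation_of_marks.
by exists 1%R; rewrite ?mulr1 // dvdzE absz_nat dvdn1 neq_ltn prime_gt1 ?orbT.
Qed.

(** * The primitive quotient *)

Local Close Scope group_scope.

Section RelationMarks.
Import Order.TTheory boolp classical_sets ring_quotient generic_quotient.
Local Open Scope quotient_scope.
Variables (p : nat) (gT : finGroupType) (G : {group gT}).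
Hypothesis p_prime : prime p.

Lemma relation_mark_generator :
  exists d : nat, (exists2 x, x \in is_relation p (G:=G) & mark G x = d%:Z) /\
    forall x, x \in is_relation p (G:=G) -> (d %| mark G x)%Z.
Proof.
(* [P d] is about d + 1: the search runs over positive marks, and the generator is 0 when there is
   none. *)
pose P d := `[< exists2 x, x \in is_relation p (G:=G) & mark G x = d.+1%:Z >].
have [[d0 Pd0]|none] := pselect (exists d, P d); last first.
  exists 0%N; split; first by exists 0; rewrite ?rpred0 ?raddf0.
  move=> x Kx; rewrite dvd0z; apply/negPn/negP=> nzx; apply: none.
  exists `|mark G x|%N.-1; apply/asboolP; rewrite prednK ?absz_gt0 //.
  have [/ger0_norm x0|/ltW/ler0_norm x0] := lerP 0 (mark G x); first by exists x; rewrite // abszE x0.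
  by exists (- x); rewrite ?rpredN // raddfN abszE x0.
have exP : exists d, P d by exists d0.
case: (ex_minnP exP) => d /asboolP[y Ky markd] mind.
exists d.+1; split=> [|x Kx]; first by exists y.
pose r := x - y *~ (mark G x %/ d.+1%:Z)%Z.
have markr : mark G r = (mark G x %% d.+1%:Z)%Z.
  by rewrite (raddfB (mark G)) /= (raddfMz (mark G)) /= markd mulrzz mulrC /modz.
have Kr : r \in is_relation p (G:=G) by rewrite rpredB // rpredMz.
apply/dvdz_mod0P; rewrite -markr; apply/eqP/negPn/negP=> nzr.
have : P `|mark G r|%N.-1.
  apply/asboolP; exists r => //; rewrite prednK ?absz_gt0 // abszE ger0_norm //.
  by rewrite markr modz_ge0.
move/mind; apply/negP; rewrite -ltnNge -ltnS prednK ?absz_gt0 //.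
by rewrite -ltz_nat abszE markr ger0_norm ?modz_ge0 // ltz_pmod.
Qed.

Lemma relation_mark1 : (forall q, prime q -> ~~ Dress_group p q G) ->
  exists2 x, x \in is_relation p (G:=G) & mark G x = 1.
Proof.
move=> nD; have [d [[x Kx markx] dvdd]] := relation_mark_generator.
have nq q : prime q -> ~~ (q %| d)%N.
  move=> q_prime; have [y Ky nqy] := relation_not_Dress p_prime q_prime (nD q q_prime).
  apply: contra nqy => qd; apply: dvdz_trans (dvdd y Ky).
  by rewrite dvdzE.
exists x => //; rewrite markx; congr Posz.
(* The case d = 0 is excluded because 2 would divide d, and d > 1 by its smallest prime factor. *)
case: d {markx dvdd} nq => [|[|d]] nq //; first by have := nq 2%N isT; rewrite dvdn0.
by have := nq _ (pdiv_prime (isT : 1 < d.+2)%N); rewrite pdiv_dvd.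
Qed.

(** q divides the generator d. A second factor q is excluded by [Dress_relation_exact]; a prime r
    other than q is excluded because G is not a (p,r)-Dress group, two such primes forcing it to be
    p-hypo-elementary. *)
Lemma relation_mark_prime q : prime q -> Dress_group p q G -> ~~ hypo_elementary p G ->
  exists2 x, x \in is_relation p (G:=G) & mark G x = q%:Z.
Proof.
move=> q_prime Dq nhypo; have [d [[x Kx markx] dvdd]] := relation_mark_generator.
have [y Ky [u nqu marky]] := Dress_relation_exact p_prime q_prime Dq nhypo.
have /dvdnP[e defd] : (q %| d)%N.
  by have := Dress_mark_dvd p_prime Dq Kx; rewrite markx dvdzE.
have q0 := prime_gt0 q_prime.
have nr r : prime r -> ~~ (r %| e)%N.
  move=> r_prime; have [->|neqr] := eqVneq r q.
    apply: contra nqu => qe; have := dvdd y Ky; rewrite marky defd mulnC PoszM.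
    rewrite dvdz_mul2l; last (by rewrite eqz_nat -lt0n); apply: dvdz_trans.
    by rewrite dvdzE.
  have nDr : ~~ Dress_group p r G.
    by apply: contra nhypo => Dr; apply: Dress_two_primes Dr Dq.
  have [w Kw nrw] := relation_not_Dress p_prime r_prime nDr.
  apply: contra nrw => re; apply: dvdz_trans (dvdd w Kw).
  by rewrite dvdzE defd /= dvdn_mulr.
exists x => //; rewrite markx defd; congr Posz.
case: e {defd} nr => [|[|e]] nr; last 1 first.
- by have := nr _ (pdiv_prime (isT : 1 < e.+2)%N); rewrite pdiv_dvd.
- by have := nr 2%N isT; rewrite dvdn0.
by rewrite mul1n.
Qed.

Definition top_mark (x : relation_group p G) : int := mark G x.

Lemma top_mark_is_zmod_morphism : zmod_morphism top_mark.
Proof.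
by move=> x y; rewrite /top_mark -(raddfB (mark G)) /=; congr mark.
Qed.

HB.instance Definition _ := GRing.isZmodMorphism.Build (relation_group p G) int
  top_mark top_mark_is_zmod_morphism.

(** y has no [G/G] term, so the product is a combination of relations induced from restrictions of w
    to proper subgroups. *)
Lemma mul_imprim (y w : burnside G) (v : relation_group p G) :
    mark G y = 0 -> w \in is_relation p (G:=G) -> relation_val v = burnside_mul y w ->
  v \in imprim (p:=p) (G:=G).
Proof.
move=> y0 Kw defv.
have Kres c : res (trans_repr c) w \in is_relation p (G:=trans_repr (G:=G) c).
  by apply: res_relation => //; apply: trans_repr_sub.
have Kg c : ind G (res (trans_repr (G:=G) c) w) \in is_relation p (G:=G).
  by apply: ind_relation => //; apply: trans_repr_sub.
have -> : v = \sum_c RelationGroup (Kg c) *~ y c.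
  apply: val_inj; rewrite raddf_sum /= defv; apply: eq_bigr => c _.
  exact/esym/(raddfMz (val : relation_group p G -> burnside G)).
apply: rpred_sum => c _; have [->|nzc] := eqVneq (y c) 0; first by rewrite mulr0z rpred0.
apply: rpredMz; apply: mem_zspan; left.
exists (trans_repr c), (RelationGroup (Kres c)); split=> //.
exact: trans_repr_proper nzc.
Qed.

Lemma top_mark0_imprim (theta v : relation_group p G) :
  top_mark theta = 1 -> top_mark v = 0 -> v \in imprim (p:=p) (G:=G).
Proof.
case: theta v => [t Kt] [z Kz]; rewrite /top_mark /= => t1 z0.
pose y := coset_class G G - t.
have y0 : mark G y = 0 by rewrite (raddfB (mark G)) /= mark1 // t1 subrr.
have Kid x w : w \in is_relation p (G:=G) -> burnside_mul x w \in is_relation p (G:=G).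
  move=> Kw; apply: rpred_sum => c _; apply: rpredMz; have sc := trans_repr_sub c.
  by apply: ind_relation => //; apply: res_relation.
(* In each product the first factor has mark 0 at G and supplies the coefficients, the second is the
   relation that is restricted and induced: z and theta, then 1 - theta and z. *)
have -> : RelationGroup Kz = RelationGroup (Kid z t Kt) + RelationGroup (Kid y z Kz).
  apply: val_inj; rewrite (raddfD (val : relation_group p G -> burnside G)) /=.
  apply: mark_eq => T sTG; rewrite (raddfD (mark T)) /= !mark_mul // (raddfB (mark T)) /= mark1 //.
  by rewrite mulrBl mul1r mulrC addrC subrK.
by rewrite rpredD //; [exact: (mul_imprim z0 Kt) | exact: (mul_imprim y0 Kz)].
Qed.

(** An element induced from a proper subgroup has mark 0 at G, so only the inflations matter. *)
Lemma top_mark_imprim (d : int) (v : relation_group p G) :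
    (forall (N : {group gT}) (x : burnside (G / N)%G), (N <| G)%g -> (N :!=: 1)%g ->
       x \in is_relation p (G:=(G / N)%G) -> (d %| mark (G / N)%g x)%Z) ->
  v \in imprim (p:=p) (G:=G) -> (d %| top_mark v)%Z.
Proof.
move=> dN; apply: (@zspan_ind _ _ (fun v => is_true (d %| top_mark v)%Z)).
- by rewrite raddf0 dvdz0.
- by move=> x y dx dy; rewrite raddfB rpredB.
move=> x [[H [y [prH defx]]] | [N [[y Ky] [nsN ntN defx]]]]; rewrite /top_mark defx.
  rewrite (mark_ind _ (subxx G) (proper_sub prH)) big1 ?dvdz0 // => C /andP[/rcosetsP[g Gg ->] sG].
  have [h Hh defr] := mem_repr_rcosetP H g.
  case/properP: prH => sHG [a Ga nHa]; case/negP: nHa.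
  have Gr : fingroup.repr (H :* g)%g \in G by rewrite defr groupM // (fintype.subsetP sHG).
  move: sG; rewrite -{1}(conjGid Gr) conjSg => /fintype.subsetP; exact.
by rewrite /= mark_infl // dN.
Qed.

Lemma inflated_top_mark (N : {group gT}) (n : int) : (N <| G)%g -> (N :!=: 1)%g ->
    (exists2 x, x \in is_relation p (G:=(G / N)%G) & mark (G / N)%g x = n) ->
  exists2 v, v \in imprim (p:=p) (G:=G) & top_mark v = n.
Proof.
move=> nsN ntN [x Kx markx].
exists (RelationGroup (infl_relation nsN Kx)); last by rewrite /top_mark /= mark_infl.
by apply: mem_zspan; right; exists N, (RelationGroup Kx).
Qed.

Lemma imprim_top_mark (theta w v : relation_group p G) :
    top_mark theta = 1 -> w \in imprim (p:=p) (G:=G) -> (top_mark w %| top_mark v)%Z ->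
  v \in imprim (p:=p) (G:=G).
Proof.
move=> t1 Iw /dvdzP[k defv]; rewrite -(subrK (w *~ k) v) rpredD ?rpredMz //.
by apply: (top_mark0_imprim t1); rewrite raddfB raddfMz /= mulrzz defv mulrC subrr.
Qed.

Lemma prim_classE (v w : relation_group p G) :
  (prim_class v == prim_class w) = (v - w \in imprim (p:=p) (G:=G)).
Proof. by rewrite Quotient.idealrBE. Qed.

Lemma prim_isom (V : zmodType) (g : {additive relation_group p G -> V}) (s : V -> relation_group p G) :
    (forall v, (v \in imprim (p:=p) (G:=G)) = (g v == 0)) -> cancel s g ->
  zmod_isom (prim p G) V.
Proof.
move=> kerg sK; pose f (u : prim p G) : V := g (repr u).
have fE v : f (prim_class v) = g v.
  apply/eqP; rewrite -subr_eq0 -raddfB -kerg -prim_classE.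
  by rewrite /prim_class reprK.
have fB : zmod_morphism f.
  move=> u w; rewrite -[u]reprK -[w]reprK.
  by rewrite -[in LHS](raddfB (\pi_(prim p G))) -!/(prim_class _) !fE raddfB.
pose F : {additive prim p G -> V} := HB.pack f (GRing.isZmodMorphism.Build _ _ f fB).
exists F; exists (fun v => prim_class (s v)) => [u|v] /=; last by rewrite fE sK.
rewrite -[RHS]reprK; apply/eqP; rewrite -/(prim_class (repr u)) prim_classE kerg raddfB sK.
by rewrite subrr.
Qed.

End RelationMarks.

Lemma intr_Zp_eq0 (q : nat) (n : int) : (1 < q)%N -> (n%:~R == 0 :> 'Z_q) = (q %| n)%Z.
Proof.
move=> q_gt1; have natr0 m : (m%:R == 0 :> 'Z_q) = (q %| m)%N.
  by rewrite Zp_nat -val_eqE /= Zp_cast // /dvdn.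
by rewrite dvdzE absz_nat; case: n => n; rewrite ?NegzE ?mulrNz ?oppr_eq0 -pmulrn natr0 ?abszN.
Qed.

(** * The three cases for the primitive quotient, and its generators *)

Section Primitive.
Import generic_quotient.
Local Open Scope quotient_scope.
Variables (p : nat) (gT : finGroupType) (G : {group gT}).
Variable theta : relation_group p G.
Hypotheses (p_prime : prime p) (theta1 : top_mark theta = 1).

Lemma prim_isom_int :
    (forall N : {group gT}, (N <| G)%g -> (N :!=: 1)%g -> hypo_elementary p (G / N)%g) ->
  zmod_isom (prim p G) int.
Proof.
move=> hypoN; apply: (@prim_isom p gT G int (@top_mark p gT G) (fun n => theta *~ n)) => [v|n].
  apply/idP/eqP => [Iv | v0]; last exact: top_mark0_imprim theta1 v0.
  apply/eqP; rewrite -dvd0z; apply: top_mark_imprim Iv => N x nsN ntN Kx.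
  by rewrite (relation_mark_hypo p_prime Kx (subxx _)) // hypoN.
by rewrite raddfMz /= theta1 intz.
Qed.

Lemma prim_isom_Zp (q : nat) : prime q ->
    (forall N : {group gT}, (N <| G)%g -> (N :!=: 1)%g -> Dress_group p q (G / N)%g) ->
    (exists N : {group gT}, [/\ (N <| G)%g, (N :!=: 1)%g & ~~ hypo_elementary p (G / N)%g]) ->
  zmod_isom (prim p G) 'Z_q.
Proof.
move=> q_prime DN [N [nsN ntN nhypoN]]; have q_gt1 := prime_gt1 q_prime.
have [w Iw markw] := inflated_top_mark nsN ntN (relation_mark_prime p_prime q_prime (DN N nsN ntN) nhypoN).
pose g (v : relation_group p G) : 'Z_q := (top_mark v)%:~R.
have gB : zmod_morphism g by move=> u v; rewrite /g raddfB rmorphB.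
pose g' : {additive relation_group p G -> 'Z_q} := HB.pack g (GRing.isZmodMorphism.Build _ _ g gB).
apply: (@prim_isom p gT G 'Z_q g' (fun x => theta *+ x)) => [v|x] /=; last first.
  by rewrite /g raddfMn /= theta1 rmorphMn /= natr_Zp.
rewrite /g intr_Zp_eq0 //; apply/idP/idP => [Iv|].
  by apply: top_mark_imprim Iv => M x nsM ntM Kx; apply: Dress_mark_dvd (DN M nsM ntM) Kx.
by rewrite -markw; apply: imprim_top_mark theta1 Iw.
Qed.

Lemma prim_trivial :
    (exists N : {group gT}, [/\ (N <| G)%g, (N :!=: 1)%g &
       forall q : nat, prime q -> ~~ Dress_group p q (G / N)%g]) \/
    (exists (q1 q2 : nat) (N1 N2 : {group gT}),
       [/\ prime q1, prime q2, q1 != q2,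
           [/\ (N1 <| G)%g, (N1 :!=: 1)%g, Dress_group p q1 (G / N1)%g &
               ~~ hypo_elementary p (G / N1)%g] &
           [/\ (N2 <| G)%g, (N2 :!=: 1)%g, Dress_group p q2 (G / N2)%g &
               ~~ hypo_elementary p (G / N2)%g]]) ->
  forall v : relation_group p G, v \in imprim (p:=p) (G:=G).
Proof.
move=> cases v; suff [w Iw markw] : exists2 w, w \in imprim (p:=p) (G:=G) & top_mark w = 1.
  by apply: (imprim_top_mark theta1 Iw); rewrite markw dvd1z.
case: cases => [[N [nsN ntN nDN]] | [q1 [q2 [N1 [N2]]]]].
  exact: inflated_top_mark nsN ntN (relation_mark1 p_prime nDN).
case=> q1_prime q2_prime neq12 [nsN1 ntN1 D1 nhypo1] [nsN2 ntN2 D2 nhypo2].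
have [w1 Iw1 mark1] := inflated_top_mark nsN1 ntN1 (relation_mark_prime p_prime q1_prime D1 nhypo1).
have [w2 Iw2 mark2] := inflated_top_mark nsN2 ntN2 (relation_mark_prime p_prime q2_prime D2 nhypo2).
(* Inflations supply the top marks q1 and q2; these are coprime, so some combination has top mark
   1. *)
have [a [b eqab]] : exists a, exists b, a * q1%:Z + b * q2%:Z = 1.
  have [a [b eqab]] := Bezoutz q1 q2; exists a, b; rewrite eqab.
  by congr Posz; apply/eqP; rewrite -/(coprime q1 q2) prime_coprime // dvdn_prime2.
exists (w1 *~ a + w2 *~ b); first by rewrite rpredD ?rpredMz.
by rewrite raddfD !raddfMz /= !mulrzz mark1 mark2 mulrC [_ * b]mulrC.
Qed.

Lemma prim_generated (x : prim p G) : exists n : int, x = prim_class theta *~ n.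
Proof.
rewrite -[x]reprK; set v := generic_quotient.repr x; exists (top_mark v).
rewrite -[LHS]/(prim_class v) -[RHS](raddfMz (\pi_(prim p G)%qT)); apply/eqP.
rewrite prim_classE; apply: (top_mark0_imprim theta1).
by rewrite raddfB raddfMz /= theta1 mulrzz mul1r subrr.
Qed.

End Primitive.

Local Open Scope group_scope.

Theorem theorem1p2 (p : nat) (p_prime : prime p)
    (gT : finGroupType) (G : {group gT})
    (G_not_Dress : forall q : nat, prime q -> ~~ Dress_group p q G) :
  [/\ (forall N : {group gT}, N <| G -> N :!=: 1 -> hypo_elementary p (G / N)) ->
        zmod_isom (prim p G) int,
      forall q : nat, prime q ->
        (forall N : {group gT}, N <| G -> N :!=: 1 -> Dress_group p q (G / N)) ->
        (exists N : {group gT},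
           [/\ N <| G, N :!=: 1 & ~~ hypo_elementary p (G / N)]) ->
        zmod_isom (prim p G) 'Z_q,
      (exists N : {group gT},
         [/\ N <| G, N :!=: 1 &
             forall q : nat, prime q -> ~~ Dress_group p q (G / N)]) \/
      (exists (q1 q2 : nat) (N1 N2 : {group gT}),
         [/\ prime q1, prime q2, q1 != q2,
             [/\ N1 <| G, N1 :!=: 1, Dress_group p q1 (G / N1) &
                 ~~ hypo_elementary p (G / N1)] &
             [/\ N2 <| G, N2 :!=: 1, Dress_group p q2 (G / N2) &
                 ~~ hypo_elementary p (G / N2)]]) ->
        forall x : prim p G, x = 0%R
    & forall (theta : relation_group p G) (a : {group gT} -> int),
        relation_val theta =
          (coset_class G G + \sum_(H : {group gT} | H \proper G)
                               coset_class G H *~ a H)%R ->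
        forall x : prim p G, exists n : int, x = (prim_class theta *~ n)%R].
Proof.
have [t Kt markt] := relation_mark1 p_prime G_not_Dress.
pose theta0 : relation_group p G := RelationGroup Kt.
have theta1 : top_mark theta0 = 1%R by [].
split.
- exact: prim_isom_int theta1.
- exact: prim_isom_Zp theta1.
- move=> cases x; have [n ->] := prim_generated theta1 x.
  have /eqP -> : prim_class theta0 == prim_class 0%R.
    by rewrite prim_classE subr0; apply: prim_trivial theta1 cases _.
  by rewrite [prim_class _]raddf0 mul0rz.
(* Among the terms of [theta] only [G/G] has a nonzero mark at G, so [theta] has top mark 1 and
   generates just as [theta0] does. *)
move=> theta a deft; apply: prim_generated.
rewrite /top_mark deft (raddfD (mark G)) /= mark1 // raddf_sum /= big1 ?addr0 // => H prH.
by rewrite (raddfMz (mark G)) /= mark_coset // nfix_proper // mul0rz.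
Qed.
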